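(* Let $k$ be an algebraically closed field. Suppose that $A=\bigoplus_{n\in\mathbb{Z}}A_n$ is a finitely generated $\mathbb{Z}$-graded $k$-algebra with $A_n\neq 0$ for all $n\in\mathbb{Z}$, which is an Ore domain with graded quotient ring $Q = Q_{\rm gr}(A) = K[t, t^{-1}; \sigma]$, where $K$ is a field with $\operatorname{tr.deg}(K/k) = d$ and $\operatorname{GKdim}(A) = d+1$. Assume that $Q$ has center $k$. Then $K = k(x_1, \dots, x_d)$ is a rational function field in indeterminates $x_i$ over $k$, and $A_0 \subseteq T$ where $\sigma(T) = T$ and one of the following two cases occurs: (A) $\sigma(x_1) = x_1 + 1$, $\sigma(x_i) = p_i x_i$ for all $i \geq 2$, for some $p_2, \dots, p_d$ which generate a free abelian subgroup of $k^{\times}$, $\operatorname{char} k = 0$, and $T = k[x_1, x_2^{\pm 1}, \dots, x_d^{\pm 1}]$; or (B) $\sigma(x_i) = p_i x_i$ for all $i \geq 1$, for some $p_1, \dots, p_d$ which generate a free abelian subgroup of $k^{\times}$, and $T = k[x_1^{\pm 1}, x_2^{\pm 1}, \dots, x_d^{\pm 1}]$. Moreover, if $A$ is simple, then $A_0 = T$.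
   Context: For a $\mathbb{Z}$-graded $k$-algebra $A$ which is an Ore domain, $Q_{\rm gr}(A)$ is the graded quotient ring: the localization of $A$ at the set of nonzero homogeneous elements. $K[t,t^{-1};\sigma]$ is the skew-Laurent ring with $ta=\sigma(a)t$ for $a\in K$, where $\sigma$ is a $k$-automorphism of $K$; $K$ is in degree $0$ and $t$ in degree $1$. $\operatorname{GKdim}$ denotes Gelfand-Kirillov dimension over $k$. *)

(* Defs.v *)
From HB Require Import structures.
From mathcomp Require Import all_boot all_order all_algebra.
From mathcomp Require Import finmap.
From mathcomp.multinomials Require mpoly monalg.
Import -(notations) mpoly monalg.
From mathcomp Require Import boolp classical_sets functions reals.
From mathcomp Require Import constructive_ereal ereal sequences exp.
From mathcomp Require Import topology normedtype.

Set Implicit Arguments.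
Unset Strict Implicit.
Unset Printing Implicit Defensive.

Import Order.TTheory GRing.Theory Num.Theory.
Local Open Scope classical_set_scope.
Local Open Scope ring_scope.

Section SkewPower.
Variables (K : nzRingType) (s : {rmorphism K -> K}).

Definition aut_inv (y : K) : K := xget 0 [set x | s x = y].

Definition aut_pow (n : int) : K -> K :=
  match n with
  | Posz m => iter m s
  | Negz m => iter m.+1 aut_inv
  end.

Hypothesis s_bij : bijective s.

Lemma aut_invK : cancel aut_inv s.
Proof.
move=> y; rewrite /aut_inv; case: xgetP => [x _ //|noy].
by case: s_bij => s' _ s'K; case: (noy (s' y)); rewrite /= s'K.
Qed.

Lemma autK : cancel s aut_inv.
Proof. by move=> x; apply: (bij_inj s_bij); rewrite aut_invK. Qed.

Lemma aut_powS n x : aut_pow (n + 1) x = s (aut_pow n x).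
Proof.
case: n => [m|[|m]].
- by rewrite -PoszD addn1.
- by rewrite /= aut_invK.
- have -> : Negz m.+1 + 1 = Negz m by rewrite !NegzE -[m.+2]addn1 PoszD opprD addrNK.
  by rewrite /= aut_invK.
Qed.

Lemma aut_powP n x : aut_pow (n - 1) x = aut_inv (aut_pow n x).
Proof. by rewrite -[in RHS](subrK 1 n) aut_powS autK. Qed.

Lemma aut_powD m n x : aut_pow (m + n) x = aut_pow m (aut_pow n x).
Proof.
elim/int_rect: m => [|m IH|m IH]; first by rewrite add0r.
- have -> : (m.+1%:Z = m%:Z + 1) by rewrite -PoszD addn1.
  by rewrite addrAC !aut_powS IH.
- have -> : (- m.+1%:Z = - m%:Z - 1) by rewrite -opprD -PoszD addn1.
  by rewrite addrAC !aut_powP IH.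
Qed.

Lemma aut_pow_zmod n : zmod_morphism (aut_pow n).
Proof.
move=> x y; elim/int_rect: n => [//|n IH|n IH].
- have -> : (n.+1%:Z = n%:Z + 1) by rewrite -PoszD addn1.
  by rewrite !aut_powS IH rmorphB.
- have -> : (- n.+1%:Z = - n%:Z - 1) by rewrite -opprD -PoszD addn1.
  by rewrite !aut_powP IH; apply: (bij_inj s_bij); rewrite rmorphB !aut_invK.
Qed.

Lemma aut_pow1 n : aut_pow n 1 = 1.
Proof.
elim/int_rect: n => [//|n IH|n IH].
- have -> : (n.+1%:Z = n%:Z + 1) by rewrite -PoszD addn1.
  by rewrite !aut_powS IH rmorph1.
- have -> : (- n.+1%:Z = - n%:Z - 1) by rewrite -opprD -PoszD addn1.
  by rewrite !aut_powP IH; apply: (bij_inj s_bij); rewrite rmorph1 !aut_invK.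
Qed.

Lemma aut_powM n : {morph aut_pow n : x y / x * y}.
Proof.
move=> x y; elim/int_rect: n => [//|n IH|n IH].
- have -> : (n.+1%:Z = n%:Z + 1) by rewrite -PoszD addn1.
  by rewrite !aut_powS IH rmorphM.
- have -> : (- n.+1%:Z = - n%:Z - 1) by rewrite -opprD -PoszD addn1.
  by rewrite !aut_powP IH; apply: (bij_inj s_bij); rewrite rmorphM !aut_invK.
Qed.

End SkewPower.

(** Elements are finitely supported families (a_n)_n of coefficients, standing
    for \sum_n a_n t^n.  The bijectivity proof is a parameter of the type so
    that the ring structure can be inferred. *)
Definition skewLaurent (K : nzRingType) (s : {rmorphism K -> K})
  (s_bij : bijective s) : Type := @monalg.malg int K.

Section SkewLaurent.
Variables (K : nzRingType) (s : {rmorphism K -> K}) (s_bij : bijective s).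

Local Notation Q := (skewLaurent s_bij).
Local Notation supp := (@monalg.msupp int K).
Local Notation coef := (@monalg.mcoeff int K).

HB.instance Definition _ := GRing.Zmodule.copy Q (@monalg.malg int K).

(** [slmono n a] is a t^n *)
Definition slmono (n : int) (a : K) : Q := @monalg.mkmalgU int K n a.

(** a t^m * b t^n = a s^m(b) t^(m+n), extended biadditively *)
Definition slmul (f g : Q) : Q :=
  \sum_(m <- supp f) \sum_(n <- supp g)
    slmono (m + n) (coef m f * aut_pow s m (coef n g)).

Lemma slmono_zmod n : zmod_morphism (slmono n).
Proof. exact: monalg.monalgUB. Qed.
HB.instance Definition _ n :=
  GRing.isZmodMorphism.Build K Q (slmono n) (slmono_zmod n).

HB.instance Definition _ n :=
  GRing.isZmodMorphism.Build K K (aut_pow s n) (aut_pow_zmod s_bij n).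

Lemma slmulEw (D E : {fset int}) (f g : Q) :
  (supp f `<=` D)%fset -> (supp g `<=` E)%fset ->
  slmul f g = \sum_(m <- D) \sum_(n <- E)
    slmono (m + n) (coef m f * aut_pow s m (coef n g)).
Proof.
move=> fD gE; rewrite /slmul [RHS](big_fsetID _ (mem (supp f))) /=.
rewrite [X in _ = _ + X]big1_fset ?addr0; last first.
  move=> m; rewrite !inE => /andP[_ /monalg.mcoeff_outdom ->] _.
  by rewrite big1 // => n _; rewrite mul0r raddf0.
have -> : [fset x in D | mem (supp f) x]%fset = supp f.
  by apply/fsetP => x; rewrite !inE; apply: andb_idl => /(fsubsetP fD).
apply: eq_bigr => m _.
rewrite [RHS](big_fsetID _ (mem (supp g))) /=.
rewrite [X in _ = _ + X]big1_fset ?addr0; last first.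
  move=> n; rewrite !inE => /andP[_ /monalg.mcoeff_outdom ->] _.
  by rewrite raddf0 mulr0 raddf0.
have -> // : [fset x in E | mem (supp g) x]%fset = supp g.
by apply/fsetP => x; rewrite !inE; apply: andb_idl => /(fsubsetP gE).
Qed.

Lemma slmulDl : left_distributive slmul +%R.
Proof.
move=> f1 f2 g; pose D := (supp f1 `|` supp f2)%fset.
have D1 : (supp f1 `<=` D)%fset by apply: fsubsetUl.
have D2 : (supp f2 `<=` D)%fset by apply: fsubsetUr.
have D12 : (supp (f1 + f2 : monalg.malg _ _) `<=` D)%fset.
  exact: monalg.msuppD_le.
rewrite (slmulEw D1 (fsubset_refl _)) (slmulEw D2 (fsubset_refl _)).
rewrite (slmulEw D12 (fsubset_refl _)) -big_split; apply: eq_bigr => m _.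
rewrite -big_split; apply: eq_bigr => n _ /=.
by rewrite monalg.mcoeffD mulrDl raddfD.
Qed.

Lemma slmulDr : right_distributive slmul +%R.
Proof.
move=> f g1 g2; pose D := (supp g1 `|` supp g2)%fset.
have D1 : (supp g1 `<=` D)%fset by apply: fsubsetUl.
have D2 : (supp g2 `<=` D)%fset by apply: fsubsetUr.
have D12 : (supp (g1 + g2 : monalg.malg _ _) `<=` D)%fset.
  exact: monalg.msuppD_le.
rewrite (slmulEw (fsubset_refl _) D1) (slmulEw (fsubset_refl _) D2).
rewrite (slmulEw (fsubset_refl _) D12) -big_split; apply: eq_bigr => m _.
rewrite -big_split; apply: eq_bigr => n _ /=.
by rewrite monalg.mcoeffD raddfD mulrDr raddfD.
Qed.

Lemma slmul_mono m n a b :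
  slmul (slmono m a) (slmono n b) = slmono (m + n) (a * aut_pow s m b).
Proof.
rewrite (slmulEw (@monalg.msuppU_le _ _ m a) (@monalg.msuppU_le _ _ n b)).
by rewrite !big_seq_fset1 !monalg.mcoeffUU.
Qed.

Lemma slmonoE (f : Q) : f = \sum_(n <- supp f) slmono n (coef n f).
Proof. exact: monalg.monalgE. Qed.

Lemma slmul_suml I (r : seq I) (F : I -> Q) g :
  slmul (\sum_(i <- r) F i) g = \sum_(i <- r) slmul (F i) g.
Proof.
apply: (big_morph (slmul^~ g)) => [f1 f2|]; first exact: slmulDl.
by apply: (addrI (slmul 0 g)); rewrite -slmulDl !addr0.
Qed.

Lemma slmul_sumr I (r : seq I) (F : I -> Q) f :
  slmul f (\sum_(i <- r) F i) = \sum_(i <- r) slmul f (F i).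
Proof.
apply: (big_morph (slmul f)) => [g1 g2|]; first exact: slmulDr.
by apply: (addrI (slmul f 0)); rewrite -slmulDr !addr0.
Qed.

Lemma slmulA : associative slmul.
Proof.
move=> f g h; rewrite [f]slmonoE [g]slmonoE [h]slmonoE.
rewrite !slmul_suml; apply: eq_bigr => m _.
rewrite slmul_sumr (slmul_sumr _ _ (slmono m _)) slmul_suml.
apply: eq_bigr => n _; rewrite !slmul_sumr; apply: eq_bigr => p _.
by rewrite !slmul_mono addrA (aut_powM s_bij) mulrA (aut_powD s_bij).
Qed.

Lemma slmul1l : left_id (slmono 0 1) slmul.
Proof.
move=> f; rewrite [f]slmonoE slmul_sumr; apply: eq_bigr => n _.
by rewrite slmul_mono add0r mul1r.
Qed.

Lemma slmul1r : right_id (slmono 0 1) slmul.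
Proof.
move=> f; rewrite [f]slmonoE slmul_suml; apply: eq_bigr => n _.
by rewrite slmul_mono addr0 (aut_pow1 s_bij) mulr1.
Qed.

Lemma slmono1_neq0 : slmono 0 1 != 0.
Proof.
apply/eqP => /(congr1 (coef 0)) /eqP.
by rewrite monalg.mcoeffUU monalg.mcoeff0 oner_eq0.
Qed.

HB.instance Definition _ := GRing.Zmodule_isNzRing.Build Q
  slmulA slmul1l slmul1r slmulDl slmulDr slmono1_neq0.

Definition slC (a : K) : Q := slmono 0 a.
Definition slT : Q := slmono 1 1.

Lemma slT_skew a : slT * slC a = slC (s a) * slT.
Proof. by rewrite /GRing.mul /= !slmul_mono addr0 add0r mul1r mulr1. Qed.

Lemma slmono_CT (n : nat) a : slmono n a = slC a * slT ^+ n.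
Proof.
elim: n a => [|n IH] a; first by rewrite expr0 mulr1.
rewrite exprSr mulrA -IH /GRing.mul /= slmul_mono.
by rewrite (aut_pow1 s_bij) mulr1 -PoszD addn1.
Qed.

Lemma slmono_CTN (n : nat) a : slmono (- n%:Z) a * slT ^+ n = slC a.
Proof.
rewrite -[slT ^+ n]mul1r -[1]/(slC 1) -slmono_CT.
by rewrite {1}/GRing.mul /= slmul_mono addNr (aut_pow1 s_bij) mulr1.
Qed.

Definition sl_degree (n : int) : set Q := range (slmono n).

End SkewLaurent.

Definition subspace (k : nzRingType) (V : lmodType k) (U : set V) : Prop :=
  U 0 /\ forall (c : k) u v, U u -> U v -> U (c *: u + v).

Definition lspan (k : nzRingType) (V : lmodType k) (X : set V) : set V :=
  smallest (@subspace k V) X.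

Definition lin_indep (k : nzRingType) (V : lmodType k) n (b : 'I_n -> V) : Prop :=
  forall c : 'I_n -> k, \sum_(i < n) c i *: b i = 0 -> forall i, c i = 0.

Definition is_basis (k : nzRingType) (V : lmodType k) (U : set V)
    n (b : 'I_n -> V) : Prop :=
  lin_indep b /\ lspan (range b) = U.

(** 0 by convention on infinite-dimensional subspaces *)
Definition vdim (k : nzRingType) (V : lmodType k) (U : set V) : nat :=
  xget 0%N [set n | exists b : 'I_n -> V, is_basis U b].

(** [h : k -> B] is the structure map of the k-algebra B *)
Definition subalgebra (k B : nzRingType) (h : k -> B) (S : set B) : Prop :=
  [/\ forall c, S (h c), forall a b, S a -> S b -> S (a - b)
    & forall a b, S a -> S b -> S (a * b)].

Definition gen_subalgebra (k B : nzRingType) (h : k -> B) (X : set B) : set B :=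
  smallest (subalgebra h) X.

Definition subfield (k K : fieldType) (h : k -> K) (F : set K) : Prop :=
  subalgebra h F /\ forall a, F a -> F a^-1.

Definition gen_subfield (k K : fieldType) (h : k -> K) (X : set K) : set K :=
  smallest (subfield h) X.

Definition finitely_generated (k : fieldType) (A : algType k) : Prop :=
  exists s : seq A, gen_subalgebra (in_alg A) [set` s] = setT.

Definition alg_indep (k K : fieldType) (h : k -> K) d (x : 'I_d -> K) : Prop :=
  forall p : mpoly.mpoly d k, mpoly.mmap h x p = 0 -> p = 0.

Definition algebraic_over (K : fieldType) (F : set K) (y : K) : Prop :=
  exists p : {poly K}, [/\ p != 0, forall i, F p`_i & root p y].

Definition trdeg_eq (k K : fieldType) (h : k -> K) (d : nat) : Prop :=
  exists x : 'I_d -> K,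
    alg_indep h x /\ forall y, algebraic_over (gen_subfield h (range x)) y.

(** If V is spanned by s, this is V^0 + V^1 + ... + V^n. *)
Definition power_space (k : fieldType) (A : algType k) (s : seq A) (n : nat)
    : set A :=
  lspan [set \prod_(a <- w) a | w in [set w : seq A |
           (size w <= n)%N /\ {subset w <= s}]].

(** The supremum is over all finite-dimensional subspaces V, each presented by
    a finite spanning sequence s. *)
Definition GKdim (R : realType) (k : fieldType) (A : algType k) : \bar R :=
  ereal_sup [set limn_esup (fun n : nat =>
      (ln ((vdim (power_space s n))%:R : R) / ln (n%:R : R))%:E)
    | s in [set: seq A]].

Record Zgrading (k : fieldType) (A : algType k) (gr : int -> set A) : Prop := {
  gr_subspace : forall n, subspace (gr n);
  gr_one : gr 0 1;
  gr_mul : forall m n a b, gr m a -> gr n b -> gr (m + n) (a * b);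
  gr_sum : forall a, exists (r : seq int) (x : int -> A),
    (forall n, gr n (x n)) /\ a = \sum_(n <- r) x n;
  gr_direct : forall (r : seq int) (x : int -> A), uniq r ->
    (forall n, gr n (x n)) -> \sum_(n <- r) x n = 0 ->
    forall n, n \in r -> x n = 0
}.

Definition homogeneous (A : Type) (gr : int -> set A) : set A :=
  \bigcup_(n in [set: int]) gr n.

Record Ore_domain (A : nzRingType) : Prop := {
  Ore_integral : forall a b : A, a * b = 0 -> a = 0 \/ b = 0;
  Ore_right : forall a b : A, a != 0 -> b != 0 ->
    exists x y, a * x = b * y /\ a * x != 0;
  Ore_left : forall a b : A, a != 0 -> b != 0 ->
    exists x y, x * a = y * b /\ x * a != 0
}.

(** [j : A -> Q] identifies the graded ring Q with the localization of A at
    its nonzero homogeneous elements: j is an injective graded k-algebra map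
    ([h : k -> Q] being the structure map of Q) inverting these elements, and
    Q consists of the fractions j(a) j(s)^-1, equally of the j(s)^-1 j(a). *)
Record graded_quotient_ring (k : fieldType) (A : algType k) (gr : int -> set A)
    (Q : nzRingType) (h : k -> Q) (grQ : int -> set Q)
    (j : {rmorphism A -> Q}) : Prop := {
  gqr_alg : forall c : k, j c%:A = h c;
  gqr_inj : injective j;
  gqr_graded : forall n a, gr n a -> grQ n (j a);
  gqr_unit : forall s, homogeneous gr s -> s != 0 ->
    exists u, u * j s = 1 /\ j s * u = 1;
  gqr_right_fraction : forall q, exists a s,
    [/\ homogeneous gr s, s != 0 & q * j s = j a];
  gqr_left_fraction : forall q, exists a s,
    [/\ homogeneous gr s, s != 0 & j s * q = j a]
}.

Definition center (B : nzRingType) : set B :=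
  [set z | forall b, z * b = b * z].
Arguments center B : clear implicits.

Definition two_sided_ideal (B : nzRingType) (I : set B) : Prop :=
  [/\ I 0, forall a b, I a -> I b -> I (a + b)
    & forall b a, I a -> I (b * a) /\ I (a * b)].

Definition simple_ring (B : nzRingType) : Prop :=
  forall I : set B, two_sided_ideal I -> I = [set 0] \/ I = setT.

(** The p_i with P i are nonzero and freely generate an abelian subgroup of the
    multiplicative group: the n_i |-> \prod_i p_i^(n_i) have trivial kernel. *)
Definition freely_generate (k : fieldType) d (P : pred 'I_d) (p : 'I_d -> k)
    : Prop :=
  (forall i, P i -> p i != 0) /\
  forall n : 'I_d -> int, \prod_(i < d | P i) p i ^ n i = 1 ->
    forall i, P i -> n i = 0.

(** the subalgebra generated by all x_i and by the x_i^-1 with P i *)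
Definition partial_laurent (k K : fieldType) (h : k -> K) d (P : pred 'I_d)
    (x : 'I_d -> K) : set K :=
  gen_subalgebra h (range x `|` [set (x i)^-1 | i in [set i | P i]]).

(** x_1 is the variable of index 0. *)
Definition case_A (k K : fieldType) (h : k -> K) (s : K -> K) d
    (x : 'I_d -> K) (T : set K) : Prop :=
  let P := [pred i : 'I_d | (0 < i)%N] in
  [/\ (0 < d)%N /\ forall i : 'I_d, i = 0%N :> nat -> s (x i) = x i + 1,
      exists p : 'I_d -> k,
        freely_generate P p /\ forall i, P i -> s (x i) = h (p i) * x i,
      [pchar k] =i pred0
    & T = partial_laurent h P x].

Definition case_B (k K : fieldType) (h : k -> K) (s : K -> K) d
    (x : 'I_d -> K) (T : set K) : Prop :=
  (exists p : 'I_d -> k,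
     freely_generate predT p /\ forall i, s (x i) = h (p i) * x i) /\
  T = partial_laurent h predT x.

(* Main.v *)
From HB Require Import structures.
From mathcomp Require Import all_boot all_order all_algebra.
From mathcomp.multinomials Require mpoly monalg.
Import -(notations) mpoly.
From mathcomp Require Import boolp classical_sets functions reals.
From mathcomp Require Import constructive_ereal ereal sequences exp.
From mathcomp Require Import ring lra zify.
Require Import Defs.

Set Implicit Arguments.
Unset Strict Implicit.
Unset Printing Implicit Defensive.

Import Order.TTheory GRing.Theory Num.Theory.
Local Open Scope classical_set_scope.
Local Open Scope ring_scope.

(** Identify [A_0] with a subalgebra of [K]; then [K] is its fraction field.

    Suppose that some [v] in [A_0] had translates [v, s v, s^2 v, ...] spanning an
    infinite-dimensional space.  The lexicographic order on a transcendence
    basis extends to a valuation of [K] of rational rank [d] with residue field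
    [k], for which elements of distinct values are independent; so there are
    [n] combinations of the first [n] translates with distinct values.
    Counting sums of values, with [n = r^(d+1)], gives [r n^d] independent
    products of [O(n)] translates, and each of them occurs, up to a fixed
    factor, as a word of length [O(n)] in each of the degrees [n, ..., 2n-1] of
    [A].  Thus words of length [O(n)] span a space of dimension at least
    [n^(d+1+1/(d+1))], which contradicts [GKdim A = d+1].

    Hence [A_0] is spanned by generalized eigenvectors of [s].  As the fixed
    field of [s] is [k], eigenspaces are lines and the unipotent part is [k], or
    [k[y]] with [s y = y + 1] in characteristic zero.  Since [A] is finitely
    generated, [K] is generated by [y] and finitely many eigenvectors, which
    Euclid's algorithm on multiplicative relations makes free; monomials then
    have distinct eigenvalues, so these generators are algebraically
    independent.

    If [A] is simple, then the elements multiplying the whole [s]-orbit of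
    [v] into [A] form a nonzero ideal, so [A_0] is [s]-stable; eigenvectors in
    [A_0] are normal in [A], so their inverses lie in [A_0] too, and this
    forces [A_0 = T]. *)

(** * Valuation rings from maximal nonunital subalgebras *)

(** Monomials in the transcendence basis alone give about [n^d] independent products, and the
    degrees of [A] give another factor [n]: this is exactly the growth that [GKdim A = d + 1]
    allows. So the translates must contribute one more factor, and a power of [n], since a
    logarithmic gain would not change the exponent. The difficulty is that [K] is not yet known to
    be finitely generated, so the values of the translates may lie in infinitely many cosets of the
    lattice [Z^d] of values of monomials. The choice [n = r^(d+1)] settles this by pigeonhole: [n]
    distinct values either meet [r] cosets or put more than [r^d] points into one coset, where some
    coordinate then spreads over at least [r]. Either way the gain is [r = n^(1/(d+1))].

    No value group is built. The valuation is its maximal ideal [M], and values are compared by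
    asking whether quotients lie in [M]. Algebraic closedness makes the residue field equal to [k],
    which is what allows elimination among elements of equal value. *)

Lemma seq_max (T : eqType) (R : T -> T -> Prop) (s : seq T) :
  {in s &, forall x y, R x y \/ R y x} ->
  {in s & &, forall x y z, R x y -> R y z -> R x z} ->
  s != [::] -> exists2 x, x \in s & forall y, y \in s -> R x y.
Proof.
elim: s => // a s IH tot tr _.
have Raa x : x \in a :: s -> R x x by move=> xs; case: (tot x x).
have [->|/IH[||x xs xmax]] := eqVneq s [::].
- by exists a; rewrite ?mem_head // => y; rewrite inE => /eqP ->; apply: Raa; rewrite mem_head.
- by move=> x y xs ys; apply: tot; rewrite inE ?xs ?ys orbT.
- by move=> x y z xs ys zs; apply: tr; rewrite inE ?xs ?ys ?zs orbT.
have xs' : x \in a :: s by rewrite inE xs orbT.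
have ah : a \in a :: s := mem_head a s.
have [ax|xa] := tot a x ah xs'.
  exists a; rewrite ?mem_head // => y ys; move: (ys); rewrite inE => /orP[/eqP ->|/xmax].
    by apply: Raa; rewrite mem_head.
  by apply: tr => //; rewrite mem_head.
by exists x => // y; rewrite inE => /orP[/eqP ->|/xmax].
Qed.

(** * The lexicographic order on exponents, and Laurent monomials *)

Section Lex.
Variable m : nat.
Implicit Types a b : {ffun 'I_m -> int}.

Definition lexpos a : bool :=
  [exists i, (0 < a i) && [forall j : 'I_m, (j < i)%N ==> (a j == 0)]].

Lemma lexposP a : reflect (exists2 i, 0 < a i & forall j : 'I_m, (j < i)%N -> a j = 0)
  (lexpos a).
Proof.
apply: (iffP existsP) => [[i /andP[ai /forallP ji]]|[i ai ji]]; exists i => //.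
  by move=> j lji; apply/eqP; move: (ji j); rewrite lji.
by rewrite ai; apply/forallP => j; apply/implyP => /ji ->.
Qed.

Lemma lexposD a b : lexpos a -> lexpos b -> lexpos (a + b).
Proof.
move=> /lexposP[i ai ji] /lexposP[i' bi ji']; apply/lexposP.
case: (ltngtP i i') => ii.
- exists i; first by rewrite ffunE (ji' i) // addr0.
  by move=> j lj; rewrite ffunE ji // ji' // (ltn_trans lj).
- exists i'; first by rewrite ffunE (ji i') // add0r.
  by move=> j lj; rewrite ffunE ji' // ji // (ltn_trans lj).
- have e : i = i' by apply: val_inj.
  exists i; first by rewrite ffunE addr_gt0 // e.
  by move=> j lj; rewrite ffunE ji // ji' // -e.
Qed.

Lemma lexpos0 : lexpos 0 = false.
Proof. by apply/negbTE/negP => /lexposP[i]; rewrite ffunE ltxx. Qed.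

Lemma lexpos_total a : a != 0 -> lexpos a || lexpos (- a).
Proof.
move=> a0.
have [i0 ai0] : exists i, a i != 0.
  apply: contrapT => h; move/eqP: a0; apply; apply/ffunP => i; rewrite ffunE.
  by apply/eqP; apply: contrapT => /negP hi; apply: h; exists i.
have [i ai imin] := @arg_minnP _ i0 (fun i => a i != 0) (fun i : 'I_m => val i) ai0.
have ji (j : 'I_m) : (j < i)%N -> a j = 0.
  by move=> lj; apply/eqP; apply: contraTT lj; rewrite -leqNgt; apply: imin.
apply/orP; case: (ltrgtP (a i) 0) => hi; [right|left|by rewrite hi eqxx in ai].
  by apply/lexposP; exists i => [|j /ji]; rewrite ffunE ?oppr_gt0 // => ->; rewrite oppr0.
by apply/lexposP; exists i.
Qed.

End Lex.

Section Monomials.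
Variables (K : fieldType) (m : nat) (x : 'I_m -> K).
Implicit Types a b : {ffun 'I_m -> int}.

Definition mono a : K := \prod_i x i ^ a i.

Lemma mono0 : mono 0 = 1.
Proof. by rewrite /mono big1 // => i _; rewrite ffunE expr0z. Qed.

Hypothesis x_neq0 : forall i, x i != 0.

Lemma monoD a b : mono (a + b) = mono a * mono b.
Proof.
rewrite /mono -big_split; apply: eq_bigr => i _.
by rewrite ffunE expfzDr.
Qed.

Lemma mono_neq0 a : mono a != 0.
Proof. by apply/prodf_neq0 => i _; apply: expfz_neq0. Qed.

Lemma monoN a : mono (- a) = (mono a)^-1.
Proof.
apply: (mulfI (mono_neq0 a)).
by rewrite divff ?mono_neq0 // -monoD addrN mono0.
Qed.

Lemma monoB a b : mono (a - b) = mono a / mono b.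
Proof. by rewrite monoD monoN. Qed.

End Monomials.

Section Valuation.
Variables (k K : fieldType) (h : {rmorphism k -> K}).

Record nonunital (M : set K) : Prop := Nonunital {
  nonunitalD : forall a b, M a -> M b -> M (a + b);
  nonunitalM : forall a b, M a -> M b -> M (a * b);
  nonunitalZ : forall c a, M a -> M (h c * a);
  nonunital1 : ~ M 1 }.

(* Zorn is applied to the ideal alone: a maximal nonunital [k]-subalgebra [M]
   of [K] turns out to be the maximal ideal of the valuation ring [vring]. *)
Lemma nonunital_maximal (M0 : set K) : M0 !=set0 -> nonunital M0 ->
  exists M, [/\ M0 `<=` M, nonunital M &
    forall M', nonunital M' -> M `<=` M' -> M' `<=` M].
Proof.
move=> M00 nuM0.
(* The union of the empty chain is empty, so only nonempty members are required to contain [M0]. *)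
pose P := [set A : set K | nonunital A /\ (A !=set0 -> M0 `<=` A)].
have [|M [[nuM' MM0] Mmax]] := @Zorn_bigcup K P.
  move=> F FP tot; split; last first.
    move=> [y [A FA Ay]] z M0z; exists A => //.
    by apply: (FP A FA).2 => //; exists y.
  have two a b : (\bigcup_(X in F) X) a -> (\bigcup_(X in F) X) b ->
      exists2 X, F X & X a /\ X b.
    move=> [X FX Xa] [Y FY Yb]; case: (tot X Y FX FY) => XY.
      by exists Y => //; split => //; apply: XY.
    by exists X => //; split => //; apply: XY.
  split.
  - move=> a b Fa Fb; have [X FX [Xa Xb]] := two a b Fa Fb.
    by exists X => //; apply: (nonunitalD (FP X FX).1).
  - move=> a b Fa Fb; have [X FX [Xa Xb]] := two a b Fa Fb.
    by exists X => //; apply: (nonunitalM (FP X FX).1).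
  - by move=> c a [X FX Xa]; exists X => //; apply: (nonunitalZ (FP X FX).1).
  - by move=> [X FX X1]; apply: (nonunital1 (FP X FX).1).
have PM0 : P M0 by split => // _ y.
have M_neq0 : M !=set0.
  apply: contrapT => /set0P/negP/negPn/eqP M0'.
  apply: (Mmax M0) => //; rewrite M0'; split => [y []|sub].
  by case: M00 => y /sub.
exists M; split => //; first exact: MM0.
move=> M' nuM1 sub; apply: contrapT => nsub.
by apply: (Mmax M') => //; split => // _ y /MM0 My; apply: sub; apply: My.
Qed.

Variable M : set K.
Hypothesis nuMM : nonunital M.
Hypothesis M_neq0 : M !=set0.
Hypothesis M_max : forall M', nonunital M' -> M `<=` M' -> M' `<=` M.

Definition vring : set K := [set a | forall m, M m -> M (a * m)].

Lemma M_zero : M 0.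
Proof. by case: M_neq0 => y /(nonunitalZ nuMM 0); rewrite rmorph0 mul0r. Qed.

Lemma M_opp a : M a -> M (- a).
Proof. by move=> /(nonunitalZ nuMM (-1)); rewrite rmorphN1 mulN1r. Qed.

Lemma M_sub a b : M a -> M b -> M (a - b).
Proof. by move=> Ma /M_opp; apply: nonunitalD. Qed.

Lemma M_sum (I : Type) (r : seq I) (P : pred I) (F : I -> K) :
  (forall i, P i -> M (F i)) -> M (\sum_(i <- r | P i) F i).
Proof. by move=> MF; apply: big_ind => //; [exact: M_zero|exact: nonunitalD]. Qed.

Lemma M_1B_neq0 m : M m -> 1 - m != 0.
Proof.
by move=> Mm; apply: contra_notN (nonunital1 nuMM); rewrite subr_eq0 => /eqP ->.
Qed.

(** The fractions [a / (1 - m)] again form a nonunital subalgebra containing [M], so maximality puts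
    them in [M]. *)
Lemma M_div1B a m : M a -> M m -> M (a / (1 - m)).
Proof.
move=> Ma Mm; pose M' := [set z | exists a m, [/\ M a, M m & z = a / (1 - m)]].
have : M `<=` M'.
  move=> z Mz; exists z, 0; split => //; first exact: M_zero.
  by rewrite subr0 divr1.
have nM' : nonunital M'.
  split.
  - move=> _ _ [a1 [m1 [A1 B1 ->]]] [a2 [m2 [A2 B2 ->]]].
    exists (a1 + a2 - (a1 * m2 + a2 * m1)), (m1 + m2 - m1 * m2); split.
    + by do 2!apply: M_sub || apply: (nonunitalD nuMM) => //; apply: nonunitalM.
    + by apply: M_sub; [apply: nonunitalD|apply: nonunitalM].
    + rewrite addf_div ?M_1B_neq0 //; congr (_ / _); ring.
  - move=> _ _ [a1 [m1 [A1 B1 ->]]] [a2 [m2 [A2 B2 ->]]].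
    exists (a1 * a2), (m1 + m2 - m1 * m2); split.
    + exact: nonunitalM.
    + by apply: M_sub; [apply: nonunitalD|apply: nonunitalM].
    + rewrite mulf_div; congr (_ / _); ring.
  - move=> c _ [a1 [m1 [A1 B1 ->]]]; exists (h c * a1), m1; split => //.
      exact: nonunitalZ.
    by rewrite mulrA.
  - move=> [a1 [m1 [A1 B1 e]]]; apply: (nonunital1 nuMM).
    have -> : 1 = a1 + m1 :> K; last exact: nonunitalD.
    have := congr1 (fun z => z * (1 - m1)) e.
    rewrite mul1r divfK ?M_1B_neq0 // => /eqP; rewrite subr_eq => /eqP; exact.
by move=> sub; apply: (M_max nM' sub); exists a, m.
Qed.

Lemma vringD a b : vring a -> vring b -> vring (a + b).
Proof. by move=> Oa Ob m Mm; rewrite mulrDl; apply: nonunitalD; auto. Qed.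

Lemma vringM a b : vring a -> vring b -> vring (a * b).
Proof. by move=> Oa Ob m Mm; rewrite -mulrA; auto. Qed.

Lemma vringC c : vring (h c).
Proof. by move=> m; apply: nonunitalZ. Qed.

Lemma vring1 : vring 1.
Proof. by rewrite -(rmorph1 h); apply: vringC. Qed.

Lemma M_vring a : M a -> vring a.
Proof. by move=> Ma m; apply: nonunitalM. Qed.

Lemma vringX a n : vring a -> vring (a ^+ n).
Proof.
by move=> Oa; elim: n => [|n IH]; rewrite ?expr0 ?exprS; [exact: vring1|exact: vringM].
Qed.

(* The degree-lowering step in the proof of Chevalley's extension theorem. *)
Lemma vring_reduce (a : K) (p q : {poly K}) : a != 0 ->
  (forall i, M p`_i) -> (forall i, M q`_i) -> p.[a] = 1 -> q.[a^-1] = 1 ->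
  (size q <= size p)%N ->
  exists p' : {poly K}, [/\ forall i, M p'`_i, p'.[a] = 1 & (size p' < size p)%N].
Proof.
move=> a0 Mp Mq pa qa sqp.
have q_gt0 : (0 < size q)%N.
  rewrite lt0n size_poly_eq0; apply: contra_eq_neq qa => ->.
  by rewrite horner0 eq_sym oner_neq0.
have [m sq] : {m | size q = m.+1} by exists (size q).-1; rewrite prednK.
have p_gt0 := leq_trans q_gt0 sqp.
have [n sp] : {n | size p = n.+1} by exists (size p).-1; rewrite prednK.
have mn : (m <= n)%N by rewrite -ltnS -sq -sp.
pose r i := q`_i.+1 / (1 - q`_0).
have Mr i : M (r i) by apply: M_div1B.
have ean : a ^+ n = \sum_(i < m) r i * a ^+ (n - i.+1).
  have : (1 - q`_0) * a ^+ n = \sum_(i < m) q`_i.+1 * a ^+ (n - i.+1).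
    rewrite -[in LHS]qa horner_coef sq big_ord_recl expr0 mulr1 addrAC subrr add0r.
    rewrite mulr_suml; apply: eq_bigr => i _.
    rewrite -mulrA; congr (_ * _); rewrite lift0 /= exprVn.
    have ilt : (i.+1 <= n)%N by apply: leq_trans mn.
    by rewrite -{1}(subnK ilt) exprD mulrCA mulVf ?mulr1 // expf_neq0.
  move=> e; apply: (mulfI (M_1B_neq0 (Mq 0%N))); rewrite e mulr_sumr.
  by apply: eq_bigr => i _; rewrite mulrA [_ * r i]mulrC divfK ?M_1B_neq0.
exists (\poly_(i < n) p`_i + \sum_(i < m) (p`_n * r i) *: 'X^(n - i.+1)); split.
- move=> i; rewrite coefD coef_poly coef_sum; apply: nonunitalD => //.
    by case: ifP => // _; apply: M_zero.
  apply: M_sum => j _; rewrite coefZ coefXn; case: eqP => _.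
    by rewrite mulr1; apply: nonunitalM.
  by rewrite mulr0; apply: M_zero.
- rewrite hornerD horner_sum -pa horner_poly [in RHS]horner_coef sp big_ord_recr /=.
  congr (_ + _); rewrite ean mulr_sumr; apply: eq_bigr => i _.
  by rewrite hornerZ hornerXn mulrA.
- rewrite sp ltnS; apply: (leq_trans (size_polyD _ _)).
  rewrite geq_max size_poly /=; apply: (leq_trans (size_sum _ _ _)).
  apply/bigmax_leqP => i _; apply: (leq_trans (size_scale_leq _ _)).
  rewrite size_polyXn; have := ltn_ord i; lia.
Qed.

(** If [b] does not multiply [M] into itself, then by maximality the polynomials in [b] with
    coefficients in [M] represent 1. If this happens for both [a] and [a^-1], [vring_reduce] keeps
    lowering the degree of one of the two representations. *)
Lemma vring_val a : vring a \/ vring a^-1.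
Proof.
have [->|a0] := eqVneq a 0; first by left => m Mm; rewrite mul0r; exact: M_zero.
have key b : vring b \/ exists2 p : {poly K}, forall i, M p`_i & p.[b] = 1.
  pose M' := [set z | exists2 p : {poly K}, forall i, M p`_i & p.[b] = z].
  have [[p Mp pb]|nM1] := pselect (M' 1); [by right; exists p|left].
  have nM' : nonunital M'.
    split => //.
    - move=> _ _ [p Mp <-] [q Mq <-]; exists (p + q); rewrite ?hornerD // => i.
      by rewrite coefD; apply: nonunitalD.
    - move=> _ _ [p Mp <-] [q Mq <-]; exists (p * q); rewrite ?hornerM // => i.
      by rewrite coefM; apply: M_sum => j _; apply: nonunitalM.
    - move=> c _ [p Mp <-]; exists (h c *: p); rewrite ?hornerZ // => i.
      by rewrite coefZ; apply: nonunitalZ.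
  have sub : M `<=` M'.
    move=> z Mz; exists z%:P; rewrite ?hornerC // => i.
    by rewrite coefC; case: ifP => // _; apply: M_zero.
  move=> m Mm; apply: (M_max nM' sub).
  exists (m *: 'X); last by rewrite hornerZ hornerX mulrC.
  move=> i; rewrite coefZ coefX; case: eqP => _; first by rewrite mulr1.
  by rewrite mulr0; apply: M_zero.
case: (key a) => [|[p Mp pa]]; first by left.
case: (key a^-1) => [|[q Mq qa]]; first by right.
exfalso; have [n] := ubnP (size p + size q); elim: n a a0 p q Mp Mq pa qa => // n IH.
move=> a a0 p q Mp Mq pa qa; rewrite ltnS => szn.
case: (leqP (size q) (size p)) => sz.
  have [p' [Mp' pa' sp']] := vring_reduce a0 Mp Mq pa qa sz.
  by apply: (IH a a0 p' q) => //; apply: leq_trans szn; rewrite ltn_add2r.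
have ai0 : a^-1 != 0 by rewrite invr_neq0.
rewrite -[a]invrK in pa.
have [q' [Mq' qa' sq']] := vring_reduce ai0 Mq Mp qa pa (ltnW sz).
rewrite invrK in pa.
by apply: (IH a a0 p q') => //; apply: leq_trans szn; rewrite ltn_add2l.
Qed.

(** Otherwise the ideal generated by [M] and [a] would be nonunital and larger than [M]. So
    [1 = m + a * b], and the inverse of [a] is [b / (1 - m)]. *)
Lemma vring_unit a : vring a -> ~ M a -> vring a^-1.
Proof.
move=> Oa nMa.
have [b [m [Ob Mm e]]] : exists b m, [/\ vring b, M m & 1 = m + a * b].
  pose M' := [set z | exists b m, [/\ vring b, M m & z = m + a * b]].
  apply: contrapT => nM1; apply: nMa.
  have nM' : nonunital M'.
    split => //.
    - move=> _ _ [b [m [Ob Mm ->]]] [b' [m' [Ob' Mm' ->]]].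
      exists (b + b'), (m + m'); split; [exact: vringD|exact: nonunitalD|by rewrite mulrDr addrACA].
    - move=> _ _ [b [m [Ob Mm ->]]] [b' [m' [Ob' Mm' ->]]].
      exists (b * (a * b')), (m * m' + (a * b') * m + (a * b) * m'); split.
      + by do !apply: vringM.
      + apply: (nonunitalD nuMM); [apply: (nonunitalD nuMM)|]; first exact: nonunitalM.
          by apply: (vringM Oa).
        by apply: (vringM Oa).
      + ring.
    - move=> c _ [b [m [Ob Mm ->]]]; exists (h c * b), (h c * m); split.
      + by apply: vringM => //; apply: vringC.
      + exact: nonunitalZ.
      + by rewrite mulrDr mulrCA.
  apply: (M_max nM') => [z Mz|]; last first.
    exists 1, 0; split; [exact: vring1|exact: M_zero|by rewrite mulr1 add0r].
  exists 0, z; split => //; last by rewrite mulr0 addr0.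
  by rewrite -(rmorph0 h); apply: vringC.
have a0 : a != 0 by apply: contra_notN nMa => /eqP ->; apply: M_zero.
move=> z Mz; have -> : a^-1 * z = b * (z / (1 - m)).
  rewrite e (_ : m + a * b - m = a * b); last by ring.
  have ab0 : a * b != 0.
    by have := M_1B_neq0 Mm; rewrite {1}e (_ : m + a * b - m = a * b) //; ring.
  move: ab0; rewrite mulf_eq0 negb_or => /andP[_ b0].
  by field; rewrite a0 b0.
by apply: Ob; apply: M_div1B.
Qed.

Lemma M_inv_contra a : a != 0 -> vring a -> ~ M a^-1.
Proof. by move=> a0 Oa /Oa; rewrite divff //; apply: nonunital1. Qed.

Lemma vring_trichotomy a : a != 0 -> [\/ M a, M a^-1 | vring a /\ ~ M a].
Proof.
move=> a0; have [Ma|nMa] := pselect (M a); first by constructor 1.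
have [Mai|nMai] := pselect (M a^-1); first by constructor 2.
constructor 3; split => //.
by case: (vring_val a) => // /vring_unit /(_ nMai); rewrite invrK.
Qed.

Definition vunit (u : K) : Prop := vring u /\ vring u^-1.

Lemma vunit1 : vunit 1.
Proof. by split; rewrite ?invr1; exact: vring1. Qed.

Lemma vunitM u v : vunit u -> vunit v -> vunit (u * v).
Proof. by move=> [a b] [a' b']; split; rewrite ?invfM; apply: vringM. Qed.

Lemma vunitV u : vunit u -> vunit u^-1.
Proof. by move=> [a b]; split; rewrite ?invrK. Qed.

Lemma vunitX u n : vunit u -> vunit (u ^+ n).
Proof.
move=> Uu; elim: n => [|n IH]; first by rewrite expr0; exact: vunit1.
by rewrite exprS; apply: vunitM.
Qed.

Lemma vunitXz u (n : int) : vunit u -> vunit (u ^ n).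
Proof. by move=> Uu; case: n => n /=; [|apply: vunitV]; apply: vunitX. Qed.

Lemma vunit_prod (I : finType) (F : I -> K) :
  (forall i, vunit (F i)) -> vunit (\prod_i F i).
Proof. by move=> UF; apply: big_ind => //; [exact: vunit1|exact: vunitM]. Qed.

(* For nonzero [a] and [b]: their values differ. *)
Definition vseparated (a b : K) : Prop := M (a / b) \/ M (b / a).

Lemma separated_dominant (I : finType) (Z : I -> K) (P : pred I) (i0 : I) : P i0 ->
  (forall i, P i -> Z i != 0) ->
  (forall i j, P i -> P j -> i != j -> vseparated (Z i) (Z j)) ->
  exists2 i, P i & forall j, P j -> j != i -> M (Z j / Z i).
Proof.
move=> Pi0 Z0 sepZ.
have [|||i] := @seq_max _ (fun i j => vring (Z j / Z i)) (enum P).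
- move=> i j _ _; case: (vring_val (Z j / Z i)); first by left.
  by rewrite invf_div; right.
- move=> i j l _; rewrite !mem_enum => Pj _ ij jl; have := vringM jl ij.
  by rewrite mulrA divfK ?Z0.
- have : i0 \in enum P by rewrite mem_enum.
  by case: (enum P).
rewrite mem_enum => Pi imax; exists i => // j Pj ji.
case: (sepZ j i Pj Pi ji) => // Mij; exfalso.
have := imax j; rewrite mem_enum => /(_ Pj) Oji; apply: (nonunital1 nuMM).
by have := Oji _ Mij; rewrite mulrA divfK ?Z0 // divff ?Z0.
Qed.

(** Solving the relation for its dominant term shows that the coefficient of this term lies in [M],
    and with it 1. *)
Lemma separated_indep (I : finType) (Z : I -> K) (c : I -> k) :
  (forall i, Z i != 0) -> (forall i j, i != j -> vseparated (Z i) (Z j)) ->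
  \sum_i h (c i) * Z i = 0 -> forall i, c i = 0.
Proof.
move=> Z0 sepZ e i0; apply/eqP; apply: contrapT => /negP ci0.
have [||i ci imax] := @separated_dominant _ Z (fun i => c i != 0) i0 ci0.
- by move=> i _; apply: Z0.
- by move=> i j _ _; apply: sepZ.
apply: (nonunital1 nuMM).
rewrite -(rmorph1 h) -(mulVf ci) rmorphM; apply: nonunitalZ => //.
have -> : h (c i) = - \sum_(j | j != i) h (c j) * (Z j / Z i).
  apply: (mulIf (Z0 i)); rewrite mulNr mulr_suml.
  move: e; rewrite (bigD1 i) //= => /eqP; rewrite addr_eq0 => /eqP ->.
  by congr (- _); apply: eq_bigr => j _; rewrite -mulrA divfK.
apply: M_opp; apply: M_sum => j ji.
have [->|cj] := eqVneq (c j) 0; first by rewrite rmorph0 mul0r; exact: M_zero.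
by apply: nonunitalZ => //; apply: imax.
Qed.

(** [a / b] has the value of [c], which is not zero. *)
Lemma separated_vunit a b c : c != 0 -> M c \/ M c^-1 ->
  vunit (a / b / c) -> vseparated a b.
Proof.
move=> c0 Mc Uc; case: Mc => Mc; [left|right].
  by rewrite -[a / b](divfK c0); apply: Uc.1.
have ci0 : c^-1 != 0 by rewrite invr_eq0.
rewrite -[b / a](divfK ci0).
suff -> : b / a / c^-1 = (a / b / c)^-1 by apply: (vunitV Uc).1.
by rewrite invf_div -[b / a]invf_div invrK mulrC.
Qed.

End Valuation.

(** * The lexicographic valuation of a transcendence basis *)

Lemma gen_subfield_sub (k K : fieldType) (h : k -> K) (X S : set K) :
  subfield h S -> X `<=` S -> gen_subfield h X `<=` S.
Proof. by move=> fS XS; apply: smallest_sub. Qed.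

Lemma gen_subalgebra_sub (k B : nzRingType) (h : k -> B) (X S : set B) :
  subalgebra h S -> X `<=` S -> gen_subalgebra h X `<=` S.
Proof. by move=> fS XS; apply: smallest_sub. Qed.

Lemma gen_subalgebraP (k B : nzRingType) (h : k -> B) (X : set B) :
  subalgebra h (gen_subalgebra h X).
Proof.
split=> [c S [[Sc _ _] _]|a b Xa Xb S cS|a b Xa Xb S cS]; first exact: Sc.
  by have [[_ SB _] _] := cS; apply: SB; [apply: Xa|apply: Xb].
by have [[_ _ SM] _] := cS; apply: SM; [apply: Xa|apply: Xb].
Qed.

Lemma gen_subfieldP (k K : fieldType) (h : k -> K) (X : set K) :
  subfield h (gen_subfield h X).
Proof.
split; last by move=> a Xa S cS; have [fS _] := cS; apply: fS.2; apply: Xa.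
split=> [c S [[[Sc _ _] _] _]|a b Xa Xb S cS|a b Xa Xb S cS]; first exact: Sc.
  by have [[[_ SB _] _] _] := cS; apply: SB; [apply: Xa|apply: Xb].
by have [[[_ _ SM] _] _] := cS; apply: SM; [apply: Xa|apply: Xb].
Qed.

Lemma sub_gen_subfield (k K : fieldType) (h : k -> K) (X : set K) :
  X `<=` gen_subfield h X.
Proof. exact: sub_gen_smallest. Qed.

Lemma sub_gen_subalgebra (k B : nzRingType) (h : k -> B) (X : set B) :
  X `<=` gen_subalgebra h X.
Proof. exact: sub_gen_smallest. Qed.

Lemma gen_subfield_fraction (k K : fieldType) (h : {rmorphism k -> K}) m
    (z : 'I_m -> K) y : gen_subfield h (range z) y ->
  exists p q, mmap h z q != 0 /\ y = mmap h z p / mmap h z q.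
Proof.
apply: (@gen_subfield_sub _ _ _ _ [set y | exists p q, mmap h z q != 0 /\ y = mmap h z p / mmap h z q]);
  last first.
  move=> _ [i _ <-]; exists (mpolyX k (mnm1 i)), 1.
  by rewrite mmapX mmap1U rmorph1 oner_eq0 divr1.
split; first split.
- by move=> c; exists (mpolyC m c), 1; rewrite rmorph1 oner_eq0 divr1; split => //; rewrite mmapC.
- move=> _ _ [p [q [q0 ->]]] [p' [q' [q'0 ->]]].
  exists (p * q' - p' * q), (q * q'); rewrite !rmorphM rmorphB /= !rmorphM mulf_neq0 //.
  by split=> //; field; rewrite q0 q'0.
- move=> _ _ [p [q [q0 ->]]] [p' [q' [q'0 ->]]].
  exists (p * p'), (q * q'); rewrite !rmorphM /= mulf_neq0 //.
  by split=> //; field; rewrite q0 q'0.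
- move=> _ [p [q [q0 ->]]].
  have [p0|p0] := eqVneq (mmap h z p) 0.
    by exists 0, 1; rewrite p0 rmorph1 rmorph0 mul0r invr0 mul0r oner_eq0.
  by exists q, p; rewrite invf_div.
Qed.

Section LexValuation.
Variables (k K : fieldType) (h : {rmorphism k -> K}) (m : nat) (z : 'I_m -> K).
Hypothesis z_indep : alg_indep h z.

Lemma alg_indep_neq0 i : z i != 0.
Proof.
apply/eqP => zi0; have /z_indep : mmap h z (mpolyX k (mnm1 i)) = 0.
  by rewrite mmapX mmap1U.
move/(congr1 (mcoeff (mnm1 i))); rewrite mcoeffX eqxx mcoeff0.
by move/eqP; rewrite oner_eq0.
Qed.
Let z0 := alg_indep_neq0.

Definition mnm_int (a : multinom m) : {ffun 'I_m -> int} := [ffun i => (a i)%:Z].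

Lemma mono_mnm a : mono z (mnm_int a) = mmap1 z a.
Proof. by rewrite /mono /mmap1; apply: eq_bigr => i _; rewrite ffunE. Qed.

Lemma mnm_intD a b : mnm_int (mnm_add a b) = mnm_int a + mnm_int b.
Proof. by apply/ffunP => i; rewrite !ffunE mnmDE PoszD. Qed.

Lemma mnm_int_inj : injective mnm_int.
Proof.
by move=> a b /ffunP e; apply/mnmP => i; have := e i; rewrite !ffunE => -[].
Qed.

Lemma mmap1_neq0 a : mmap1 z a != 0.
Proof. by rewrite -mono_mnm; apply: mono_neq0. Qed.

Lemma mmap1D a b : mmap1 z (mnm_add a b) = mmap1 z a * mmap1 z b.
Proof. by rewrite -!mono_mnm mnm_intD monoD. Qed.

(* The Laurent polynomials in [z] all of whose exponents are
   lexicographically positive, written as [p / z^b]. *)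
Definition lexspan : set K := [set y | exists (p : mpoly m k) (b : multinom m),
  (forall a, a \in msupp p -> lexpos (mnm_int a - mnm_int b)) /\
  y = mmap h z p / mmap1 z b].

Lemma lexspan_nonunital : nonunital h lexspan.
Proof.
split.
- move=> _ _ [p [b [pb ->]]] [q [c [qc ->]]].
  exists (p * mpolyX k c + q * mpolyX k b), (mnm_add b c); split; last first.
    rewrite rmorphD !rmorphM /= !mmapX mmap1D.
    by field; rewrite !mmap1_neq0.
  move=> a /msuppD_le; rewrite mem_cat; case/orP; rewrite (perm_mem (msuppMX _ _)).
    case/mapP => a' /pb pb' ->; move: pb'.
    by rewrite !mnm_intD [mnm_int b + _]addrC opprD addrACA subrr add0r.
  case/mapP => a' /qc pb' ->; move: pb'.
  by rewrite !mnm_intD opprD addrACA subrr add0r.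
- move=> _ _ [p [b [pb ->]]] [q [c [qc ->]]].
  exists (p * q), (mnm_add b c); split; last first.
    by rewrite rmorphM mmap1D /=; field; rewrite !mmap1_neq0.
  move=> a /msuppM_le /allpairsP[[a1 a2] /= [/pb p1 /qc p2 ->]].
  by rewrite !mnm_intD opprD addrACA lexposD.
- move=> c _ [p [b [pb ->]]]; exists (c *: p), b; split.
    by move=> a /msuppZ_le /pb.
  by rewrite mmapZ mulrA.
(* If [1 = p / z^b], independence gives [p = z^b]; but the exponent [b - b = 0] is not positive. *)
- move=> [p [b [pb /eqP]]]; rewrite eq_sym.
  rewrite -subr_eq0 -(divff (mmap1_neq0 b)) -mulrBl mulf_eq0 invr_eq0.
  rewrite (negPf (mmap1_neq0 b)) orbF -(mmapX _ h) -rmorphB => /eqP /z_indep /eqP.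
  rewrite subr_eq0 => /eqP e; have := pb b.
  by rewrite e msuppX mem_head subrr lexpos0 => /(_ isT).
Qed.

Lemma lexspan_mono a : lexpos a -> lexspan (mono z a).
Proof.
move=> la.
pose p : multinom m := Multinom [tuple if 0 <= a i then `|a i|%N else 0%N | i < m].
pose n : multinom m := Multinom [tuple if 0 <= a i then 0%N else `|a i|%N | i < m].
have e : a = mnm_int p - mnm_int n.
  apply/ffunP => i; rewrite !ffunE /p /n !multinomE !tnth_mktuple.
  case: ifP => ai; first by rewrite subr0 gez0_abs.
  by rewrite sub0r ltz0_abs ?opprK // ltNge ai.
exists (mpolyX k p), n; split; first by move=> b; rewrite msuppX inE => /eqP ->; rewrite -e.
by rewrite mmapX -!mono_mnm -monoB // -e.
Qed.

(** Factor out the lexicographically least term of [p]: relative to it, all other exponents are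
    positive. *)
Lemma lexspan_lead p : p != 0 ->
  exists c b mu, [/\ c != 0, lexspan mu & mmap h z p = h c * mono z b * (1 + mu)].
Proof.
move=> p0; pose lt := fun a b : multinom m =>
  a = b \/ lexpos (mnm_int b - mnm_int a).
have [|||b bp bmin] := @seq_max _ lt (msupp p).
- move=> a b _ _; have [->|ab] := eqVneq a b; first by left; left.
  have : mnm_int a - mnm_int b != 0.
    by rewrite subr_eq0; apply: contra_neq ab; apply: mnm_int_inj.
  by move/lexpos_total/orP; rewrite opprB; case; [right|left]; right.
- move=> a b c _ _ _ [->//|ab] [<-|bc]; first by right.
  by right; rewrite -(subrKA (mnm_int b)) addrC [_ - mnm_int a]addrC lexposD // addrC.
- by rewrite msupp_eq0.
have c0 : mcoeff b p != 0 by rewrite -mcoeff_msupp.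
pose c := mcoeff b p; pose q := c^-1 *: (p - c *: mpolyX k b).
exists c, (mnm_int b), (mmap h z q / mmap1 z b); split => //; last first.
  rewrite mono_mnm mmapZ rmorphB /= mmapZ mmapX fmorphV.
  have hc0 : h c != 0 by rewrite fmorph_eq0.
  by field; rewrite hc0 mmap1_neq0.
exists q, b; split => // a aq.
have ab : a != b.
  move: aq; rewrite mcoeff_msupp; apply: contra_neq => ->.
  by rewrite mcoeffZ mcoeffB mcoeffZ mcoeffX eqxx mulr1 subrr mulr0.
have /bmin : a \in msupp p.
  move: aq; rewrite !mcoeff_msupp; apply: contra_neq => a0.
  by rewrite mcoeffZ mcoeffB mcoeffZ mcoeffX eq_sym (negPf ab) mulr0 a0 subrr mulr0.
by case=> // e; rewrite e eqxx in ab.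
Qed.

Lemma lex_valuation : exists M : set K, [/\ nonunital h M, M !=set0,
  forall M', nonunital h M' -> M `<=` M' -> M' `<=` M,
  forall a, lexpos a -> M (mono z a) &
  forall p, p != 0 -> exists c b mu,
    [/\ c != 0, M mu & mmap h z p = h c * mono z b * (1 + mu)]].
Proof.
have L0 : lexspan !=set0.
  exists 0, 0, mnm0; split; first by move=> a; rewrite msupp0.
  by rewrite rmorph0 mul0r.
have [M [LM nuM Mmax]] := nonunital_maximal L0 lexspan_nonunital.
exists M; split => //.
- by case: L0 => y /LM; exists y.
- by move=> a /lexspan_mono /LM.
- move=> p /lexspan_lead[c [b [mu [c0 /LM Mmu e]]]]; by exists c, b, mu.
Qed.

End LexValuation.

(** * The residue field of the lexicographic valuation *)

Section Residue.
Variables (k : closedFieldType) (K : fieldType) (h : {rmorphism k -> K}).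
Variables (d : nat) (x : 'I_d -> K).
Hypothesis x_indep : alg_indep h x.
Hypothesis K_alg : forall y, algebraic_over (gen_subfield h (range x)) y.
Let x0 := alg_indep_neq0 x_indep.

(** A unit [y] of the valuation ring is a root of a polynomial over [k(x)]. Division by a
    coefficient of least value makes the coefficients integral and one of them 1; their residues lie
    in [k] because elements of [k(x)] have leading terms. The residue polynomial splits over [k],
    and one of its factors takes [y] into [M]. *)
Lemma lex_valuation_residue : exists M : set K, [/\ nonunital h M, M !=set0,
  forall M', nonunital h M' -> M `<=` M' -> M' `<=` M,
  forall a, lexpos a -> M (mono x a) &
  forall y, y != 0 -> [\/ M y, M y^-1 | exists2 c, c != 0 & M (y - h c)]].
Proof.
have [M [nuM M0' Mmax Mx lead]] := lex_valuation x_indep.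
exists M; split => // y y0.
case: (vring_trichotomy nuM M0' Mmax y0) => [||[Oy nMy]].
- by constructor 1.
- by constructor 2.
constructor 3.
pose O := vring M.
have fracF q : gen_subfield h (range x) q -> q != 0 ->
    exists c a mu, [/\ c != 0, M mu & q = h c * mono x a * (1 + mu)].
  move=> /gen_subfield_fraction[f [g [g0 ->]]]; rewrite mulf_eq0 invr_eq0 negb_or => /andP[f0 _].
  have [|c [b [mu [c0 Mmu ef]]]] := lead f; first by apply: contra_neq f0 => ->; rewrite rmorph0.
  have [|c' [b' [mu' [c'0 Mmu' eg]]]] := lead g; first by apply: contra_neq g0 => ->; rewrite rmorph0.
  have Mmu'N := M_opp nuM Mmu'.
  have d0 : 1 + mu' != 0 by have := M_1B_neq0 nuM Mmu'N; rewrite opprK.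
  exists (c / c'), (b - b'), ((mu - mu') / (1 + mu')); split.
  - by rewrite mulf_neq0 ?invr_neq0.
  - have -> : 1 + mu' = 1 - - mu' by rewrite opprK.
    by apply: (M_div1B nuM M0' Mmax) => //; apply: (M_sub nuM).
  - rewrite ef eg rmorphM fmorphV monoB //.
    have hc'0 : h c' != 0 by rewrite fmorph_eq0.
    by field; rewrite d0 mono_neq0.
have resF q : gen_subfield h (range x) q -> O q -> exists c, M (q - h c).
  have [->|q0] := eqVneq q 0; first by exists 0; rewrite rmorph0 subrr; apply: (M_zero nuM).
  move=> Fq Oq; have [c [a [mu [c0 Mmu eq]]]] := fracF q Fq q0.
  have hc0 : h c != 0 by rewrite fmorph_eq0.
  have O1 : vring M (1 + mu).
    by apply: (vringD nuM); [exact: (vring1 nuM)|exact: (M_vring nuM)].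
  have [a0|/lexpos_total/orP[la|la]] := eqVneq a 0.
  - exists c; rewrite eq a0 mono0 mulr1 mulrDr mulr1 addrAC subrr add0r.
    exact: (nonunitalZ nuM).
  - exists 0; rewrite rmorph0 subr0 eq mulrC; apply: O1.
    by apply: (nonunitalZ nuM); apply: Mx.
  - exfalso; have d0 : 1 + mu != 0 by have := M_1B_neq0 nuM (M_opp nuM Mmu); rewrite opprK.
    apply: (M_inv_contra nuM q0 Oq).
    have -> : q^-1 = (h c^-1 * mono x (- a)) / (1 - - mu).
      by rewrite eq opprK monoN // fmorphV; field; rewrite mono_neq0 // hc0 d0.
    apply: (M_div1B nuM M0' Mmax); last exact: (M_opp nuM).
    by apply: (nonunitalZ nuM); apply: Mx.
have [p [p0 Fp rootp]] := K_alg y.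
have [i pi0 imax] : exists2 i, p`_i != 0 & forall j, O (p`_j / p`_i).
  pose s := [seq i <- iota 0 (size p) | p`_i != 0].
  have [|||i] := @seq_max _ (fun i j => O (p`_j / p`_i)) s.
  - move=> i j _ _; case: (vring_val nuM M0' Mmax (p`_j / p`_i)); first by left.
    by rewrite invf_div; right.
  - move=> i j l _; rewrite mem_filter => /andP[j0 _] _ ij jl.
    by have := vringM jl ij; rewrite mulrA divfK.
  - have : (size p).-1 \in s.
      rewrite mem_filter lead_coef_eq0 p0 mem_iota add0n /= prednK ?leqnn //.
      by rewrite lt0n size_poly_eq0.
    by case: s.
  rewrite mem_filter => /andP[pi0 _] imax; exists i => // j.
  have [->|pj0] := eqVneq p`_j 0.
    by rewrite mul0r -(rmorph0 h); apply: (vringC nuM).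
  apply: imax; rewrite mem_filter pj0 mem_iota add0n /=.
  by rewrite ltnNge; apply: contra_neqN pj0 => /(nth_default 0).
have Fsub : forall a b, gen_subfield h (range x) a -> gen_subfield h (range x) b ->
    gen_subfield h (range x) (a / b).
  move=> a b Fa Fb S [sS xS].
  case: (sS) => -[_ _ SM] SV; apply: SM; first exact: Fa.
  by apply: SV; apply: Fb.
have /choice[c cP] j : exists c, M (p`_j / p`_i - h c).
  by apply: resF; [apply: Fsub|apply: imax].
pose q : {poly k} := \poly_(j < size p) c j.
have q0 : q != 0.
  apply/eqP => /(congr1 (fun r : {poly k} => r`_i)); rewrite coef_poly coef0 ifT; last first.
    by rewrite ltnNge; apply: contra_neqN pi0 => /(nth_default 0).
  move=> ci; have := cP i; rewrite divff // ci rmorph0 subr0.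
  exact: (nonunital1 nuM).
have Mq : M ((map_poly h q).[y]).
  have -> : (map_poly h q).[y] = - \sum_(j < size p) (p`_j / p`_i - h (c j)) * y ^+ j.
    rewrite (@horner_coef_wide _ (size p)); last first.
      by rewrite size_map_poly size_poly.
    have : \sum_(j < size p) p`_j / p`_i * y ^+ j = 0.
      move/rootP: rootp; rewrite horner_coef => e.
      under eq_bigr do rewrite mulrAC.
      by rewrite -mulr_suml e mul0r.
    move=> e; rewrite -[LHS]subr0 -[X in _ - X]e -sumrB -sumrN; apply: eq_bigr => j _.
    by rewrite coef_map coef_poly ltn_ord mulrBl opprB.
  apply: (M_opp nuM); apply: (M_sum nuM) => // j _.
  by rewrite mulrC; apply: (vringX nuM).
have [rs eq] := closed_field_poly_normal q.
move: Mq; rewrite eq map_polyZ rmorph_prod hornerZ => Mq.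
have {}Mq : M (\prod_(r <- rs) (y - h r)).
  have lq0 : lead_coef q != 0 by rewrite lead_coef_eq0.
  have hl0 : h (lead_coef q) != 0 by rewrite fmorph_eq0.
  have := nonunitalZ nuM (lead_coef q)^-1 Mq.
  rewrite fmorphV mulKf // horner_prod.
  rewrite (eq_bigr (fun r => y - h r)) // => r _.
  by rewrite rmorphB /= map_polyX map_polyC hornerXsubC.
have [r Mr] : exists r, M (y - h r).
  elim: rs Mq {eq} => [|r rs IH]; first by rewrite big_nil => /(nonunital1 nuM).
  rewrite big_cons => Mq; have [|nMr] := pselect (M (y - h r)); first by exists r.
  (* A factor outside [M] is a unit of the valuation ring and can be cancelled. *)
  apply: IH.
  have Or : vring M (y - h r).
    by apply: (vringD nuM) => //; rewrite -rmorphN; apply: (vringC nuM).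
  have := vring_unit nuM M0' Mmax Or nMr Mq.
  rewrite mulKf //; apply: contra_notN nMr => /eqP ->; exact: (M_zero nuM).
exists r => //; apply: contra_notN nMy => /eqP r0; by move: Mr; rewrite r0 rmorph0 subr0.
Qed.

End Residue.

(** * Invariance of the transcendence degree *)

Lemma linear_dependence (k : fieldType) (I J : finType) (C : I -> J -> k) :
  (#|J| < #|I|)%N ->
  exists2 c : I -> k, (exists i, c i != 0) & forall j, \sum_i c i * C i j = 0.
Proof.
move=> IJ; pose A : 'M[k]_(#|I|, #|J|) := \matrix_(i, j) C (enum_val i) (enum_val j).
have : kermx A != 0.
  rewrite kermx_eq0 /row_free; apply: contraL IJ => /eqP <-.
  by rewrite -leqNgt rank_leq_col.
case/rowV0Pn => v /sub_kermxP vA v0.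
exists (fun i => v 0 (enum_rank i)).
  apply: contrapT => h; move/eqP: v0; apply; apply/rowP => i; rewrite mxE.
  apply/eqP; apply: contrapT => /negP vi; apply: h; exists (enum_val i).
  by rewrite enum_valK.
move=> j; have := congr1 (fun B : 'rV_ _ => B 0 (enum_rank j)) vA; rewrite !mxE => e; rewrite -[RHS]e.
rewrite (reindex (@enum_val _ I)) /=; last by exists enum_rank => i _; rewrite ?enum_valK ?enum_rankK.
by apply: eq_bigr => i _; rewrite !mxE enum_rankK enum_valK.
Qed.

Section MpolyBounded.
Variables (k : nzRingType) (d : nat).
Implicit Types p q : mpoly d k.

(** Exponents are bounded one by one, not by total degree, so that monomials are indexed by
    [{ffun 'I_d -> 'I_B.+1}]. *)
Definition mbounded (B : nat) p := forall a, a \in msupp p -> forall i, (a i <= B)%N.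

Lemma mbounded_exists p : exists B, mbounded B p.
Proof.
exists (\max_(a <- msupp p) \max_i a i) => a ap i.
rewrite (big_rem a ap) /=; apply: leq_trans (leq_maxl _ _).
exact: (leq_bigmax i).
Qed.

Lemma mbounded_leq B B' p : (B <= B')%N -> mbounded B p -> mbounded B' p.
Proof. by move=> BB bp a /bp ab i; apply: leq_trans (ab i) BB. Qed.

Lemma mboundedM B B' p q : mbounded B p -> mbounded B' q -> mbounded (B + B') (p * q).
Proof.
move=> bp bq a /msuppM_le /allpairsP[[a1 a2] /= [/bp p1 /bq p2 ->]] i.
by rewrite mnmDE leq_add.
Qed.

Lemma mbounded1 : mbounded 0 1.
Proof. by move=> a; rewrite msupp1 inE => /eqP -> i; rewrite mnmE. Qed.

Lemma mboundedX B p n : mbounded B p -> mbounded (n * B) (p ^+ n).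
Proof.
move=> bp; elim: n => [|n IH]; first by rewrite expr0; exact: mbounded1.
by rewrite exprS mulSn; apply: mboundedM.
Qed.

Lemma mbounded_prod (I : finType) (P : I -> mpoly d k) B :
  (forall i, mbounded B (P i)) -> mbounded (#|I| * B) (\prod_i P i).
Proof.
move=> bP; rewrite -sum1_card big_distrl /=.
apply: (big_rec2 (fun b p => mbounded b p)); first exact: mbounded1.
by move=> i b p _ bp; rewrite mul1n; apply: mboundedM.
Qed.

End MpolyBounded.

Section Steinitz.
Variables (k K : fieldType) (h : {rmorphism k -> K}) (m d : nat).
Variables (z : 'I_m -> K) (x : 'I_d -> K).
Hypothesis z_indep : alg_indep h z.
Hypothesis K_alg : forall y, algebraic_over (gen_subfield h (range x)) y.
Let z0 := alg_indep_neq0 z_indep.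

Lemma mmap_bounded B p : mbounded B p ->
  mmap h x p = \sum_(a : {ffun 'I_d -> 'I_B.+1})
    h (mcoeff (Multinom [tuple val (a i) | i < d]) p) * \prod_i x i ^+ a i.
Proof.
move=> bp; rewrite {1}/mmap.
pose f (a : {ffun 'I_d -> 'I_B.+1}) := Multinom [tuple val (a i) | i < d].
have fE a i : f a i = a i by rewrite /f multinomE tnth_mktuple.
have finj : injective f.
  by move=> a b /mnmP e; apply/ffunP => i; apply: val_inj; have := e i; rewrite !fE.
have -> : \sum_a h (mcoeff (f a) p) * \prod_i x i ^+ a i =
    \sum_(b <- [seq f a | a : {ffun 'I_d -> 'I_B.+1}]) h (mcoeff b p) * mmap1 x b.
  rewrite big_map big_enum /=; apply: eq_bigr => a _; congr (_ * _).
  by apply: eq_bigr => i _; rewrite fE.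
rewrite [RHS](bigID (mem (msupp p))) /= [X in _ = _ + X]big1 ?addr0; last first.
  by move=> b /memN_msupp_eq0 ->; rewrite rmorph0 mul0r.
rewrite -[RHS]big_filter; apply: perm_big; apply: uniq_perm.
- exact: msupp_uniq.
- by rewrite filter_uniq // map_inj_uniq ?enum_uniq.
move=> b; rewrite mem_filter; case bs: (b \in msupp p) => //=; apply/esym/mapP.
exists [ffun i => inord (b i)]; first by rewrite mem_enum.
by apply/mnmP => i; rewrite fE ffunE inordK // ltnS bp.
Qed.

Section Values.
Variable M : set K.
Hypotheses (nuM : nonunital h M) (M0' : M !=set0).
Hypothesis Mmax : forall M', nonunital h M' -> M `<=` M' -> M' `<=` M.

(* In an algebraic equation for [y] two terms must have the same value, so a
   power of [y] has the value of an element of [k(x)]. *)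
Lemma vunit_algebraic y : y != 0 -> exists e f g,
  [/\ (0 < e)%N, mmap h x f != 0, mmap h x g != 0 &
      vunit M (y ^+ e * mmap h x g / mmap h x f)].
Proof.
move=> y0; have [p [p0 Fp /rootP rootp]] := K_alg y.
pose T i := p`_i * y ^+ i.
pose s := [seq i <- iota 0 (size p) | p`_i != 0].
have sP i : (i \in s) = (p`_i != 0).
  rewrite mem_filter mem_iota add0n /=; case: eqVneq => //= pi0.
  by rewrite ltnNge; apply: contra_neqN pi0 => /(nth_default 0).
have T0 i : i \in s -> T i != 0 by rewrite sP => pi0; rewrite mulf_neq0 ?expf_neq0.
have red i j : (i < j)%N -> i \in s -> j \in s -> vunit M (T j / T i) ->
    exists e f g, [/\ (0 < e)%N, mmap h x f != 0, mmap h x g != 0 &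
      vunit M (y ^+ e * mmap h x g / mmap h x f)].
  move=> ij; rewrite !sP => pi0 pj0 Uij.
  have [f [g [g0 ei]]] := gen_subfield_fraction (Fp i).
  have [f' [g' [g'0 ej]]] := gen_subfield_fraction (Fp j).
  have f0 : mmap h x f != 0 by apply: contraNneq pi0; rewrite ei => ->; rewrite mul0r.
  have f'0 : mmap h x f' != 0 by apply: contraNneq pj0; rewrite ej => ->; rewrite mul0r.
  exists (j - i)%N, (f * g'), (f' * g); rewrite !rmorphM /= !mulf_neq0 //.
  split => //; first by rewrite subn_gt0.
  suff -> : y ^+ (j - i) * (mmap h x f' * mmap h x g) / (mmap h x f * mmap h x g') = T j / T i by [].
  rewrite /T ei ej -{2}(subnK (ltnW ij)) exprD.
  have yi0 : y ^+ i != 0 by rewrite expf_neq0.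
  by field; rewrite yi0 f0 g0 g'0.
have [|||i si imax] := @seq_max _ (fun i j => vring M (T j / T i)) s.
- move=> i j _ _; case: (vring_val nuM M0' Mmax (T j / T i)); first by left.
  by rewrite invf_div; right.
- by move=> i j l _ js _ ij jl; have := vringM jl ij; rewrite mulrA divfK ?T0.
- have hs : (size p).-1 \in s by rewrite sP lead_coef_eq0.
  by apply/eqP => s0; rewrite s0 in hs.
have [j [sj ji Uj]] : exists j, [/\ j \in s, j != i & vunit M (T j / T i)].
  (* Were [T i] the only term of its value, each other [T j / T i] would lie in [M]; but these sum
     to -1. *)
  apply: contrapT => noj; apply: (nonunital1 nuM).
  have -> : 1 = - \sum_(j <- s | j != i) T j / T i.
    have : \sum_(j <- s) T j = 0.
      rewrite -[RHS]rootp horner_coef -(big_mkord xpredT (fun i => p`_i * y ^+ i)) /index_iota subn0.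
      rewrite big_filter [RHS](bigID (fun i => p`_i != 0)) /= [X in _ = _ + X]big1 ?addr0 //.
      by move=> l /negPn /eqP ->; rewrite mul0r.
    rewrite (big_rem i si) /= => /eqP; rewrite addr_eq0 => /eqP e.
    rewrite -mulr_suml -mulNr; apply: (mulIf (T0 i si)); rewrite mul1r divfK ?T0 // e.
    by congr (- _); rewrite rem_filter ?filter_uniq ?iota_uniq // big_filter.
  apply: (M_opp nuM); rewrite big_seq_cond; apply: (M_sum nuM M0') => j /andP[js ji].
  apply: contrapT => nMj; apply: noj; exists j; split => //; split; first exact: imax.
  by apply: (vring_unit nuM M0' Mmax) => //; apply: imax.
case: (ltngtP i j) => [ij|ij|ij]; last by rewrite ij eqxx in ji.
  exact: (red i j).
by apply: (red j i) => //; rewrite -invf_div; apply: vunitV.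
Qed.

Lemma ratio_power (a b y : K) (e n c c' : nat) : a != 0 -> b != 0 -> y != 0 ->
  (c <= n)%N -> (c' <= n)%N ->
  (a ^+ c * b ^+ (n - c)) / (a ^+ c' * b ^+ (n - c')) / y ^ (e%:Z * (c%:Z - c'%:Z))
  = (y ^+ e * b / a) ^ (c'%:Z - c%:Z).
Proof.
move=> a0 b0 y0 cn c'n; set i := c%:Z - c'%:Z.
have ra : a ^+ c / a ^+ c' = a ^ i by rewrite !exprnP invr_expz -expfzDr.
have rb : b ^+ (n - c) / b ^+ (n - c') = b ^ (- i).
  rewrite !exprnP !invr_expz -expfzDr //; congr (_ ^ _).
  by rewrite -!subzn // /i; ring.
have -> : c'%:Z - c%:Z = - i by rewrite opprB.
rewrite -mulf_div ra rb !expfzMl exprz_inv opprK exprnP exprz_exp invr_expz.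
by rewrite mulrN; ring.
Qed.

(** [F j / G j] has the value of [z j ^+ E j], so the values of the two products differ by that of a
    monomial in [z] with exponents [E j * (c j - c' j)], not all zero. The complementary powers of
    [G j] avoid denominators. *)
Lemma separated_box N (E : 'I_m -> nat) (F G : 'I_m -> K) :
  (forall a, lexpos a -> M (mono z a)) ->
  (forall j, [/\ (0 < E j)%N, F j != 0, G j != 0 & vunit M (z j ^+ E j * G j / F j)]) ->
  forall c c' : {ffun 'I_m -> 'I_N.+1}, c != c' ->
  vseparated M (\prod_j (F j ^+ c j * G j ^+ (N - c j)))
    (\prod_j (F j ^+ c' j * G j ^+ (N - c' j))).
Proof.
move=> Mz EFG c c' cc'.
pose a : {ffun 'I_m -> int} := [ffun j => ((E j)%:Z * ((c j)%:Z - (c' j)%:Z))].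
apply: (separated_vunit (c := mono z a)).
- exact: mono_neq0.
- have a0 : a != 0.
    apply: contra_neq cc' => /ffunP a0; apply/ffunP => j; apply: val_inj => /=.
    have [e0 _ _ _] := EFG j.
    have := a0 j; rewrite !ffunE => /eqP; rewrite mulf_eq0 subr_eq0 eqz_nat => /orP[/eqP e|].
      by rewrite e in e0.
    by move=> /eqP [].
  by case/orP: (lexpos_total a0) => la; [left|right]; rewrite -?monoN //; apply: Mz.
- rewrite /mono -!prodf_div; apply: (vunit_prod nuM) => j; rewrite ffunE.
  have [e0 F0 G0 Uj] := EFG j.
  have lc : (c j <= N)%N := ltn_ord (c j).
  have lc' : (c' j <= N)%N := ltn_ord (c' j).
  rewrite ratio_power //.
  exact: (vunitXz nuM).
Qed.

End Values.

(* The elements [prod_j F_j^(c_j) G_j^(N - c_j)] have distinct values, hence are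
   independent, while they are polynomials in [x] of bounded degree. *)
Lemma box_card_bound : exists D, forall N, (N.+1 ^ m <= (m * (N * D + N * D)).+1 ^ d)%N.
Proof.
have [M [nuM M0' Mmax Mz _]] := lex_valuation z_indep.
have /choice[E /choice[F /choice[G EFG]]] : forall j, exists e f g, _ :=
  fun j => vunit_algebraic nuM M0' Mmax (z0 j).
have [D DP] : exists D, forall j, mbounded D (F j) /\ mbounded D (G j).
  have /choice[B BP] j : exists B, mbounded B (F j) /\ mbounded B (G j).
    have [b1 B1] := mbounded_exists (F j); have [b2 B2] := mbounded_exists (G j).
    exists (maxn b1 b2); split; [apply: mbounded_leq B1|apply: mbounded_leq B2].
      exact: leq_maxl.
    exact: leq_maxr.
  exists (\max_j B j) => j; have [B1 B2] := BP j.
  by split; [apply: mbounded_leq B1|apply: mbounded_leq B2]; exact: (leq_bigmax j).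
exists D => N.
pose P (c : {ffun 'I_m -> 'I_N.+1}) := \prod_j (F j ^+ c j * G j ^+ (N - c j)).
have bP c : mbounded (m * (N * D + N * D)) (P c).
  rewrite -{1}(card_ord m); apply: mbounded_prod => j; have [bF bG] := DP j.
  apply: mboundedM; [apply: mbounded_leq (mboundedX bF)|apply: mbounded_leq (mboundedX bG)].
    by rewrite leq_mul2r -ltnS ltn_ord orbT.
  by rewrite leq_mul2r leq_subr orbT.
pose Z c := mmap h x (P c).
have ZE c : Z c = \prod_j (mmap h x (F j) ^+ c j * mmap h x (G j) ^+ (N - c j)).
  by rewrite /Z rmorph_prod; apply: eq_bigr => j _; rewrite rmorphM !rmorphXn.
have Z0 c : Z c != 0.
  rewrite ZE; apply/prodf_neq0 => j _; have [_ F0 G0 _] := EFG j.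
  by rewrite mulf_neq0 ?expf_neq0.
have sepZ c c' : c != c' -> vseparated M (Z c) (Z c').
  by move=> cc'; rewrite !ZE; apply: (separated_box nuM Mz EFG).
have cI : #|{ffun 'I_m -> 'I_N.+1}| = (N.+1 ^ m)%N by rewrite card_ffun !card_ord.
have cJ B : #|{ffun 'I_d -> 'I_B.+1}| = (B.+1 ^ d)%N by rewrite card_ffun !card_ord.
rewrite -cI -cJ leqNgt; apply/negP => /(@linear_dependence k _ _ (fun c a =>
  mcoeff (Multinom [tuple val (fun_of_fin a i) | i < d]) (P c)))[c [c0 cc0] e].
have ce : forall i, c i = 0; last by rewrite ce eqxx in cc0.
apply: (separated_indep nuM M0' Mmax Z0 sepZ); rewrite /Z.
under eq_bigr do rewrite (mmap_bounded (bP _)) mulr_sumr.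
rewrite exchange_big /= big1 // => a _.
under eq_bigr do rewrite mulrA -rmorphM.
by rewrite -mulr_suml -rmorph_sum e rmorph0 mul0r.
Qed.

Lemma trdeg_le : (m <= d)%N.
Proof.
have [D key] := box_card_bound.
rewrite leqNgt; apply/negP => dm.
(* With [N = C^d] the right side is at most [(C * N.+1)^d = N * N.+1^d], which is below
   [N.+1^(d+1)]. *)
pose C := (m * (D + D)).+1; have := key (C ^ d)%N; rewrite leqNgt => /negP; apply.
apply: (@leq_ltn_trans ((C * (C ^ d).+1) ^ d)%N).
  have le2 a b e : (a <= b -> a ^ e <= b ^ e)%N by case: e => // e; rewrite leq_exp2r.
  by apply: le2; rewrite /C; nia.
rewrite expnMn; apply: (@leq_trans ((C ^ d).+1 ^ d.+1)%N).
  by rewrite expnS ltn_pmul2r // expn_gt0.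
by rewrite leq_pexp2l.
Qed.

End Steinitz.

(** * Counting values *)

(** Both sides have the form [B * N + (A - B) * s + m] with [m < r <= A - B], so [s] and [m] are a
    quotient and a remainder. *)
Lemma combination_inj (r : nat) (A B : int) (N s s' m m' : nat) :
  r%:Z <= A - B -> (m < r)%N -> (m' < r)%N -> (s <= N)%N -> (s' <= N)%N ->
  A *+ s + B *+ (N - s) + m%:Z = A *+ s' + B *+ (N - s') + m'%:Z ->
  s = s' /\ m = m'.
Proof.
move=> D mr m'r sN s'N; rewrite !pmulrn !mulrzz -(subzn sN) -(subzn s'N) => e.
have {}e : (A - B) * (s%:Z - s'%:Z) = m'%:Z - m%:Z by lia.
have ss : s = s' by case: (ltngtP s s') => // ss; exfalso; nia.
by split => //; rewrite ss subrr mulr0 in e; lia.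
Qed.

Section SeparatedFamilies.
Variables (k K : fieldType) (h : {rmorphism k -> K}).
Variable M : set K.
Hypotheses (nuM : nonunital h M) (M0' : M !=set0).
Hypothesis Mmax : forall M', nonunital h M' -> M `<=` M' -> M' `<=` M.

Lemma vseparatedP a b : a != 0 -> b != 0 -> ~ vseparated M a b <-> vunit M (a / b).
Proof.
move=> a0 b0; have ab0 : a / b != 0 by rewrite mulf_neq0 ?invr_neq0.
have nu := nonunital1 nuM.
split=> [nsep|[Oab Oba]].
  case: (vring_trichotomy nuM M0' Mmax ab0) => [Mab|Mab|[Oab nMab]].
  - by case: nsep; left.
  - by case: nsep; right; rewrite -invf_div.
  - by split => //; apply: (vring_unit nuM M0' Mmax).
case=> Mab; first by apply: nu; rewrite -(mulVf ab0); apply: Oba.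
by apply: nu; rewrite -(divff ab0) invf_div; apply: Oab.
Qed.

Lemma vseparated_scale g a b : g != 0 -> vseparated M a b -> vseparated M (g * a) (g * b).
Proof.
by move=> g0 [Mab|Mab]; [left|right]; rewrite -mulf_div divff // mul1r.
Qed.

(** * Elimination to distinct values *)

Section Independent.
Hypothesis residue : forall y, y != 0 ->
  [\/ M y, M y^-1 | exists2 c, c != 0 & M (y - h c)].
Variable u : nat -> K.

Definition lcomb n y := exists c : nat -> k, y = \sum_(j < n) h (c j) * u j.

Lemma lcomb0 n : lcomb n 0.
Proof. by exists (fun=> 0); rewrite big1 // => i _; rewrite rmorph0 mul0r. Qed.

Lemma lcombD n y z : lcomb n y -> lcomb n z -> lcomb n (y + z).
Proof.
move=> [c ->] [c' ->]; exists (fun j => c j + c' j); rewrite -big_split.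
by apply: eq_bigr => i _; rewrite rmorphD mulrDl.
Qed.

Lemma lcombZ n a y : lcomb n y -> lcomb n (h a * y).
Proof.
move=> [c ->]; exists (fun j => a * c j); rewrite mulr_sumr.
by apply: eq_bigr => i _; rewrite rmorphM mulrA.
Qed.

Lemma lcombN n y : lcomb n y -> lcomb n (- y).
Proof. by move=> /(lcombZ (-1)); rewrite rmorphN1 mulN1r. Qed.

Lemma lcomb_gen i n : (i < n)%N -> lcomb n (u i).
Proof.
move=> lin; exists (fun j => (j == i)%:R).
rewrite (bigD1 (Ordinal lin)) //= eqxx rmorph1 mul1r big1 ?addr0 // => j ji.
have -> : (j == i :> nat) = false by apply/negbTE.
by rewrite rmorph0 mul0r.
Qed.

Lemma lcomb_widen n n' y : (n <= n')%N -> lcomb n y -> lcomb n' y.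
Proof.
move=> nn' [c ->]; apply: (big_ind (lcomb n')); [exact: lcomb0|exact: lcombD|].
by move=> i _; apply: lcombZ; apply: lcomb_gen; apply: leq_trans nn'.
Qed.

Hypothesis u_indep : forall n, ~ lcomb n (u n).

Lemma separated_basis n : exists w : 'I_n -> K,
  [/\ forall i, w i != 0, forall i, lcomb n (w i) &
      forall i j, i != j -> vseparated M (w i) (w j)].
Proof.
elim: n => [|n [w [w0 wn sw]]]; first by exists (fun=> 0); split=> -[].
suff red y : lcomb n (y - u n) ->
    exists2 y', lcomb n (y' - u n) & forall i, vseparated M y' (w i).
  have [|y yn sy] := red (u n); first by rewrite subrr; exact: lcomb0.
  have y0 : y != 0.
    apply/eqP => e; apply: (@u_indep n); rewrite -[u n]opprK; apply: lcombN.
    by rewrite -sub0r -e.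
  exists (fun i => if unlift ord_max i is Some j then w j else y); split.
  - by move=> i; case: unliftP => [j|] _.
  - move=> i; case: unliftP => [j|] _; first by apply: lcomb_widen (wn j).
    rewrite -(subrK (u n) y); apply: lcombD; last exact: lcomb_gen.
    by apply: lcomb_widen yn.
  - move=> i j; case: unliftP => [i'|] ->; case: unliftP => [j'|] -> //.
    + by move=> ij; apply: sw; apply: contra_neq ij => ->.
    + by move=> _; case: (sy i'); [right|left].
    + by rewrite eqxx.
(* Subtracting a multiple of a [w i] with the value of [y] brings [y] strictly
   below [w i], and it stays below whatever it was below before. *)
have [N] := ubnP #|[pred i | ~~ `[< M (y / w i) >]]|.
elim: N y => // N IH y; rewrite ltnS => cN yn.
have [sep|/existsNP[i nsep]] := pselect (forall i, vseparated M y (w i)).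
  by exists y.
have y0 : y != 0.
  apply/eqP => e; apply: nsep; left; rewrite e mul0r; exact: (M_zero nuM M0').
have yw0 : y / w i != 0 by rewrite mulf_neq0 ?invr_neq0.
have [Mi|Mi|[c c0 Mc]] := residue yw0; first by case: nsep; left.
  by case: nsep; right; rewrite -invf_div.
have Mi : M ((y - h c * w i) / w i) by rewrite mulrBl mulfK.
apply: (IH (y - h c * w i)); last first.
  rewrite addrAC; apply: lcombD => //; apply: lcombN; exact: lcombZ.
apply: leq_trans cN; apply: proper_card; apply/properP; split.
  apply/fintype.subsetP => j; rewrite !inE => /asboolPn nMj; apply/asboolPn => Mj; apply: nMj.
  have [ij|ij] := eqVneq i j; first by rewrite -ij.
  have [Uy _] := (vseparatedP y0 (w0 i)).1 nsep.
  have [_ Uy'] := (vseparatedP y0 (w0 i)).1 nsep.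
  have Mij : M (w i / w j).
    have -> : w i / w j = (y / w i)^-1 * (y / w j).
      by rewrite invf_div mulrA divfK.
    exact: Uy'.
  have -> : (y - h c * w i) / w j = ((y - h c * w i) / w i) * (w i / w j).
    by rewrite mulrA divfK.
  exact: (nonunitalM nuM Mi Mij).
exists i; rewrite !inE; first by apply/asboolPn => My; apply: nsep; left.
by apply/negP => /asboolPn.
Qed.

End Independent.

(** * Many products with distinct values *)

Section Counting.
Variables (d : nat) (x : 'I_d -> K).
Hypothesis x0 : forall i, x i != 0.
Hypothesis Mx : forall a, lexpos a -> M (mono x a).

(** The value of [y] lies in the lattice spanned by the values of the [x i], with coordinates
    [a]. *)
Definition val_at (y : K) (a : {ffun 'I_d -> int}) := vunit M (y / mono x a).

Lemma val_atM y z a b : val_at y a -> val_at z b -> val_at (y * z) (a + b).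
Proof. by rewrite /val_at monoD // -mulf_div; apply: vunitM. Qed.

Lemma val_at1 : val_at 1 0.
Proof. by rewrite /val_at mono0 divr1; apply: (vunit1 nuM). Qed.

Lemma val_atX y a n : val_at y a -> val_at (y ^+ n) (a *+ n).
Proof.
by move=> ya; elim: n => [|n IH]; rewrite ?exprS ?mulrS; [exact: val_at1|exact: val_atM].
Qed.

Lemma val_at_mono a : val_at (mono x a) a.
Proof. by rewrite /val_at divff ?mono_neq0 //; apply: (vunit1 nuM). Qed.

Lemma val_at_separated y z a b : val_at y a -> val_at z b -> a != b -> vseparated M y z.
Proof.
move=> ya zb ab; apply: (separated_vunit (c := mono x (a - b))).
- exact: mono_neq0.
- have : a - b != 0 by rewrite subr_eq0.
  by case/lexpos_total/orP => la; [left|right]; rewrite -?monoN //; apply: Mx.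
- rewrite (_ : y / z / _ = (y / mono x a) / (z / mono x b)); last first.
    rewrite monoB // !invf_div; ring.
  by apply: vunitM => //; apply: vunitV.
Qed.

Lemma val_at_inj y a b : val_at y a -> val_at y b -> y != 0 -> a = b.
Proof.
move=> ya yb y0; apply/eqP; apply: contrapT => /negP /(val_at_separated ya yb).
by apply/(vseparatedP y0 y0); rewrite divff //; apply: (vunit1 nuM).
Qed.

Definition box_mono (c : 'I_d -> nat) : K := \prod_i x i ^+ c i.

Lemma box_monoE c : box_mono c = mono x [ffun i => (c i)%:Z].
Proof. by apply: eq_bigr => i _; rewrite ffunE. Qed.

Variables (r : nat) (w : 'I_(r ^ d.+1) -> K).
Hypothesis r_gt0 : (0 < r)%N.
Hypothesis w0 : forall i, w i != 0.
Hypothesis w_sep : forall i j, i != j -> vseparated M (w i) (w j).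
Local Notation n := (r ^ d.+1)%N.

Local Notation T := ('I_r * {ffun 'I_d -> 'I_n})%type.

(** The two bounds keep each product a word of length O(n). The index type has [r * n^d] elements,
    [r] times as many as the box of monomials. *)
Definition box_family := exists (g : T -> seq 'I_n) (c : T -> 'I_d -> nat),
  [/\ forall t, (size (g t) <= n)%N, forall t i, (c t i <= n)%N &
    forall t t', t != t' -> vseparated M
      ((\prod_(a <- g t) w a) * box_mono (c t))
      ((\prod_(a <- g t') w a) * box_mono (c t'))].

(** Quotients of distinct representatives have no value in the lattice, so the boxes of monomials
    attached to them cannot meet in value. *)
Lemma box_family_many_cosets (f : 'I_r -> 'I_n) :
  (forall l l' a, val_at (w (f l) / w (f l')) a -> l = l') -> box_family.
Proof.
move=> finj; exists (fun t : T => [:: f t.1]), (fun (t : T) i => t.2 i : nat); split.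
- by move=> t; rewrite /= expn_gt0 r_gt0.
- by move=> t i; apply: ltnW.
move=> [l c] [l' c'] /= cc'; rewrite !big_seq1 !box_monoE.
set m := mono x _; set m' := mono x _.
apply: contrapT => /vseparatedP; rewrite !mulf_neq0 ?mono_neq0 // => /(_ isT isT) U.
have V : val_at (w (f l) / w (f l')) ([ffun i => (c' i)%:Z] - [ffun i => (c i)%:Z]).
  rewrite /val_at monoB // -/m -/m'; move: U; congr vunit.
  by rewrite !invfM !invrK; ring.
have ll' := finj _ _ _ V; move/eqP: cc'; apply.
rewrite ll' in V *; congr (_, _); apply/ffunP => i; apply: val_inj => /=.
move: V; rewrite divff // => V.
have /ffunP/(_ i) := val_at_inj V val_at1 (oner_neq0 _).
by rewrite !ffunE => /eqP; rewrite subr_eq0 => /eqP [].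
Qed.

(** In coordinate [i] the value of a product is a constant plus [(ap i - aq i) * a + l], where [a]
    counts the letters [p] and [l < r] is the exponent of [x i]. So [a] and [l] can be read off, and
    then the remaining exponents. *)
Lemma box_family_wide (p q b : 'I_n) (ap aq : {ffun 'I_d -> int}) i :
  val_at (w p / w b) ap -> val_at (w q / w b) aq -> (r%:Z <= ap i - aq i) -> box_family.
Proof.
move=> vp vq D.
(* [t.2 i] now counts the letters [p], and [t.1] takes its place as the exponent of [x i]. *)
exists (fun t : T => nseq (t.2 i) p ++ nseq (n - t.2 i) q),
  (fun (t : T) j => if j == i then t.1 : nat else t.2 j : nat); split.
- by move=> t; rewrite size_cat !size_nseq subnKC // ltnW.
- move=> t j; case: eqP => _; last exact: ltnW.
  by apply: (leq_trans (ltnW (ltn_ord _))); rewrite -{1}(expn1 r) leq_pexp2l.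
pose c (t : T) j := if j == i then t.1 : nat else t.2 j : nat.
pose e (t : T) : {ffun 'I_d -> int} :=
  ap *+ t.2 i + aq *+ (n - t.2 i) + [ffun j => (c t j)%:Z].
pose Y (t : T) := (w p / w b) ^+ t.2 i * (w q / w b) ^+ (n - t.2 i) * box_mono (c t).
(* Padding with [q] gives every word exactly [n] letters, so normalizing the letters by [w b] costs
   one common factor [w b ^+ n]. *)
have YE (t : T) : (\prod_(a <- nseq (t.2 i) p ++ nseq (n - t.2 i) q) w a) * box_mono (c t)
    = w b ^+ n * Y t.
  rewrite big_cat /= !big_nseq !iter_mulr_1 /Y [RHS]mulrA; congr (_ * _).
  have -> : w b ^+ n = w b ^+ (t.2 i) * w b ^+ (n - t.2 i).
    by rewrite -exprD subnKC // ltnW.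
  by rewrite mulrACA -!exprMn ![w b * _]mulrC !divfK.
have valY (t : T) : val_at (Y t) (e t).
  apply: val_atM; last by rewrite box_monoE; exact: val_at_mono.
  by apply: val_atM; apply: val_atX.
move=> t t' tt'; rewrite !YE; apply: vseparated_scale; first by rewrite expf_neq0.
apply: (val_at_separated (valY t) (valY t')); apply: contra_neq tt'.
case: t t' => [l a] [l' a'] /ffunP eE.
have ffE (f : {ffun 'I_d -> int}) N j : (f *+ N) j = f j *+ N by rewrite ffunMnE.
have [ai ll] : a i = a' i :> nat /\ l = l' :> nat.
  have := eE i; rewrite /e /c !ffunE /= eqxx !ffE.
  have := ltn_ord (a i); have := ltn_ord (a' i); have := ltn_ord l; have := ltn_ord l'.
  by move=> ? ? ? ? eq; apply: (combination_inj D) eq => //; apply: ltnW.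
congr (_, _); first exact: val_inj.
apply/ffunP => j; apply: val_inj => /=; have [->//|ji] := eqVneq j i.
have := eE j; rewrite /e /c !ffunE /= (negPf ji) !ffE ai => /addrI.
by move=> [].
Qed.

(* Either the values of [w] meet [r] cosets of the lattice spanned by the values
   of [x], or more than [r ^ d] of them lie in one coset.  In the second case
   some coordinate [i] spreads over at least [r], between [p] and [q] say, and
   the products [p^a q^(n-a)] combine with the [x_i^l], [l < r]. *)
Lemma box_family_exists : box_family.
Proof.
pose e := fun i j : 'I_n => `[< exists a, val_at (w j / w i) a >].
have eP i j : reflect (exists a, val_at (w j / w i) a) (e i j) by apply: asboolP.
have e_refl i : e i i by apply/eP; exists 0; rewrite divff //; exact: val_at1.
pose cls i := [set j | e i j]%SET.
have clsE i j : e i j -> cls i = cls j.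
  move=> /eP[a va]; apply/setP => l; rewrite !inE; apply/eP/eP => -[b vb].
    exists (b - a).
    have -> : w l / w j = w l / w i / (w j / w i) by rewrite invf_div mulrA divfK.
    rewrite /val_at monoB // (_ : _ / _ = (w l / w i / mono x b) / (w j / w i / mono x a)).
      by apply: vunitM => //; apply: vunitV.
    by rewrite !invf_div; ring.
  exists (b + a); have -> : w l / w i = w l / w j * (w j / w i) by rewrite mulrA divfK.
  exact: val_atM.
pose P := [set cls i | i in [set: 'I_n]%SET]%SET.
have [rP|Pr] := leqP r #|P|.
  have /choice[f fP] (l : 'I_r) : exists i, cls i = nth finset.set0 (enum P) l.
    have : nth finset.set0 (enum P) l \in enum P.
      by rewrite mem_nth // -cardE (leq_trans (ltn_ord l)).
    by rewrite mem_enum => /imsetP[i _ ->]; exists i.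
  apply: (box_family_many_cosets (f := f)) => l l' a va.
  have /clsE : e (f l') (f l) by apply/eP; exists a.
  rewrite !fP => /eqP; rewrite nth_uniq ?enum_uniq -?cardE ?(leq_trans (ltn_ord _)) //.
  by move=> /eqP ll'; apply: val_inj.
have [b bigb] : exists b, (r ^ d < #|cls b|)%N.
  apply: contrapT => /forallNP small.
  have : (#|finset.cover P| <= \sum_(A in P) #|A|)%N by apply: leq_card_cover.
  have -> : finset.cover P = [set: 'I_n]%SET.
    apply/setP => i; rewrite inE; apply/finset.bigcupP; exists (cls i); last by rewrite inE.
    exact: imset_f.
  rewrite cardsT card_ord; apply/negP; rewrite -ltnNge.
  apply: (@leq_ltn_trans (#|P| * r ^ d)%N); last first.
    have : (#|P| * r ^ d < r * r ^ d)%N by rewrite ltn_pmul2r // expn_gt0 r_gt0.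
    by rewrite -expnS.
  rewrite -sum_nat_const; apply: leq_sum => _ /imsetP[i _ ->].
  by rewrite leqNgt; apply/negP.
have /choice[al alP] j : exists a, j \in cls b -> val_at (w j / w b) a.
  have [|jb] := boolP (j \in cls b); last by exists 0.
  by rewrite inE => /eP[a va]; exists a.
have bb : b \in cls b by rewrite inE.
apply: contrapT => nobox; move: bigb; rewrite ltnNge; apply/negP/negPn.
have /choice[q qP] i : exists q, q \in cls b /\ forall j, j \in cls b -> (al q i <= al j i).
  have [|||q] := @seq_max _ (fun q j => al q i <= al j i) (enum (cls b)).
  - by move=> j l _ _; apply/orP; exact: le_total.
  - by move=> j l t _ _ _; exact: le_trans.
  - by apply/eqP => e0; move: (bb); rewrite -mem_enum e0.
  rewrite mem_enum => qb qmin; exists q; split => // j jb.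
  by apply: qmin; rewrite mem_enum.
have bound i j : j \in cls b -> al j i - al (q i) i < r%:Z.
  move=> jb; rewrite ltNge; apply/negP => D; apply: nobox.
  by apply: (box_family_wide (alP j jb) (alP _ (qP i).1) D).
(* If all spreads stay below [r], coordinates counted from their minimum place the class injectively
   among [r^d] points. *)
pose F j : {ffun 'I_d -> 'I_r} := [ffun i => insubd (Ordinal r_gt0) `|al j i - al (q i) i|%N].
have cF : #|{ffun 'I_d -> 'I_r}| = (r ^ d)%N by rewrite card_ffun !card_ord.
rewrite -cF -(@card_in_imset _ _ F); first exact: max_card.
move=> j j' jb jb' /ffunP FE.
have alE : al j = al j'.
  apply/ffunP => i; have := FE i; rewrite !ffunE => /(congr1 val).
  have [_ qmin] := qP i.
  have := bound i j jb; have := bound i j' jb'; have := qmin j jb; have := qmin j' jb'.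
  by rewrite !val_insubd; move: (al j i) (al j' i) (al (q i) i) => A B C; do 2![case: ifP]; lia.
apply/eqP; apply: contrapT => /negP /w_sep.
apply/vseparatedP => //.
have -> : w j / w j' = (w j / w b / mono x (al j)) / (w j' / w b / mono x (al j')).
  rewrite alE; have m0 := mono_neq0 x0 (al j'); field.
  by rewrite m0 !w0.
by apply: vunitM; [apply: alP|apply: vunitV; apply: alP].
Qed.

End Counting.
End SeparatedFamilies.

(** * Dimensions and Gelfand-Kirillov dimension *)

Section Dimension.
Variables (k : fieldType) (V : lmodType k).
Implicit Types (U X : set V).

Lemma lspan_subspace X : subspace (lspan X).
Proof.
split=> [U [[U0 _] _] //|c u v Xu Xv U cU].
by have [[_ UD] _] := cU; apply: UD; [apply: Xu|apply: Xv].
Qed.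

Lemma subspaceD U u v : subspace U -> U u -> U v -> U (u + v).
Proof. by move=> [_ UD] Uu Uv; rewrite -[u]scale1r; apply: UD. Qed.

Lemma subspaceZ U c u : subspace U -> U u -> U (c *: u).
Proof. by move=> [U0 UD] Uu; rewrite -[c *: u]addr0; apply: UD. Qed.

Lemma subspace_sum U (I : Type) (r : seq I) (c : I -> k) (b : I -> V) :
  subspace U -> (forall i, U (b i)) -> U (\sum_(i <- r) c i *: b i).
Proof.
move=> sU Ub; apply: big_ind => [|u v|i _]; [exact: sU.1|exact: subspaceD|exact: subspaceZ].
Qed.

Lemma lspan_sub X U : subspace U -> X `<=` U -> lspan X `<=` U.
Proof. by move=> sU XU; apply: smallest_sub. Qed.

Lemma sub_lspan X : X `<=` lspan X.
Proof. exact: sub_gen_smallest. Qed.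

Lemma lspan_range n (b : 'I_n -> V) y : lspan (range b) y ->
  exists c : 'I_n -> k, y = \sum_i c i *: b i.
Proof.
apply: (@lspan_sub _ [set y | exists c : 'I_n -> k, y = \sum_i c i *: b i]).
  split; first by exists (fun=> 0); rewrite big1 // => i _; rewrite scale0r.
  move=> a _ _ [c ->] [c' ->]; exists (fun i => a * c i + c' i).
  by rewrite scaler_sumr -big_split; apply: eq_bigr => i _; rewrite scalerDl scalerA.
move=> _ [i _ <-]; exists (fun l => (l == i)%:R).
rewrite (bigD1 i) //= eqxx scale1r big1 ?addr0 // => l /negPf ->.
by rewrite scale0r.
Qed.

Lemma finite_basis (s : seq V) : exists n (b : 'I_n -> V), is_basis (lspan [set` s]) b.
Proof.
elim: s => [|x s [n [b [bi bs]]]].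
  exists 0%N, (fun=> 0); split=> [c _ []//|].
  by congr lspan; apply/seteqP; split=> [y [[]]|y].
have [xs|xs] := pselect (lspan [set` s] x).
  exists n, b; split => //; rewrite bs; apply/seteqP; split.
    apply: lspan_sub; first exact: lspan_subspace.
    by move=> y ys; apply: sub_lspan; rewrite /= inE ys orbT.
  apply: lspan_sub; first exact: lspan_subspace.
  by move=> y /=; rewrite inE => /orP[/eqP -> //|ys]; apply: sub_lspan.
pose b' (i : 'I_n.+1) := if unlift ord_max i is Some l then b l else x.
have b'max : b' ord_max = x by rewrite /b' unlift_none.
have b'lift i : b' (lift ord_max i) = b i by rewrite /b' liftK.
exists n.+1, b'; split.
  move=> c; rewrite (bigD1 ord_max) //= b'max => e.
  have e' : \sum_(i | i != ord_max) c i *: b' i = \sum_i c (lift ord_max i) *: b i.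
    rewrite (reindex_omap (lift ord_max) (unlift ord_max)) /=; last first.
      by move=> i ni; case: unliftP ni => [l ->|->] //; rewrite eqxx.
    apply: eq_big => [i|i _]; last by rewrite b'lift.
    by rewrite liftK eqxx andbT eq_sym neq_lift.
  have cm : c ord_max = 0.
    apply/eqP; apply: contrapT => /negP cm; apply: xs; rewrite -bs.
    have -> : x = \sum_i (- (c ord_max)^-1 * c (lift ord_max i)) *: b i.
      under eq_bigr do rewrite -scalerA.
      rewrite -scaler_sumr -e'; move/eqP: e; rewrite addrC addr_eq0 => /eqP ->.
      by rewrite scaleNr scalerN opprK scalerA mulVf // scale1r.
    apply: (subspace_sum (U := lspan (range b))); first exact: lspan_subspace.
    by move=> i; apply: sub_lspan; exists i.
  rewrite e' cm scale0r add0r in e => i.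
  by case: (unliftP ord_max i) => [l|] -> //; apply: (bi (fun i => c (lift ord_max i))).
apply/seteqP; split.
  apply: lspan_sub; first exact: lspan_subspace.
  move=> _ [i _ <-]; case: (unliftP ord_max i) => [l|] ->.
    rewrite b'lift; have : lspan (range b) (b l) by apply: sub_lspan; exists l.
    rewrite bs; apply: lspan_sub; first exact: lspan_subspace.
    by move=> y ys; apply: sub_lspan; rewrite /= inE ys orbT.
  by rewrite b'max; apply: sub_lspan; rewrite /= mem_head.
apply: lspan_sub; first exact: lspan_subspace.
move=> y /=; rewrite inE => /orP[/eqP ->|ys].
  by rewrite -b'max; apply: sub_lspan; exists ord_max.
have : lspan [set` s] y by apply: sub_lspan.
rewrite -bs; apply: lspan_sub; first exact: lspan_subspace.
by move=> _ [i _ <-]; rewrite -b'lift; apply: sub_lspan; exists (lift ord_max i).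
Qed.

(** [vdim] falls back to 0 when no basis is found, so a lower bound needs the finite basis of
    [finite_basis]. *)
Lemma vdim_ge (s : seq V) (I : finType) (b : I -> V) :
  (forall i, lspan [set` s] (b i)) ->
  (forall c : I -> k, \sum_i c i *: b i = 0 -> forall i, c i = 0) ->
  (#|I| <= vdim (lspan [set` s]))%N.
Proof.
move=> bU bi; rewrite /vdim; case: xgetP => [n _ [e [ei es]]|nob]; last first.
  by have [n [b' b'P]] := finite_basis s; case: (nob n); exists b'.
have /choice[C CP] i : exists c : 'I_n -> k, b i = \sum_l c l *: e l.
  by apply: lspan_range; rewrite es.
rewrite leqNgt; apply/negP => nI.
have [|c [i0 ci0] cC] := @linear_dependence k I 'I_n C; first by rewrite card_ord.
move/eqP: ci0; apply; apply: bi.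
under eq_bigr do rewrite CP scaler_sumr.
rewrite exchange_big /= big1 // => l _.
under eq_bigr do rewrite scalerA.
by rewrite -scaler_suml cC scale0r.
Qed.

End Dimension.

Fixpoint words (T : Type) (s : seq T) (n : nat) : seq (seq T) :=
  if n is n'.+1 then [::] :: [seq a :: w | a <- s, w <- words s n'] else [:: [::]].

Lemma mem_words (T : eqType) (s : seq T) n w :
  (w \in words s n) = (size w <= n)%N && all (mem s) w.
Proof.
elim: n w => [|n IH] w; first by rewrite inE; case: w.
rewrite inE; case: w => //= a w; rewrite ltnS.
apply/allpairsP/and3P => [[[a' w'] /= [as_ ws [-> ->]]]|[wn as_ ws]].
  by move: ws; rewrite IH => /andP[].
by exists (a, w); rewrite /= IH wn.
Qed.

(** Presents the power space as the span of a finite sequence, the form that [vdim_ge] takes. *)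
Lemma power_space_words (k : fieldType) (A : algType k) (s : seq A) n :
  power_space s n = lspan [set` [seq \prod_(a <- w) a | w <- words s n]].
Proof.
congr lspan; apply/seteqP; split=> [_ [w [wn ws] <-]|y /= /mapP[w]].
  by apply/mapP; exists w => //; rewrite mem_words wn; apply/allP.
by rewrite mem_words => /andP[wn /allP ws] ->; exists w.
Qed.

(* Along [n = C r^(d+1)] the growth exponent tends to
   [((d+1)^2 + 1) / (d+1) > d + 1]. *)
Lemma GKdim_gt (R : realType) (k : fieldType) (A : algType k) (s : seq A) (C d : nat) :
  (1 < C)%N ->
  (forall r, (0 < r)%N ->
    (r ^ (d.+1 * d.+1).+1 <= vdim (power_space s (C * r ^ d.+1)))%N) ->
  ~ (GKdim R A <= (d.+1%:R)%:E)%E.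
Proof.
move=> C1 growth GK.
pose u n : \bar R := (ln ((vdim (power_space s n))%:R : R) / ln (n%:R : R))%:E.
pose D : R := d.+1%:R; have D0 : 0 < D by rewrite ltr0n.
(* The growth hypothesis pushes the exponent towards [D + 1/D]; half of this gain is kept as
   slack. *)
have : (limn_esup u < (D + (2 * D)^-1)%:E)%E.
  apply: (@le_lt_trans _ _ D%:E); last by rewrite lte_fin ltrDl invr_gt0 mulr_gt0.
  by apply: le_trans GK; apply: ereal_sup_ubound; exists s.
move=> /ereal_inf_lt[_ [B [N _ NB] <-] supB].
have bound n : (N <= n)%N -> ln ((vdim (power_space s n))%:R : R) / ln (n%:R : R) < D + (2 * D)^-1.
  move=> Nn; rewrite -lte_fin; apply: le_lt_trans supB.
  by apply: ereal_sup_ubound; exists n => //; apply: NB.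
(* With [r = C^q] all logarithms become multiples of [ln C], and the claim reduces to
   [D + 1/(2D) <= q/2], for which [q >= 2D + 1] suffices. The summand [N] puts [C * r^(d+1)] beyond
   the threshold. *)
pose q := (2 * d.+1 + 1 + N)%N; pose r := (C ^ q)%N.
have C0 : (0 < C)%N by apply: ltnW.
have r0 : (0 < r)%N by rewrite expn_gt0 C0.
have qr : (q <= r)%N by apply: ltnW; apply: ltn_expl.
have lC : 0 < ln (C%:R : R) by rewrite ln_gt0 // ltr1n.
have lr : ln (r%:R : R) = q%:R * ln (C%:R : R).
  by rewrite natrX lnXn ?ltr0n // mulr_natl.
have Nm : (N <= C * r ^ d.+1)%N.
  apply: (@leq_trans r); first by apply: leq_trans qr; rewrite /q leq_addl.
  by rewrite expnS mulnCA leq_pmulr // muln_gt0 C0 expn_gt0 r0.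
have lm : ln ((C * r ^ d.+1)%:R : R) = ln (C%:R : R) + D * ln (r%:R : R).
  have rD0 : (0 < r ^ d.+1)%N by rewrite expn_gt0 r0.
  by rewrite natrM lnM ?posrE ?ltr0n // [(r ^ _)%:R]natrX lnXn ?ltr0n // mulr_natl.
have := bound _ Nm; apply/negP; rewrite -leNgt.
have lr0 : 0 < ln (r%:R : R) by rewrite lr mulr_gt0 // ltr0n /q addn1.
rewrite ler_pdivlMr; last by rewrite lm addr_gt0 // mulr_gt0.
apply: (@le_trans _ _ ((D * D + 1) * ln (r%:R : R))); last first.
  have -> : (D * D + 1) * ln (r%:R : R) = ln ((r ^ (d.+1 * d.+1).+1)%:R : R).
    by rewrite natrX lnXn ?ltr0n // /D -natrM natr1 mulr_natl.
  have p0 : (0 < r ^ (d.+1 * d.+1).+1)%N by rewrite expn_gt0 r0.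
  rewrite ler_ln ?posrE ?ltr0n //; last by apply: leq_trans (growth r r0).
  by rewrite ler_nat growth.
rewrite lm lr; set L := ln _.
have qD : 2 * D + 1 <= q%:R by rewrite /q !natrD natrM lerDl.
have e : (D + (2 * D)^-1) * (L + D * (q%:R * L)) = (D * D * q%:R + q%:R / 2 + D + (2 * D)^-1) * L.
  by field; rewrite gt_eqF.
rewrite e mulrA; apply: ler_wpM2r; first exact: ltW.
have : (2 * D)^-1 <= 1 / 2.
  by rewrite invfM mul1r ler_piMr // ?invr_ge0 // invf_le1 // ler1n.
move: qD; move: (q%:R : R) ((2 * D)^-1) => Q I qD IP.
rewrite [leRHS]mulrDl mul1r -!addrA lerD2l; lra.
Qed.

(** * Products of translates *)

Section ProductSpan.
Variables (k K : fieldType) (h : {rmorphism k -> K}).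

Inductive prodspan (G : set K) (N : nat) : K -> Prop :=
| prodspan0 : prodspan G N 0
| prodspan_cons c (l : seq K) y : (size l <= N)%N -> (forall a, a \in l -> G a) ->
    prodspan G N y -> prodspan G N (h c * \prod_(a <- l) a + y).

Variable G : set K.

Lemma prodspan_gen a : G a -> prodspan G 1 a.
Proof.
move=> Ga; have := @prodspan_cons G 1 1 [:: a] 0 isT _ (prodspan0 G 1).
rewrite big_seq1 rmorph1 mul1r addr0; apply.
by move=> b; rewrite inE => /eqP ->.
Qed.

Lemma prodspan1 N : prodspan G N 1.
Proof.
have := @prodspan_cons G N 1 [::] 0 isT _ (prodspan0 G N).
by rewrite big_nil rmorph1 mul1r addr0; apply.
Qed.

Lemma prodspanD N y z : prodspan G N y -> prodspan G N z -> prodspan G N (y + z).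
Proof.
by move=> Py Pz; elim: Py => [|c l y' sl Gl _ IH]; rewrite ?add0r // -addrA; apply: prodspan_cons.
Qed.

Lemma prodspanZ N c y : prodspan G N y -> prodspan G N (h c * y).
Proof.
elim=> [|c' l y' sl Gl _ IH]; first by rewrite mulr0; exact: prodspan0.
by rewrite mulrDr mulrA -rmorphM; apply: prodspan_cons.
Qed.

Lemma prodspan_leq N N' y : (N <= N')%N -> prodspan G N y -> prodspan G N' y.
Proof.
move=> NN'; elim=> [|c l y' sl Gl _ IH]; first exact: prodspan0.
by apply: prodspan_cons => //; apply: leq_trans NN'.
Qed.

Lemma prodspanM N N' y z : prodspan G N y -> prodspan G N' z -> prodspan G (N + N') (y * z).
Proof.
move=> Py Pz; elim: Py => [|c l y' sl Gl _ IH]; first by rewrite mul0r; exact: prodspan0.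
rewrite mulrDl; apply: prodspanD => //; rewrite -mulrA; apply: prodspanZ.
elim: Pz => [|c' l' z' sl' Gl' _ IH']; first by rewrite mulr0; exact: prodspan0.
rewrite mulrDr mulrCA -big_cat; apply: prodspan_cons => //.
  by rewrite size_cat leq_add.
by move=> a; rewrite mem_cat => /orP[/Gl|/Gl'].
Qed.

Lemma prodspanX n a : G a -> prodspan G n (a ^+ n).
Proof.
move=> Ga; elim: n => [|n IH]; first by rewrite expr0; exact: prodspan1.
by rewrite exprS -add1n; apply: prodspanM => //; exact: prodspan_gen.
Qed.

Lemma prodspan_prod (I : Type) (r : seq I) (F : I -> K) N :
  (forall i, prodspan G N (F i)) -> prodspan G (size r * N) (\prod_(i <- r) F i).
Proof.
move=> PF; elim: r => [|i r IH]; first by rewrite big_nil; exact: prodspan1.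
by rewrite big_cons mulSn; apply: prodspanM.
Qed.

End ProductSpan.

(** Multiplication by the common factor [prod_i B_i^n] turns each monomial [x^c] of the box into
    [prod_i A_i^(c_i) B_i^(n - c_i)], without affecting separation. This costs [n] factors for each
    [i], beside the [n] factors for the combinations of translates. *)
Lemma orbit_growth (k : closedFieldType) (K : fieldType) (h : {rmorphism k -> K})
    d (x A B : 'I_d -> K) (u : nat -> K) (r : nat) :
  alg_indep h x -> (forall y, algebraic_over (gen_subfield h (range x)) y) ->
  (forall i, [/\ A i != 0, B i != 0 & x i = A i / B i]) ->
  (forall n, ~ lcomb h u n (u n)) -> (0 < r)%N ->
  let n := (r ^ d.+1)%N in
  let G := [set y | (exists2 i, (i < n)%N & y = u i) \/ exists i, y = A i \/ y = B i] in
  exists Y : 'I_r * {ffun 'I_d -> 'I_n} -> K,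
    (forall t, prodspan h G (n + d * n) (Y t)) /\
    forall c, \sum_t h (c t) * Y t = 0 -> forall t, c t = 0.
Proof.
move=> xi Kalg xAB ui r0 n G.
have [M [nuM M0' Mmax Mx res]] := lex_valuation_residue xi Kalg.
have x0 := alg_indep_neq0 xi.
have [w [w0 wn ws]] := separated_basis nuM M0' Mmax res ui n.
have [g [c [sg cn sep]]] := box_family_exists nuM M0' Mmax x0 Mx r0 w0 ws.
pose Y t := (\prod_(a <- g t) w a) * \prod_i (A i ^+ c t i * B i ^+ (n - c t i)).
exists Y; split.
  move=> t; apply: prodspanM.
    apply: (prodspan_leq (sg t)); rewrite -[size _]muln1; apply: prodspan_prod => i.
    have [cf ->] := wn i; apply: big_ind; [exact: prodspan0|exact: prodspanD|].
    by move=> l _; apply: prodspanZ; apply: prodspan_gen; left; exists l.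
  rewrite -[X in (X * _)%N](size_enum_ord d) -big_enum; apply: prodspan_prod => i.
  apply: (@prodspan_leq _ _ _ _ (c t i + (n - c t i))); first by rewrite subnKC.
  by apply: prodspanM; apply: prodspanX; right; exists i; [left|right].
have YE t : Y t = (\prod_i B i ^+ n) * ((\prod_(a <- g t) w a) * box_mono x (c t)).
  rewrite /Y mulrCA; congr (_ * _); rewrite /box_mono -big_split; apply: eq_bigr => i _ /=.
  have [A0 B0 ->] := xAB i; rewrite expr_div_n.
  have -> : B i ^+ n = B i ^+ c t i * B i ^+ (n - c t i) by rewrite -exprD subnKC.
  by field; rewrite expf_neq0.
have B0 : \prod_i B i ^+ n != 0.
  by apply/prodf_neq0 => i _; have [_ B0 _] := xAB i; rewrite expf_neq0.
move=> cf; apply: (separated_indep nuM M0' Mmax).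
  move=> t; rewrite YE !mulf_neq0 //; first by rewrite prodf_seq_neq0; apply/allP => a _; rewrite w0.
  by rewrite box_monoE mono_neq0.
by move=> t t' tt'; rewrite !YE; apply: vseparated_scale => //; apply: sep.
Qed.

Section SkewBasics.
Variables (K : fieldType) (s : {rmorphism K -> K}) (s_bij : bijective s).
Local Notation Q := (skewLaurent s_bij).

Lemma slmonoM m n a b : slmono s_bij m a * slmono s_bij n b =
  slmono s_bij (m + n) (a * aut_pow s m b) :> Q.
Proof. exact: slmul_mono. Qed.

Lemma slmono_coef m n a :
  @monalg.mcoeff int K m (slmono s_bij n a) = if n == m then a else 0.
Proof. by rewrite /slmono monalg.mcoeffU; case: eqP => _; rewrite ?mulr1n ?mulr0n. Qed.

Lemma slmono_inj n : injective (slmono s_bij n).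
Proof.
move=> a b /(congr1 (@monalg.mcoeff int K n)).
by rewrite !slmono_coef eqxx.
Qed.

(* [(tau t)^n = skew_power tau n * t^n] *)
Fixpoint skew_power (tau : K) n : K :=
  if n is n'.+1 then tau * s (skew_power tau n') else 1.

Lemma skew_power_neq0 tau n : tau != 0 -> skew_power tau n != 0.
Proof. by move=> t0; elim: n => [|n IH] /=; rewrite ?oner_neq0 // mulf_neq0 // fmorph_eq0. Qed.

End SkewBasics.

(** * Realizing products of translates by words in [A] *)

Section Words.
Variables (k : fieldType) (A : algType k) (K : fieldType) (h : {rmorphism k -> K}).
Variables (s : {rmorphism K -> K}) (s_bij : bijective s).
Variable j : {rmorphism A -> skewLaurent s_bij}.
Hypothesis jC : forall c : k, j c%:A = slC s_bij (h c).
Variables (tA : A) (tau : K).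
Hypothesis jt : j tA = slmono s_bij 1 tau.
Variables (V : seq A) (kap : A -> K).
Hypothesis jV : forall a, a \in V -> j a = slC s_bij (kap a).

(* The letter of translate [i] is placed after exactly [i] copies of [tA]. *)
Lemma word_realization n (l : seq (nat * A)) :
  (forall p, p \in l -> (p.1 <= n)%N /\ p.2 \in V) ->
  exists w : seq A, [/\ size w = (size l + n)%N, {subset w <= tA :: V} &
    j (\prod_(a <- w) a) =
      slmono s_bij n ((\prod_(p <- l) iter p.1 s (kap p.2)) * skew_power s tau n)].
Proof.
have base (l0 : seq (nat * A)) : (forall p, p \in l0 -> p.1 = 0%N /\ p.2 \in V) ->
    exists w : seq A, [/\ size w = size l0, {subset w <= tA :: V} &
      j (\prod_(a <- w) a) = slC s_bij (\prod_(p <- l0) iter p.1 s (kap p.2))].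
  elim: l0 => [|[i a] l0 IH] lP.
    by exists [::]; rewrite !big_nil rmorph1; split.
  have [|w [sw wV jw]] := IH; first by move=> p pl; apply: lP; rewrite inE pl orbT.
  have [/= i0 aV] := lP _ (mem_head _ _).
  exists (a :: w); split=> [|b|]; first by rewrite /= sw.
    by rewrite inE => /orP[/eqP ->|/wV //]; rewrite inE aV orbT.
  by rewrite !big_cons rmorphM jw jV //= i0 /slC slmonoM.
elim: n l => [|n IH] l lP.
  have [|w [sw wV jw]] := base l; first by move=> p /lP[]; case: p.1.
  by exists w; rewrite addn0 /= mulr1.
(* Letters of translate 0 come before the first [tA]. The others go after it with their index
   lowered by one, which passing [tA] restores. *)
pose l0 := [seq p <- l | p.1 == 0%N]; pose l1 := [seq p <- l | p.1 != 0%N].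
have [|w0 [sw0 wV0 jw0]] := base l0.
  by move=> p; rewrite mem_filter => /andP[/eqP -> /lP[]].
pose l1' := [seq (p.1.-1, p.2) | p <- l1].
have [|w1 [sw1 wV1 jw1]] := IH l1'.
  move=> p /mapP[q]; rewrite mem_filter => /andP[q0 /lP[qn qV]] -> /=; split => //.
  by rewrite -ltnS prednK // lt0n.
exists (w0 ++ tA :: w1); split.
- rewrite size_cat /= sw0 sw1 size_map !addnS addnA.
  by rewrite !size_filter -(count_predC (fun p : nat * A => p.1 == 0%N) l).
- by move=> a; rewrite mem_cat inE => /orP[/wV0 //|/orP[/eqP ->|/wV1 //]]; rewrite mem_head.
rewrite big_cat big_cons !rmorphM jw0 jt jw1 /slC !slmonoM add0r /=.
congr (slmono _ _ _).
have e1 : s (\prod_(p <- l1') iter p.1 s (kap p.2)) = \prod_(p <- l1) iter p.1 s (kap p.2).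
  rewrite rmorph_prod big_map big_seq [RHS]big_seq; apply: eq_bigr => p.
  by rewrite mem_filter => /andP[p0 _] /=; rewrite -iterS prednK // lt0n.
have e2 : \prod_(p <- l) iter p.1 s (kap p.2) =
    (\prod_(p <- l0) iter p.1 s (kap p.2)) * \prod_(p <- l1) iter p.1 s (kap p.2).
  by rewrite (bigID (fun p : nat * A => p.1 == 0%N)) /= [in RHS]big_filter [X in _ = _ * X]big_filter.
by rewrite [s (_ * _)]rmorphM e1 e2 -[RHS]mulrA; congr (_ * _); rewrite mulrCA.
Qed.

Lemma j_scale c a : j (c *: a) = slC s_bij (h c) * j a.
Proof. by rewrite -mulr_algl rmorphM jC. Qed.

(** The extra factor [skew_power s tau m] depends on [m] alone, so in each degree [m >= n]
    independence of the [y] carries over to [A]. *)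
Lemma prodspan_power_space (G : set K) n N y :
  (forall a, G a -> exists i b, [/\ (i <= n)%N, b \in V & a = iter i s (kap b)]) ->
  prodspan h G N y -> forall m, (n <= m)%N ->
  exists2 a, power_space (tA :: V) (N + m) a &
    j a = slmono s_bij m (y * skew_power s tau m).
Proof.
move=> GP Py m nm; elim: Py => [|c l {}y sl Gl _ [a Pa ja]].
  exists 0; first exact: (lspan_subspace _).1.
  by rewrite rmorph0 mul0r raddf0.
have [l' [sl' l'P el']] : exists l' : seq (nat * A), [/\ size l' = size l,
    forall p, p \in l' -> (p.1 <= n)%N /\ p.2 \in V &
    \prod_(p <- l') iter p.1 s (kap p.2) = \prod_(a <- l) a].
  elim: l Gl {sl} => [|b l IH] Gl; first by exists [::]; rewrite !big_nil.
  have [|l' [sl' l'P el']] := IH; first by move=> p pl; apply: Gl; rewrite inE pl orbT.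
  have [i [b' [im b'V eb]]] := GP _ (Gl _ (mem_head _ _)).
  exists ((i, b') :: l'); split; first by rewrite /= sl'.
    by move=> p; rewrite inE => /orP[/eqP -> //|/l'P].
  by rewrite !big_cons el' -eb.
have [|w [sw wV jw]] := @word_realization m l'.
  by move=> p /l'P[pn pV]; split => //; apply: leq_trans nm.
exists (c *: (\prod_(a <- w) a) + a).
  apply: (lspan_subspace _).2 => //; apply: sub_gen_smallest; exists w => //.
  by split => //=; rewrite sw sl' leq_add2r.
by rewrite rmorphD /= j_scale jw ja el' /slC slmonoM add0r -raddfD /= mulrA mulrDl.
Qed.

End Words.

(** * Orbits of the degree zero part are finite dimensional *)

Section OrbitFinite.
Variables (R : realType) (k : closedFieldType) (A : algType k).
Variables (K : fieldType) (h : {rmorphism k -> K}).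
Variables (s : {rmorphism K -> K}) (s_bij : bijective s).
Variable j : {rmorphism A -> skewLaurent s_bij}.
Hypothesis jC : forall c : k, j c%:A = slC s_bij (h c).
Local Notation coef := (@monalg.mcoeff int K).

(** [A_0] seen inside [K], described without the grading; [zero_part_degree0] and
    [degree0_zero_part] identify the two. *)
Definition zero_part : set K := [set z | exists a, j a = slC s_bij z].

Lemma sl_coef_sum (I : Type) (r : seq I) (P : pred I) (F : I -> skewLaurent s_bij) n :
  coef n (\sum_(i <- r | P i) F i) = \sum_(i <- r | P i) coef n (F i).
Proof.
by apply: (big_morph (coef n)); [exact: monalg.mcoeffD|exact: monalg.mcoeff0].
Qed.

Variables (tA : A) (tau : K).
Hypotheses (jt : j tA = slmono s_bij 1 tau) (tau0 : tau != 0).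

Lemma power_space_leq (V : seq A) n n' : (n <= n')%N ->
  power_space V n `<=` power_space V n'.
Proof.
move=> nn'; apply: lspan_sub; first exact: lspan_subspace.
move=> _ [w [wn wV] <-]; apply: sub_lspan; exists w => //.
by split => //; apply: leq_trans nn'.
Qed.

(** Every [Y t] is realized in each of the degrees [n, ..., 2n - 1]. A linear relation splits by
    degree, and in one degree it is a relation among the [Y t]. *)
Lemma vdim_growth (V : seq A) (I : finType) (Y : I -> K) (G : set K) n N :
  (forall a, a \in V -> j a = slC s_bij (coef 0 (j a))) ->
  (forall a, G a -> exists i b, [/\ (i <= n)%N, b \in V & a = iter i s (coef 0 (j b))]) ->
  (forall t, prodspan h G N (Y t)) ->
  (forall c, \sum_t h (c t) * Y t = 0 -> forall t, c t = 0) ->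
  (n * #|I| <= vdim (power_space (tA :: V) (N + (n + n))))%N.
Proof.
move=> jV GP YP Yind.
have real (p : 'I_n * I) : exists a, power_space (tA :: V) (N + (n + p.1)) a /\
    j a = slmono s_bij (n + p.1)%N (Y p.2 * skew_power s tau (n + p.1)).
  have [a Pa ja] := prodspan_power_space jC jt jV GP (YP p.2) (leq_addr p.1 n).
  by exists a.
have [b bP] := choice real.
rewrite -[X in (X * _)%N](card_ord n) -card_prod power_space_words.
apply: (vdim_ge (b := b)).
  move=> p; rewrite -power_space_words.
  have [Pb _] := bP p; apply: power_space_leq Pb.
  by rewrite !leq_add2l ltnW.
move=> c e [i t].
have sp0 : skew_power s tau (n + i) != 0 by apply: skew_power_neq0.
have e' : \sum_t h (c (i, t)) * Y t = 0.
  apply: (mulIf sp0); rewrite mul0r mulr_suml.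
  have := congr1 (fun q => coef (n + i)%N (j q)) e.
  rewrite rmorph0 monalg.mcoeff0 raddf_sum sl_coef_sum => e2; rewrite -[RHS]e2.
  rewrite [RHS](_ : _ = \sum_i' \sum_t coef (n + i)%N (j (c (i', t) *: b (i', t)))); last first.
    by rewrite pair_bigA; apply: eq_bigr => -[].
  rewrite (bigD1 i) //= [X in _ = _ + X]big1 ?addr0.
    apply: eq_bigr => t' _; have [_ jb] := bP (i, t').
    by rewrite (j_scale jC) jb /slC slmonoM slmono_coef add0r eqxx mulrA.
  move=> i' ii'; apply: big1 => t' _; have [_ jb] := bP (i', t').
  rewrite (j_scale jC) jb /slC slmonoM slmono_coef add0r /=.
  case: eqP => // -[] /eqP; rewrite eqn_add2l => /eqP /val_inj ei.
  by rewrite ei eqxx in ii'.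
exact: (Yind _ e' t).
Qed.

Lemma zero_part_orbit_finite d v :
  trdeg_eq h d -> (GKdim R A <= (d.+1%:R)%:E)%E ->
  (forall z, exists a b, [/\ zero_part a, zero_part b, b != 0 & z = a / b]) ->
  zero_part v -> exists n, lcomb h (fun i => iter i s v) n (iter n s v).
Proof.
move=> [x [xi Kalg]] GK frac [av jav]; apply: contrapT => /forallNP vind.
have /choice[al alP] i : exists p : A * A,
    [/\ j p.1 = slC s_bij (coef 0 (j p.1)), j p.2 = slC s_bij (coef 0 (j p.2)),
     coef 0 (j p.2) != 0 & x i = coef 0 (j p.1) / coef 0 (j p.2)].
  have [a [b [[aa ja] [bb jb] b0 e]]] := frac (x i).
  by exists (aa, bb); rewrite /= ja jb /slC !slmono_coef.
pose V := av :: flatten [seq [:: (al i).1; (al i).2] | i <- enum 'I_d].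
have alV i : (al i).1 \in V /\ (al i).2 \in V.
  by split; rewrite inE; apply/orP; right; apply/flattenP; exists [:: (al i).1; (al i).2];
    rewrite ?inE ?eqxx ?orbT //; apply/mapP; exists i => //; rewrite mem_enum.
have jV a : a \in V -> j a = slC s_bij (coef 0 (j a)).
  rewrite inE => /orP[/eqP ->|/flattenP[l /mapP[i _ ->]]].
    by rewrite jav /slC slmono_coef.
  by have [j1 j2 _ _] := alP i; rewrite !inE => /orP[/eqP ->|/eqP ->].
(* A word has at most [n + d * n] letters from degree 0 and fewer than [2n] copies of [tA], whence
   the constant [d.+3]. *)
apply: (@GKdim_gt R k A (tA :: V) d.+3 d) => // r r0.
pose Aa i := coef 0 (j (al i).1); pose Bb i := coef 0 (j (al i).2).
have [|Y [YP Yi]] := @orbit_growth _ _ h d x Aa Bb (fun i => iter i s v) r xi Kalg _ vind r0.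
  move=> i; have [_ _ b0 e] := alP i; split => //; apply: contraTneq (alg_indep_neq0 xi i).
  by rewrite e -/(Aa i) => ->; rewrite mul0r eqxx.
set n := (r ^ d.+1)%N in Y YP Yi *.
have := vdim_growth jV _ YP Yi (n := n).
have -> : (n * #|{: 'I_r * {ffun 'I_d -> 'I_n}}| = r ^ (d.+1 * d.+1).+1)%N.
  rewrite card_prod card_ffun !card_ord mulnCA -expnS /n -expnM.
  by rewrite -expnS.
have -> : (n + d * n + (n + n) = d.+3 * n)%N by rewrite !mulSn; lia.
apply=> a [[i lin ->]|[i [->|->]]].
- exists i, av; split; [exact: ltnW|by rewrite inE eqxx|].
  by rewrite jav /slC slmono_coef.
- by exists 0%N, (al i).1; split => //; exact: (alV i).1.
- by exists 0%N, (al i).2; split => //; exact: (alV i).2.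
Qed.

End OrbitFinite.

(** * Generalized eigenvectors *)

Section Eigen.
Variables (k K : fieldType) (h : {rmorphism k -> K}).
Variable s : {rmorphism K -> K}.
Hypothesis sh : forall c, s (h c) = h c.
Implicit Types (mu nu : k) (l : seq k) (u v w : K).

Definition shift_op mu w : K := s w - h mu * w.

Definition shift_ops l w : K := foldr shift_op w l.

Definition geneig mu w : Prop := exists m, iter m (shift_op mu) w = 0.

Lemma shift_opD mu u v : shift_op mu (u + v) = shift_op mu u + shift_op mu v.
Proof. by rewrite /shift_op rmorphD; ring. Qed.

Lemma shift_opZ mu c u : shift_op mu (h c * u) = h c * shift_op mu u.
Proof. by rewrite /shift_op rmorphM sh; ring. Qed.

Lemma shift_op0 mu : shift_op mu 0 = 0.
Proof. by rewrite /shift_op rmorph0 mulr0 subr0. Qed.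

Lemma shift_opB mu u v : shift_op mu (u - v) = shift_op mu u - shift_op mu v.
Proof. by rewrite /shift_op rmorphB; ring. Qed.

Lemma shift_opC mu nu u : shift_op mu (shift_op nu u) = shift_op nu (shift_op mu u).
Proof. by rewrite /shift_op !rmorphB !rmorphM !sh; ring. Qed.

Lemma shift_op_s mu u : shift_op mu (s u) = s (shift_op mu u).
Proof. by rewrite /shift_op rmorphB rmorphM sh. Qed.

Lemma shift_op_diff mu nu u : shift_op mu u - shift_op nu u = h (nu - mu) * u.
Proof. by rewrite /shift_op rmorphB; ring. Qed.

Lemma shift_opsD l u v : shift_ops l (u + v) = shift_ops l u + shift_ops l v.
Proof. by elim: l => //= mu l ->; rewrite shift_opD. Qed.

Lemma shift_ops0 l : shift_ops l 0 = 0.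
Proof. by elim: l => //= mu l ->; rewrite shift_op0. Qed.

Lemma shift_opsC l mu u : shift_ops l (shift_op mu u) = shift_op mu (shift_ops l u).
Proof. by elim: l => //= nu l ->; rewrite shift_opC. Qed.

Lemma shift_ops_cat l l' u : shift_ops (l ++ l') u = shift_ops l (shift_ops l' u).
Proof. by rewrite /shift_ops foldr_cat. Qed.

Lemma shift_ops_comm l l' u : shift_ops l (shift_ops l' u) = shift_ops l' (shift_ops l u).
Proof. by elim: l' => //= mu l' IH; rewrite shift_opsC IH. Qed.

Lemma shift_ops_nseq m mu u : shift_ops (nseq m mu) u = iter m (shift_op mu) u.
Proof. by elim: m => //= m ->. Qed.

Lemma shift_ops_eig l mu u : shift_op mu u = 0 ->
  shift_ops l u = h (\prod_(nu <- l) (mu - nu)) * u.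
Proof.
move=> e; elim: l => [|nu l IH] /=; first by rewrite big_nil rmorph1 mul1r.
rewrite IH shift_opZ big_cons rmorphM.
have -> : shift_op nu u = h (mu - nu) * u by rewrite -shift_op_diff e subr0.
by rewrite mulrCA mulrA.
Qed.

Lemma shift_op_inj l mu u : shift_ops l u = 0 -> mu \notin l -> shift_op mu u = 0 -> u = 0.
Proof.
move=> /eqP e mul Du; apply/eqP; move: e; rewrite (shift_ops_eig _ Du) mulf_eq0.
rewrite fmorph_eq0 prodf_seq_eq0 => /orP[/hasP[nu nul]|//].
by rewrite subr_eq0 => /eqP emn; rewrite emn nul in mul.
Qed.

(** Two polynomials in [s] without a common root kill only 0: the factors of the second are
    injective on the kernel of the first. *)
Lemma shift_ops_disjoint l l' u : shift_ops l u = 0 -> shift_ops l' u = 0 ->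
  (forall mu, mu \in l' -> mu \notin l) -> u = 0.
Proof.
move=> e; elim: l' => // mu l' IH /= e' dis; apply: IH => //; last first.
  by move=> nu nul; apply: dis; rewrite inE nul orbT.
apply: (@shift_op_inj l mu) => //; last by apply: dis; rewrite mem_head.
by rewrite shift_ops_comm e shift_ops0.
Qed.

Lemma geneig0 mu : geneig mu 0.
Proof. by exists 0%N. Qed.

Lemma geneig_iter_leq mu m n u : (m <= n)%N ->
  iter m (shift_op mu) u = 0 -> iter n (shift_op mu) u = 0.
Proof.
move=> mn e; rewrite -(subnK mn) iterD e.
by elim: (n - m)%N => //= i ->; rewrite shift_op0.
Qed.

Lemma iter_shift_opD mu m u v :
  iter m (shift_op mu) (u + v) = iter m (shift_op mu) u + iter m (shift_op mu) v.
Proof. by rewrite -!shift_ops_nseq shift_opsD. Qed.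

Lemma iter_shift_opZ mu m c u :
  iter m (shift_op mu) (h c * u) = h c * iter m (shift_op mu) u.
Proof. by elim: m => //= m ->; rewrite shift_opZ. Qed.

Lemma geneigD mu u v : geneig mu u -> geneig mu v -> geneig mu (u + v).
Proof.
move=> [m em] [n en]; exists (maxn m n); rewrite iter_shift_opD.
by rewrite (geneig_iter_leq _ em) ?leq_maxl // (geneig_iter_leq _ en) ?leq_maxr // addr0.
Qed.

Lemma geneigZ mu c u : geneig mu u -> geneig mu (h c * u).
Proof. by move=> [m e]; exists m; rewrite iter_shift_opZ e mulr0. Qed.

Lemma geneigN mu u : geneig mu u -> geneig mu (- u).
Proof. by move=> /(geneigZ (-1)); rewrite rmorphN1 mulN1r. Qed.

Lemma geneig_s mu u : geneig mu u -> geneig mu (s u).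
Proof.
move=> [m e]; exists m; rewrite -[RHS](rmorph0 s) -e.
by elim: m {e} => //= m ->; rewrite shift_op_s.
Qed.

Lemma geneig_op mu nu u : geneig mu u -> geneig mu (shift_op nu u).
Proof.
by move=> gu; apply: geneigD; [apply: geneig_s|apply: geneigN; apply: geneigZ].
Qed.

(** A twisted Leibniz rule: [(s - mu nu)(u v) = (s - mu)u * s v + mu u * (s - nu)v], and each
    summand has one of the exponents [m], [n] lowered. *)
Lemma geneigM mu nu u v : geneig mu u -> geneig nu v -> geneig (mu * nu) (u * v).
Proof.
move=> [m em] [n en]; exists (m + n)%N.
have [N] := ubnP (m + n); elim: N m n u v em en => // N IH m n u v em en.
rewrite ltnS => mnN.
have [u0|u0] := eqVneq u 0.
  by rewrite u0 mul0r -shift_ops_nseq shift_ops0.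
have [v0|v0] := eqVneq v 0.
  by rewrite v0 mulr0 -shift_ops_nseq shift_ops0.
case: m em mnN => [|m] em mnN; first by move: em u0 => /= ->; rewrite eqxx.
case: n en mnN => [|n] en mnN; first by move: en v0 => /= ->; rewrite eqxx.
rewrite addSn iterSr.
have -> : shift_op (mu * nu) (u * v) = shift_op mu u * s v + h mu * (u * shift_op nu v).
  by rewrite /shift_op !rmorphM; ring.
rewrite iter_shift_opD iter_shift_opZ.
rewrite (IH m n.+1) ?add0r; first last.
- by move: mnN; rewrite addSn.
- rewrite -[RHS](rmorph0 s) -en; elim: n.+1 => //= i ->; by rewrite shift_op_s.
- by rewrite -iterSr.
rewrite addnS -addSn (IH m.+1 n) ?mulr0 //; first by rewrite -iterSr.
by move: mnN; rewrite addnS addSn.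
Qed.

Record stable_subspace (S : set K) : Prop := StableSubspace {
  ss0 : S 0;
  ssD : forall u v, S u -> S v -> S (u + v);
  ssZ : forall c u, S u -> S (h c * u);
  ssS : forall u, S u -> S (s u) }.

Section Projection.
Variable S : set K.
Hypothesis stS : stable_subspace S.

Lemma ssN u : S u -> S (- u).
Proof. by move=> /(ssZ stS (-1)); rewrite rmorphN1 mulN1r. Qed.

Lemma ss_op mu u : S u -> S (shift_op mu u).
Proof.
by move=> Su; apply: (ssD stS); [apply: (ssS stS)|apply: ssN; apply: (ssZ stS)].
Qed.

Lemma ss_ops l u : S u -> S (shift_ops l u).
Proof. by move=> Su; elim: l => //= mu l; apply: ss_op. Qed.

(** On the generalized eigenspace of [mu], the operator [s - nu] is the nonzero scalar [mu - nu]
    plus a nilpotent operator, so its inverse is a polynomial in [s] and preserves [S]. *)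
Lemma ss_op_inv mu nu u : geneig mu u -> nu != mu -> S (shift_op nu u) -> S u.
Proof.
move=> [m]; elim: m u => [|m IH] u /= e mn Su; first by rewrite e; exact: (ss0 stS).
have S1 : S (shift_op mu u).
  by apply: IH => //; [rewrite -iterSr|rewrite shift_opC; apply: ss_op].
have dnz : mu - nu != 0 by rewrite subr_eq0 eq_sym.
have -> : u = h (mu - nu)^-1 * (shift_op nu u - shift_op mu u).
  by rewrite shift_op_diff mulrA -rmorphM mulVf // rmorph1 mul1r.
by apply: (ssZ stS); apply: (ssD stS) => //; apply: ssN.
Qed.

Lemma ss_ops_inv l mu u : geneig mu u -> mu \notin l -> S (shift_ops l u) -> S u.
Proof.
elim: l u => //= nu l IH u gu; rewrite inE negb_or => /andP[mn ml] Su.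
apply: IH => //; apply: (@ss_op_inv mu nu) => //; last by rewrite eq_sym.
by elim: {Su ml} l => //= ? ?; apply: geneig_op.
Qed.

Lemma ss_project mu l u v : geneig mu u -> mu \notin l -> shift_ops l v = 0 ->
  S (u + v) -> S u.
Proof.
move=> gu ml ev Suv; apply: (ss_ops_inv gu ml).
by have := ss_ops l Suv; rewrite shift_opsD ev addr0.
Qed.

(** The operators killing all other components act injectively on the chosen one. For [S] zero this
    is the independence of generalized eigenvectors with distinct eigenvalues. *)
Lemma ss_component (I : eqType) (r : seq I) (F : I -> K) (mu : I -> k) : uniq r ->
  (forall i, i \in r -> geneig (mu i) (F i)) -> {in r &, injective mu} ->
  S (\sum_(i <- r) F i) -> forall i, i \in r -> S (F i).
Proof.
move=> ur gF mui Ssum i ir; rewrite (big_rem i ir) /= in Ssum.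
have [l li el] : exists2 l, mu i \notin l & shift_ops l (\sum_(x <- rem i r) F x) = 0.
  have : forall x, x \in rem i r -> geneig (mu x) (F x) /\ mu x != mu i.
    move=> x; rewrite mem_rem_uniq // inE => /andP[xi xr]; split; first exact: gF.
    by apply: contra_neq xi => /mui; apply.
  elim: (rem i r) => [|x t IH] tP; first by exists [::]; rewrite // big_nil.
  have [|l li el] := IH; first by move=> y yt; apply: tP; rewrite inE yt orbT.
  have [[m em] nx] := tP x (mem_head _ _).
  exists (nseq m (mu x) ++ l).
    by rewrite mem_cat negb_or li andbT mem_nseq negb_and [mu i == _]eq_sym nx orbT.
  rewrite big_cons shift_opsD shift_ops_cat shift_ops_comm shift_ops_nseq em shift_ops0.
  by rewrite shift_ops_cat el shift_ops0 addr0.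
exact: (ss_project (gF i ir) li el Ssum).
Qed.

End Projection.

Lemma zero_stable : stable_subspace [set 0].
Proof.
by split=> [//|u v -> ->|c u ->|u ->] /=; rewrite ?addr0 ?mulr0 ?rmorph0.
Qed.

Lemma geneig_preimage mu nu u : geneig mu u -> nu != mu ->
  exists2 z, geneig mu z & shift_op nu z = u.
Proof.
move=> [m]; elim: m u => [|m IH] u /= e mn.
  by exists 0; [exact: geneig0|rewrite shift_op0 e].
have [|z gz ez] := IH (shift_op mu u) _ mn; first by rewrite -iterSr.
have gu : geneig mu u by exists m.+1.
exists (h (mu - nu)^-1 * (u - z)).
  by apply: geneigZ; apply: geneigD => //; apply: geneigN.
rewrite shift_opZ shift_opB ez.
rewrite shift_op_diff mulrA -rmorphM mulVf ?rmorph1 ?mul1r //.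
by rewrite subr_eq0 eq_sym.
Qed.

(** Primary decomposition one root at a time: the components of [(s - mu) w] away from [mu] are
    pulled back through [s - mu], and what they leave of [w] is killed by a power of [s - mu]. *)
Lemma geneig_decomposition l w : shift_ops l w = 0 ->
  exists2 F : k -> K, (forall mu, geneig mu (F mu)) & w = \sum_(mu <- undup l) F mu.
Proof.
elim: l w => [|mu l IH] w /=.
  by move=> ->; exists (fun=> 0); [move=> mu; exact: geneig0|rewrite big_nil].
rewrite -shift_opsC => /IH[F gF e].
have /choice[Z ZP] nu : exists z, geneig nu z /\ (nu != mu -> shift_op mu z = F nu).
  have [->|nm] := eqVneq nu mu; first by exists 0; split; [exact: geneig0|].
  have [|z gz ez] := @geneig_preimage nu mu (F nu) (gF nu); first by rewrite eq_sym.
  by exists z.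
pose w0 := w - \sum_(nu <- undup l | nu != mu) Z nu.
have gw0 : geneig mu w0.
  have e0 : shift_op mu w0 = if mu \in l then F mu else 0.
    rewrite /w0 shift_opB e.
    have -> : shift_op mu (\sum_(nu <- undup l | nu != mu) Z nu) =
        \sum_(nu <- undup l | nu != mu) F nu.
      rewrite (big_morph (shift_op mu) (shift_opD mu) (shift_op0 mu)).
      by apply: eq_bigr => nu nm; apply: (ZP nu).2.
    rewrite (bigID (fun nu => nu != mu)) /= addrAC subrr add0r.
    case: ifP => ml.
      rewrite (eq_bigl (pred1 mu)); last by move=> nu /=; rewrite negbK.
      by rewrite -big_filter filter_pred1_uniq ?undup_uniq ?mem_undup // big_seq1.
    rewrite big_seq_cond big1 // => nu /andP[]; rewrite mem_undup => nl /negPn /eqP en.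
    by rewrite -en nl in ml.
  have : geneig mu (shift_op mu w0) by rewrite e0; case: ifP => _ //; exact: geneig0.
  by move=> [m em]; exists m.+1; rewrite iterSr.
exists (fun nu => if nu == mu then w0 else Z nu).
  by move=> nu; case: eqP => [->|_]; [|exact: (ZP nu).1].
have split_sum : \sum_(nu <- mu :: [seq x <- undup l | x != mu])
    (if nu == mu then w0 else Z nu) = w.
  rewrite big_cons eqxx big_filter (eq_bigr Z); last by move=> nu /negPf ->.
  by rewrite /w0 subrK.
rewrite -[LHS]split_sum; apply: perm_big; apply: uniq_perm.
- by rewrite /= mem_filter eqxx filter_uniq ?undup_uniq.
- exact: (undup_uniq (mu :: l)).
- move=> nu; rewrite inE mem_filter mem_undup; case: eqVneq => [->|nm] /=.
    by case: ifP => ml; rewrite ?inE ?eqxx // mem_undup.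
  by case: ifP => ml; rewrite ?inE ?(negPf nm) mem_undup.
Qed.

(** The quotient [e' / e] is fixed by [s]. *)
Lemma eig_unique mu e e' :
  (forall a, s a = a -> exists c, a = h c) ->
  e != 0 -> s e = h mu * e -> s e' = h mu * e' -> exists c, e' = h c * e.
Proof.
move=> fix_ e0 se se'.
have mu0 : h mu != 0.
  by apply: contraNneq e0 => m0; have := fmorph_eq0 s e; rewrite se m0 mul0r eqxx => <-.
have [|c ec] := fix_ (e' / e).
  by rewrite rmorphM fmorphV se se'; field; rewrite ?e0 ?mu0.
by exists c; rewrite -ec divfK.
Qed.

Lemma geneig_eigenvector mu u : u != 0 -> geneig mu u ->
  exists m, iter m (shift_op mu) u != 0 /\ iter m.+1 (shift_op mu) u = 0.
Proof.
move=> u0 [m]; elim: m => [/eqP|m IH e]; first by rewrite (negPf u0).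
by have [/IH //|nz] := eqVneq (iter m (shift_op mu) u) 0; exists m.
Qed.

Lemma shift_op_eigM mu e w : s e = h mu * e ->
  shift_op mu (e * w) = h mu * (e * shift_op 1 w).
Proof. by move=> se; rewrite /shift_op rmorphM se rmorph1; ring. Qed.

Lemma iter_shift_op_eigM mu e m w : s e = h mu * e ->
  iter m (shift_op mu) (e * w) = h (mu ^+ m) * (e * iter m (shift_op 1) w).
Proof.
move=> se; elim: m => [|m IH]; first by rewrite expr0 rmorph1 mul1r.
by rewrite !iterS IH shift_opZ shift_op_eigM // exprS rmorphM; ring.
Qed.

(** Multiplication by [e] carries [s - 1] to [s - mu], up to the nonzero scalar [mu]. *)
Lemma geneig_divide mu e u : e != 0 -> s e = h mu * e -> geneig mu u -> geneig 1 (u / e).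
Proof.
move=> e0 se [m em]; exists m.
have mu0 : h mu != 0.
  by apply: contraNneq e0 => m0; have := fmorph_eq0 s e; rewrite se m0 mul0r eqxx => <-.
have := iter_shift_op_eigM m (u / e) se; rewrite mulrC divfK // em => /esym/eqP.
by rewrite rmorphXn !mulf_eq0 (negPf e0) expf_eq0 (negPf mu0) andbF => /eqP.
Qed.

End Eigen.

(** * Structure of the field *)

Section Structure.
Variables (k : closedFieldType) (K : fieldType) (h : {rmorphism k -> K}).
Variable s : {rmorphism K -> K}.
Hypothesis sh : forall c, s (h c) = h c.
Hypothesis fix_k : forall a, s a = a -> exists c, a = h c.

Lemma root_in_image (q : {poly k}) y : q != 0 -> (map_poly h q).[y] = 0 -> exists c, y = h c.
Proof.
move=> q0; have [rs ->] := closed_field_poly_normal q.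
rewrite map_polyZ rmorph_prod hornerZ => /eqP.
rewrite mulf_eq0 fmorph_eq0 lead_coef_eq0 (negPf q0) /= horner_prod prodf_seq_eq0.
case/hasP => c _; rewrite /= rmorphB /= map_polyX map_polyC hornerXsubC subr_eq0 => /eqP.
by exists c.
Qed.

Definition poly_act (p : {poly k}) (w : K) : K := \sum_(i < size p) h p`_i * iter i s w.

Lemma poly_act_widen (p : {poly k}) (w : K) N : (size p <= N)%N ->
  poly_act p w = \sum_(i < N) h p`_i * iter i s w.
Proof.
move=> pN; rewrite /poly_act (big_ord_widen _ (fun i => h p`_i * iter i s w) pN).
rewrite big_mkcond /=; apply: eq_bigr => i _; case: ifP => // /negbT.
by rewrite -leqNgt => /(nth_default 0) ->; rewrite rmorph0 mul0r.
Qed.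

Lemma poly_act_XsubC (z : k) (q : {poly k}) (w : K) :
  poly_act (('X - z%:P) * q) w = shift_op h s z (poly_act q w).
Proof.
rewrite (@poly_act_widen _ _ (size q).+1); last first.
  by apply: (leq_trans (size_polyMleq _ _)); rewrite size_XsubC.
under eq_bigr do rewrite mulrBl coefB coefXM coefCM rmorphB mulrBl.
rewrite sumrB /shift_op; congr (_ - _).
  rewrite big_ord_recl /= rmorph0 mul0r add0r /poly_act rmorph_sum.
  by apply: eq_bigr => i _; rewrite rmorphM sh.
rewrite (@poly_act_widen q w (size q).+1) // mulr_sumr.
by apply: eq_bigr => i _; rewrite rmorphM mulrA.
Qed.

(** The dependence says that a monic polynomial in [s] kills [v], and this polynomial splits over
    [k]. *)
Lemma orbit_shift_ops v n : lcomb h (fun i => iter i s v) n (iter n s v) ->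
  exists l, shift_ops h s l v = 0.
Proof.
move=> [c ec]; pose p : {poly k} := 'X^n - \poly_(i < n) c i.
have sp : (size p <= n.+1)%N.
  rewrite (leq_trans (size_polyD _ _)) // size_polyN size_polyXn geq_max leqnn /=.
  by apply: leqW; apply: size_poly.
have pn : p`_n = 1 by rewrite coefB coefXn eqxx coef_poly ltnn subr0.
have p0 : p != 0 by apply: contra_eq_neq pn => ->; rewrite coef0 eq_sym oner_neq0.
have pv : poly_act p v = 0.
  rewrite (poly_act_widen _ sp) big_ord_recr /= pn rmorph1 mul1r ec -big_split big1 // => i _.
  rewrite /= coefB coefXn coef_poly ltn_ord (ltn_eqF (ltn_ord i)) sub0r.
  by rewrite rmorphN mulNr addNr.
have [rs ers] := closed_field_poly_normal p.
exists rs; move: pv; rewrite ers.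
have -> : poly_act (lead_coef p *: \prod_(z <- rs) ('X - z%:P)) v =
    h (lead_coef p) * poly_act (\prod_(z <- rs) ('X - z%:P)) v.
  rewrite (@poly_act_widen (_ *: _) _ (size (\prod_(z <- rs) ('X - z%:P)))) ?size_scale_leq //.
  by rewrite mulr_sumr; apply: eq_bigr => i _; rewrite coefZ rmorphM mulrA.
have -> : poly_act (\prod_(z <- rs) ('X - z%:P)) v = shift_ops h s rs v.
  elim: rs {ers} => [|z rs IH]; last by rewrite big_cons poly_act_XsubC IH.
  by rewrite big_nil /poly_act size_poly1 big_ord1 coef1 rmorph1 mul1r.
move/eqP; rewrite mulf_eq0 fmorph_eq0 lead_coef_eq0 (negPf p0) => /eqP; exact.
Qed.

Section Additive.
Variable y : K.
Hypothesis sy : s y = y + 1.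

(** As [k] is algebraically closed, lying outside [k] amounts to transcendence, by
    [root_in_image]. *)
Lemma additive_transcendental c : y != h c.
Proof.
apply/eqP => e; have := sy; rewrite e sh => /eqP.
by rewrite -subr_eq0 opprD addrA subrr add0r oppr_eq0 oner_eq0.
Qed.

(** In characteristic [p] the Artin-Schreier expression [y^p - y] is fixed by [s], hence a constant,
    which makes [y] algebraic over [k]. *)
Lemma additive_char0 : [pchar k] =i pred0.
Proof.
move=> p; apply/negbTE/negP => pk.
have pK : p \in [pchar K] by rewrite (fmorph_pchar h).
have [c ec] : exists c, y ^+ p - y = h c.
  apply: fix_k; rewrite rmorphB rmorphXn sy -!(pFrobenius_autE pK).
  by rewrite pFrobenius_autD_comm ?pFrobenius_aut1; [ring|exact: mulrC].
have p1 : (1 < p)%N by apply: prime_gt1; apply: pcharf_prime pk.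
have [||c' ec'] := @root_in_image ('X^p - 'X - c%:P) y.
- apply/eqP => /(congr1 (fun q : {poly k} => q`_p)).
  rewrite !coefB coefXn eqxx coefX coefC coef0 (gtn_eqF p1) (gtn_eqF (ltnW p1)) !subr0.
  by move/eqP; rewrite oner_eq0.
- by rewrite !rmorphB /= map_polyXn map_polyX map_polyC !hornerE /=; rewrite ec subrr.
- by have := additive_transcendental c'; rewrite ec' eqxx.
Qed.

(** The falling factorial [y (y - 1) ... (y - j + 1)]. On these polynomials [s - 1] is the forward
    difference operator. *)
Definition ffact_at j : K := \prod_(i < j) (y - i%:R).

Lemma shift_op_ffact j : shift_op h s 1 (ffact_at j.+1) = j.+1%:R * ffact_at j.
Proof.
rewrite /shift_op rmorph1 mul1r /ffact_at rmorph_prod [X in X - _]big_ord_recl [X in _ - X]big_ord_recr.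
rewrite (eq_bigr (fun i : 'I_j => y - i%:R)) => [|i _]; last first.
  by rewrite rmorphB sy rmorph_nat lift0 -natr1; ring.
rewrite /= rmorphB sy rmorph0 subr0 -natr1; ring.
Qed.

(** Discrete integration: [u'] has the same difference as [u], so [u - u'] is fixed by [s] and is a
    constant. Characteristic zero permits the division by [j + 1]. *)
Lemma unipotent_poly m u : iter m (shift_op h s 1) u = 0 ->
  exists a : nat -> k, u = \sum_(j < m) h (a j) * ffact_at j.
Proof.
have k0 := (pcharf0P k).1 additive_char0.
elim: m u => [|m IH] u; first by move=> /= ->; exists (fun=> 0); rewrite big_ord0.
rewrite iterSr => /IH[a ea].
pose u' := \sum_(j < m) h (a j / j.+1%:R) * ffact_at j.+1.
have [|c ec] := @fix_k (u - u').
  have : shift_op h s 1 (u - u') = 0; last first.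
    by rewrite /shift_op rmorph1 mul1r => /eqP; rewrite subr_eq0 => /eqP.
  rewrite shift_opB ea /u' (big_morph (shift_op h s 1) (shift_opD h s 1) (shift_op0 h s 1)).
  rewrite -sumrB big1 // => j _; rewrite shift_opZ // shift_op_ffact.
  have j0 : h j.+1%:R != 0 by rewrite fmorph_eq0 k0.
  by rewrite rmorphM fmorphV rmorph_nat in j0 *; rewrite mulrA divfK // subrr.
exists (fun j => if j is j'.+1 then a j' / j'.+1%:R else c).
rewrite big_ord_recl /= /ffact_at big_ord0 mulr1 -ec -/u'.
by rewrite -[LHS](subrK u').
Qed.

Lemma geneig1_additive u : geneig h s 1 u -> gen_subalgebra h [set y] u.
Proof.
have [Sc SB SM] := gen_subalgebraP h [set y].
have SN a : gen_subalgebra h [set y] a -> gen_subalgebra h [set y] (- a).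
  by move=> Sa; rewrite -sub0r -(rmorph0 h); apply: SB.
have SD a b : gen_subalgebra h [set y] a -> gen_subalgebra h [set y] b ->
    gen_subalgebra h [set y] (a + b).
  by move=> Sa /SN Sb; rewrite -[b]opprK; apply: SB.
move=> [m /unipotent_poly[a ->]]; apply: (big_ind (gen_subalgebra h [set y])) => //.
  by rewrite -(rmorph0 h).
move=> j _; apply: (SM) => //; apply: (big_ind (gen_subalgebra h [set y])) => [|? ?|i _].
- by rewrite -(rmorph1 h).
- exact: SM.
apply: SB; first exact: sub_gen_subalgebra.
by rewrite -(rmorph_nat h).
Qed.

End Additive.

(** If [(s - 1) u] is a nonzero constant [c], then [u / c] is a solution of [s y = y + 1]. *)
Lemma geneig1_const u : (forall y, s y != y + 1) -> geneig h s 1 u -> exists c, u = h c.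
Proof.
move=> noy [m]; elim: m u => [|m IH] u; first by move=> /= ->; exists 0; rewrite rmorph0.
rewrite iterSr => /IH[c]; rewrite /shift_op rmorph1 mul1r => ec.
apply: fix_k; have [c0|c0] := eqVneq c 0.
  by apply/eqP; rewrite -subr_eq0 ec c0 rmorph0.
have hc0 : h c != 0 by rewrite fmorph_eq0.
have := noy (u / h c); rewrite rmorphM fmorphV sh.
have -> : s u = u + h c by rewrite -ec addrC subrK.
by rewrite mulrDl divff // eqxx.
Qed.

(** For [P] closed under products these sums form a subalgebra. Terms with the same eigenvalue need
    not be collected. *)
Inductive gsum (P : k -> Prop) : K -> Prop :=
| gsum0 : gsum P 0
| gsum_cons mu u w : P mu -> geneig h s mu u -> gsum P w -> gsum P (u + w).

Section Gsum.
Variable P : k -> Prop.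
Hypotheses (P1 : P 1) (PM : forall mu nu, P mu -> P nu -> P (mu * nu)).

Lemma gsum_gen mu u : P mu -> geneig h s mu u -> gsum P u.
Proof. by move=> Pm gu; rewrite -[u]addr0; apply: gsum_cons Pm gu (gsum0 P). Qed.

Lemma gsumD u v : gsum P u -> gsum P v -> gsum P (u + v).
Proof.
move=> Pu Pv; elim: Pu => [|mu a b Pm ga _ IH]; first by rewrite add0r.
by rewrite -addrA; apply: gsum_cons Pm ga IH.
Qed.

Lemma gsumM u v : gsum P u -> gsum P v -> gsum P (u * v).
Proof.
move=> Pu Pv; elim: Pu => [|mu a b Pm ga _ IH]; first by rewrite mul0r; exact: gsum0.
rewrite mulrDl; apply: gsumD => //.
elim: Pv => [|nu a' b' Pn ga' _ IH']; first by rewrite mulr0; exact: gsum0.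
rewrite mulrDr; apply: gsum_cons IH'; first exact: (PM Pm Pn).
exact: geneigM.
Qed.

Lemma gsumC c : gsum P (h c).
Proof.
apply: (gsum_gen P1); exists 1%N.
by rewrite /= /shift_op sh rmorph1 mul1r subrr.
Qed.

Lemma gsum_subalgebra : subalgebra h (gsum P).
Proof.
split=> [c|a b Pa Pb|a b]; [exact: gsumC| |exact: gsumM].
apply: gsumD => //; rewrite -mulN1r -(rmorphN1 h); apply: gsumM => //; exact: gsumC.
Qed.

Lemma gsum_killed u : gsum P u ->
  exists2 l, (forall mu, mu \in l -> P mu) & shift_ops h s l u = 0.
Proof.
elim=> [|mu a b Pm [m em] _ [l lP el]]; first by exists [::].
exists (nseq m mu ++ l).
  by move=> nu; rewrite mem_cat mem_nseq => /orP[/andP[_ /eqP ->]|/lP].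
rewrite shift_opsD !shift_ops_cat el shift_ops0 addr0.
by rewrite (shift_ops_comm sh) shift_ops_nseq em shift_ops0.
Qed.

End Gsum.

Lemma gen_subfield_frac (X : set K) z : gen_subfield h X z ->
  exists f g, [/\ gen_subalgebra h X f, gen_subalgebra h X g, g != 0 & z = f / g].
Proof.
have [Sc SB SM] := gen_subalgebraP h X.
have S1 : gen_subalgebra h X 1 by rewrite -(rmorph1 h).
apply: (@gen_subfield_sub _ _ _ _ [set z | exists f g,
  [/\ gen_subalgebra h X f, gen_subalgebra h X g, g != 0 & z = f / g]]); last first.
  move=> a Xa; exists a, 1; rewrite oner_neq0 divr1; split => //.
  exact: sub_gen_subalgebra.
split; first split.
- by move=> c; exists (h c), 1; rewrite oner_neq0 divr1.
- move=> _ _ [f [g [Sf Sg g0 ->]]] [f' [g' [Sf' Sg' g'0 ->]]].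
  exists (f * g' - f' * g), (g * g'); split; [by apply: SB; apply: SM|exact: SM|exact: mulf_neq0|].
  by field; rewrite g0 g'0.
- move=> _ _ [f [g [Sf Sg g0 ->]]] [f' [g' [Sf' Sg' g'0 ->]]].
  exists (f * f'), (g * g'); split; [exact: SM|exact: SM|exact: mulf_neq0|].
  by field; rewrite g0 g'0.
- move=> _ [f [g [Sf Sg g0 ->]]]; have [->|f0] := eqVneq f 0.
    by exists 0, 1; rewrite mul0r invr0 divr1 oner_neq0 -(rmorph0 h).
  by exists g, f; rewrite invf_div.
Qed.

Section Generated.
Variables (m : nat) (x : 'I_m -> K) (p : 'I_m -> k) (Y : set K).
Hypothesis x0 : forall i, x i != 0.
Hypothesis sx : forall i, s (x i) = h (p i) * x i.
Hypothesis sY : forall y, Y y -> s y = y + 1.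
Hypothesis genK : gen_subfield h (range x `|` Y) = setT.

Lemma eig_neq0 i : p i != 0.
Proof.
by rewrite -(fmorph_eq0 h); apply: contraNneq (x0 i) => e; rewrite -(fmorph_eq0 s) sx e mul0r.
Qed.

Lemma s_mono b : s (mono x b) = h (mono p b) * mono x b.
Proof.
rewrite /mono !rmorph_prod -big_split; apply: eq_bigr => i _ /=.
by rewrite !fmorphXz sx expfzMl.
Qed.

(** Write [e = f / g] with [f] and [g] polynomial in the generators; their eigenvalues lie in the
    group of the [mono p b]. If [mu] were outside this group, the eigenvalues of [e * g = f] would
    lie in a different coset, forcing [f = 0]. So [mu] is the eigenvalue of a monomial, and
    eigenspaces are lines. *)
Lemma eig_monomial mu e : e != 0 -> s e = h mu * e ->
  exists b c, mu = mono p b /\ e = h c * mono x b.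
Proof.
move=> e0 se; pose P nu := exists b, nu = mono p b.
have p0 := eig_neq0.
have P1 : P 1 by exists 0; rewrite mono0.
have PM mu' nu' : P mu' -> P nu' -> P (mu' * nu').
  by move=> [b ->] [b' ->]; exists (b + b'); rewrite monoD.
have sub : gen_subalgebra h (range x `|` Y) `<=` gsum P.
  apply: gen_subalgebra_sub; first exact: gsum_subalgebra.
  move=> a [[i _ <-]|Ya].
    apply: (@gsum_gen P (p i)); last by exists 1%N; rewrite /= /shift_op sx subrr.
    exists [ffun l => (l == i)%:Z]; rewrite /mono (bigD1 i) //= ffunE eqxx expr1z.
    by rewrite big1 ?mulr1 // => l /negPf li; rewrite ffunE li.
  apply: (gsum_gen P1); exists 2%N.
  by rewrite /= /shift_op !rmorph1 !mul1r rmorphB !(sY Ya) rmorphD (sY Ya) rmorph1; ring.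
have : gen_subfield h (range x `|` Y) e by rewrite genK.
move=> /gen_subfield_frac[f [g [/sub Sf /sub Sg g0 efg]]].
have [l lP el] := gsum_killed Sf; have [l' l'P el'] := gsum_killed Sg.
have egf : e * g = f by rewrite efg divfK.
have [[b mub]|nP] := pselect (P mu).
  have [c ec] := eig_unique fix_k (mono_neq0 x0 b) (s_mono b) (e' := e) ltac:(by rewrite -mub).
  by exists b, c.
have f0 : f = 0.
  apply: (@shift_ops_disjoint _ _ _ _ sh l [seq mu * nu | nu <- l']) => //.
    have -> : shift_ops h s [seq mu * nu | nu <- l'] f = h (mu ^+ size l') * (e * shift_ops h s l' g).
      rewrite -egf; elim: l' {l'P el'} => [|nu l' IH] /=; first by rewrite expr0 rmorph1 mul1r.
      rewrite IH shift_opZ // exprS /shift_op !rmorphM se; ring.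
    by rewrite el' !mulr0.
  move=> _ /mapP[nu /l'P[b nub] ->]; apply/negP => /lP[b' e']; apply: nP.
  exists (b' - b); rewrite monoB // -nub -e' mulfK // nub; exact: mono_neq0.
by move: egf; rewrite f0 => /eqP; rewrite mulf_eq0 (negPf e0) (negPf g0).
Qed.

End Generated.
End Structure.

(** * Free generators *)

Section FreeGenerators.
Variables (k : closedFieldType) (K : fieldType) (h : {rmorphism k -> K}).
Variable s : {rmorphism K -> K}.
Hypothesis sh : forall c, s (h c) = h c.
Hypothesis fix_k : forall a, s a = a -> exists c, a = h c.
(* [Y] is [set y] with [s y = y + 1] in case (A) and empty in case (B). *)
Variable Y : set K.

Definition eig_generators r (x : 'I_r -> K) (p : 'I_r -> k) : Prop :=
  [/\ forall i, x i != 0, forall i, s (x i) = h (p i) * x i &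
      gen_subfield h (range x `|` Y) = setT].

Lemma gen_subfield_transfer r r' (x : 'I_r -> K) (x' : 'I_r' -> K) :
  (forall i, gen_subfield h (range x' `|` Y) (x i)) ->
  gen_subfield h (range x `|` Y) = setT -> gen_subfield h (range x' `|` Y) = setT.
Proof.
move=> xx' e; apply/seteqP; split=> // z _.
have : gen_subfield h (range x `|` Y) z by rewrite e.
apply: gen_subfield_sub; first exact: gen_subfieldP.
move=> a [[i _ <-] //|Ya]; apply: sub_gen_subfield; by right.
Qed.

(** A power of [x] is fixed by [s], so [x] is algebraic over [k]. *)
Lemma torsion_eig x p (n : int) : x != 0 -> s x = h p * x -> p ^ n = 1 -> n != 0 ->
  exists c, x = h c.
Proof.
move=> x0 sx pn n0.
have [c ec] : exists c, x ^+ `|n|%N = h c.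
  apply: fix_k; rewrite rmorphXn sx exprMn -rmorphXn.
  suff -> : p ^+ `|n|%N = 1 by rewrite rmorph1 mul1r.
  case: n pn {n0} => n // pn.
  have pn' : (p ^+ n.+1)^-1 = 1 := pn.
  by rewrite -[LHS]invrK /= pn' invr1.
have n1 : (0 < `|n|)%N by rewrite absz_gt0.
apply: (@root_in_image _ _ h ('X^(`|n|%N) - c%:P)).
  by rewrite -size_poly_eq0 size_XnsubC.
by rewrite rmorphB /= map_polyXn map_polyC !hornerE /= ec subrr.
Qed.

Lemma drop_generator r (x : 'I_r.+1 -> K) p i : eig_generators x p ->
  (exists c, x i = h c) -> eig_generators (x \o lift i) (p \o lift i).
Proof.
move=> [x0 sx gx] [c ec]; split; [by move=> l; exact: x0|by move=> l; exact: sx|].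
apply: gen_subfield_transfer gx => l.
case: (unliftP i l) => [l'|] ->.
  by apply: sub_gen_subfield; left; exists l'.
by rewrite ec; have [[Sc _ _] _] := gen_subfieldP h (range (x \o lift i) `|` Y); apply: Sc.
Qed.

(** The shear with exponent [- e] undoes this one, so both families generate the same field. It
    changes a multiplicative relation as in [shear_relation]. *)
Lemma shear_generators r (x : 'I_r -> K) p i l (e : int) : i != l -> eig_generators x p ->
  eig_generators (fun t => if t == l then x l * x i ^ e else x t)
    (fun t => if t == l then p l * p i ^ e else p t).
Proof.
move=> il [x0 sx gx]; set x' := fun t => _.
split.
- move=> t; rewrite /x' /=; case: (t =P l) => _ //.
  by apply: mulf_neq0 => //; apply: expfz_neq0.
- move=> t; rewrite /x'; case: eqP => _ //.
  by rewrite rmorphM fmorphXz !sx rmorphM fmorphXz expfzMl; ring.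
have [[Sc SB SM] SV] := gen_subfieldP h (range x' `|` Y).
have x'S t : gen_subfield h (range x' `|` Y) (x' t).
  by apply: sub_gen_subfield; left; exists t.
have SXn (a : K) n : gen_subfield h (range x' `|` Y) a -> gen_subfield h (range x' `|` Y) (a ^+ n).
  move=> Sa; elim: n => [|n IH]; first by rewrite expr0 -(rmorph1 h); apply: Sc.
  by rewrite exprS; apply: (SM).
have SX (a : K) (n : int) : gen_subfield h (range x' `|` Y) a -> gen_subfield h (range x' `|` Y) (a ^ n).
  by move=> Sa; case: n => n /=; [|apply: (SV)]; apply: SXn.
have xi : x i = x' i by rewrite /x' (negPf il).
apply: gen_subfield_transfer gx => t; have [->|tl] := eqVneq t l.
  have -> : x l = x' l * x' i ^ (- e).
    by rewrite -xi /x' eqxx -mulrA -expfzDr // subrr expr0z mulr1.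
  by apply: (SM) => //; apply: SX.
have -> : x t = x' t by rewrite /x' (negPf tl).
exact: x'S.
Qed.

Lemma shear_relation r (p : 'I_r -> k) (n : 'I_r -> int) i l (e : int) : i != l ->
  (forall t, p t != 0) ->
  \prod_t (if t == l then p l * p i ^ e else p t) ^ (if t == i then n i - e * n l else n t)
  = \prod_t p t ^ n t.
Proof.
move=> il p0; rewrite (bigD1 i) //= (bigD1 l) /=; last by rewrite eq_sym.
rewrite [RHS](bigD1 i) //= [X in _ = _ * X](bigD1 l) /=; last by rewrite eq_sym.
rewrite !mulrA; congr (_ * _); last first.
  by apply: eq_bigr => t /andP[/negPf -> /negPf ->].
rewrite !eqxx (negPf il) eq_sym (negPf il) expfzDr // expfzMl exprz_exp mulrACA.
by rewrite -expfzDr // addNr expr0z mulr1.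
Qed.

(* Euclid's algorithm on the exponents of a multiplicative relation. *)
Lemma reduce_generators r (x : 'I_r.+1 -> K) p (n : 'I_r.+1 -> int) :
  eig_generators x p -> \prod_i p i ^ n i = 1 -> (exists i, n i != 0) ->
  exists (x' : 'I_r -> K) p', eig_generators x' p'.
Proof.
have [N] := ubnP (\sum_i `|n i|)%N; elim: N x p n => // N IH x p n; rewrite ltnS => nN.
move=> xp rel [i ni].
have p0 t : p t != 0 by have [x0 sx gx] := xp; apply: (eig_neq0 x0 sx).
have [[l li nl]|alone] := pselect (exists2 l, l != i & n l != 0); last first.
  exists (x \o lift i), (p \o lift i); apply: drop_generator => //.
  have [x0 sx _] := xp; apply: (torsion_eig (x0 i) (sx i) _ ni).
  move: rel; rewrite (bigD1 i) //= big1 ?mulr1 // => t ti.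
  suff -> : n t = 0 by rewrite expr0z.
  by apply/eqP; apply: contrapT => /negP nt; apply: alone; exists t.
have step a b : a != b -> n a != 0 -> n b != 0 -> (`|n b| <= `|n a|)%N ->
    exists (x' : 'I_r -> K) p', eig_generators x' p'.
  (* The sign of [e] makes [n a - e * n b] smaller than [n a] in absolute value, since
     [0 < |n b| <= |n a|]. *)
  move=> ab na nb nba; pose e : int := if (0 < n a) == (0 < n b) then 1 else -1.
  have nr := shear_relation n e ab p0; rewrite rel in nr.
  apply: (IH _ _ _ _ (shear_generators e ab xp) nr).
    apply: leq_trans nN; rewrite (bigD1 a) //= [X in (_ < X)%N](bigD1 a) //= eqxx.
    rewrite (eq_bigr (fun t => `|n t|%N)) ?ltn_add2r; last by move=> t /negPf ->.
    rewrite /e; move: (n a) (n b) na nb nba => A B; case: ifP; lia.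
  have ba : b != a by rewrite eq_sym.
  by exists b; rewrite (negPf ba).
case: (leqP `|n l| `|n i|) => le; first by apply: (step i l) => //; rewrite eq_sym.
by apply: (step l i) => //; exact: ltnW.
Qed.

Lemma free_generators r (x : 'I_r -> K) p : eig_generators x p ->
  exists m (x' : 'I_m -> K) p', eig_generators x' p' /\
    forall n : 'I_m -> int, \prod_i p' i ^ n i = 1 -> forall i, n i = 0.
Proof.
elim: r x p => [|r IH] x p xp; first by exists 0%N, x, p; split => // n _ [].
have [fr|/existsNP[n nfr]] := pselect (forall n : 'I_r.+1 -> int,
    \prod_i p i ^ n i = 1 -> forall i, n i = 0); first by exists r.+1, x, p.
move/not_implyP: nfr => [rel /existsNP[i /eqP ni]].
have [|x' [p' x'p']] := reduce_generators xp rel; first by exists i.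
exact: IH x'p'.
Qed.

Section Independence.
Variables (m : nat) (x : 'I_m -> K) (p : 'I_m -> k).
Hypothesis x0 : forall i, x i != 0.
Hypothesis sx : forall i, s (x i) = h (p i) * x i.
Hypothesis free : forall n : 'I_m -> int, \prod_i p i ^ n i = 1 -> forall i, n i = 0.
Let p0 := eig_neq0 x0 sx.

Lemma box_eig_inj B : injective (fun b : {ffun 'I_m -> 'I_B} => \prod_i p i ^+ b i).
Proof.
move=> b b' e; apply/ffunP => i; apply: val_inj.
have := @free (fun i => (b i)%:Z - (b' i)%:Z).
have -> : \prod_i p i ^ ((b i)%:Z - (b' i)%:Z) = 1.
  rewrite (eq_bigr (fun i => p i ^+ b i / p i ^+ b' i)); last first.
    by move=> l _; rewrite expfzDr // -invr_expz.
  by rewrite prodf_div e divff //; apply/prodf_neq0 => l _; rewrite expf_neq0.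
by move=> /(_ erefl i) /eqP; rewrite subr_eq0 => /eqP [].
Qed.

Lemma box_eig B (b : {ffun 'I_m -> 'I_B}) :
  s (\prod_i x i ^+ b i) = h (\prod_i p i ^+ b i) * \prod_i x i ^+ b i.
Proof.
rewrite !rmorph_prod -big_split; apply: eq_bigr => i _ /=.
by rewrite !rmorphXn sx exprMn.
Qed.

Lemma box_geneig B (b : {ffun 'I_m -> 'I_B}) :
  geneig h s (\prod_i p i ^+ b i) (\prod_i x i ^+ b i).
Proof. by exists 1%N; rewrite /= /shift_op box_eig subrr. Qed.

Lemma eig_alg_indep : alg_indep h x.
Proof.
move=> q q0; have [B bq] := mbounded_exists q.
have e0 := q0; rewrite (mmap_bounded h x bq) in e0.
pose F (b : {ffun 'I_m -> 'I_B.+1}) :=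
  h (mcoeff (Multinom [tuple val (b i) | i < m]) q) * \prod_i x i ^+ b i.
have Fz b : F b = 0.
  suff : [set 0] (F b) by [].
  apply: (ss_component sh (zero_stable h s) (r := index_enum _) (F := F)
    (mu := fun b => \prod_i p i ^+ b i)); rewrite ?mem_index_enum ?index_enum_uniq //.
  - by move=> b' _; apply: geneigZ => //; exact: box_geneig.
  - by move=> b1 b2 _ _; exact: box_eig_inj.
apply/eqP; rewrite -msupp_eq0; case eq: (msupp q) => [//|a t].
have aq : a \in msupp q by rewrite eq mem_head.
have := Fz [ffun i => inord (a i)].
have ea : Multinom [tuple val ([ffun i => inord (a i)] i : 'I_B.+1) | i < m] = a.
  by apply/mnmP => i; rewrite multinomE tnth_mktuple ffunE /= inordK // ltnS bq.
rewrite /F ea => /eqP; rewrite mulf_eq0 fmorph_eq0 -(negbK (mcoeff a q == 0)) -mcoeff_msupp aq /=.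
by rewrite prodf_seq_eq0 => /hasP[i _]; rewrite /= expf_eq0 (negPf (x0 i)) andbF.
Qed.

Variable y : K.
Hypothesis sy : s y = y + 1.

(** [y] gets index 0, where [case_A] expects the additive variable. *)
Definition adjoin_first (i : 'I_m.+1) : K := if unlift ord0 i is Some l then x l else y.

(** Terms are grouped by their exponents in [x]. Each group is a polynomial in [y] times a monomial,
    the groups have distinct eigenvalues and so vanish one by one, and [y] is transcendental. *)
Lemma eig_additive_alg_indep : alg_indep h adjoin_first.
Proof.
move=> q q0; have [B bq] := mbounded_exists q.
have e0 := q0; rewrite (mmap_bounded h _ bq) in e0.
pose c (a : {ffun 'I_m.+1 -> 'I_B.+1}) := mcoeff (Multinom [tuple val (a i) | i < m.+1]) q.
pose tl (a : {ffun 'I_m.+1 -> 'I_B.+1}) : {ffun 'I_m -> 'I_B.+1} := [ffun i => a (lift ord0 i)].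
have xE (a : {ffun 'I_m.+1 -> 'I_B.+1}) : \prod_i adjoin_first i ^+ a i = y ^+ a ord0 * \prod_i x i ^+ tl a i.
  rewrite big_ord_recl {1}/adjoin_first unlift_none; congr (_ * _).
  by apply: eq_bigr => i _; rewrite /adjoin_first liftK ffunE.
pose G b := \sum_(a | tl a == b) h (c a) * y ^+ a ord0.
pose F (b : {ffun 'I_m -> 'I_B.+1}) := G b * \prod_i x i ^+ b i.
have gy n : geneig h s 1 (y ^+ n).
  elim: n => [|n IH]; first by exists 1%N; rewrite /= /shift_op expr0 !rmorph1 mul1r subrr.
  rewrite exprS -[1]mulr1; apply: geneigM => //; exists 2%N.
  by rewrite /= /shift_op !rmorph1 !mul1r rmorphB !sy rmorphD sy rmorph1; ring.
have Fz b : F b = 0.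
  suff : [set 0] (F b) by [].
  apply: (ss_component sh (zero_stable h s) (r := index_enum _) (F := F)
    (mu := fun b => \prod_i p i ^+ b i)); rewrite ?mem_index_enum ?index_enum_uniq //.
  - move=> b' _; rewrite -[\prod_i p i ^+ _]mul1r; apply: geneigM => //; last exact: box_geneig.
    apply: (big_ind (geneig h s 1)) => [|? ?|a _]; [exact: geneig0|exact: geneigD|].
    by apply: geneigZ.
  - by move=> b1 b2 _ _; exact: box_eig_inj.
  - rewrite /= -[RHS]e0 [RHS](partition_big tl xpredT) //=; apply: eq_bigr => b' _.
    rewrite /F mulr_suml; apply: eq_bigr => a /eqP ab.
    by rewrite -/(c a) xE ab mulrA.
have cz a : c a = 0.
  have Gz : G (tl a) = 0.
    have /eqP := Fz (tl a); rewrite /F mulf_eq0 => /orP[/eqP //|].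
    by rewrite prodf_seq_eq0 => /hasP[i _]; rewrite /= expf_eq0 (negPf (x0 i)) andbF.
  pose P : {poly k} := \sum_(a' | tl a' == tl a) c a' *: 'X^(a' ord0).
  have [P0|P0] := eqVneq P 0; last first.
    have [|c' ec'] := @root_in_image _ _ h P y P0.
      rewrite rmorph_sum /= horner_sum -[RHS]Gz; apply: eq_bigr => a' _.
      by rewrite map_polyZ map_polyXn !hornerE.
    by have := additive_transcendental sh sy c'; rewrite ec' eqxx.
  have := congr1 (fun P : {poly k} => P`_(a ord0)) P0.
  rewrite coef0 coef_sum (bigD1 a) //= coefZ coefXn eqxx mulr1 big1 ?addr0 // => a' /andP[/eqP ta aa].
  rewrite coefZ coefXn; case: eqP => [e|]; last by rewrite mulr0.
  case/eqP: aa; apply/ffunP => i; case: (unliftP ord0 i) => [l|] ->.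
    by have /ffunP/(_ l) := ta; rewrite !ffunE.
  exact/val_inj/esym.
apply/eqP; rewrite -msupp_eq0; case eq: (msupp q) => [//|a t].
have aq : a \in msupp q by rewrite eq mem_head.
have := cz [ffun i => inord (a i)].
have ea : Multinom [tuple val ([ffun i => inord (a i)] i : 'I_B.+1) | i < m.+1] = a.
  by apply/mnmP => i; rewrite multinomE tnth_mktuple ffunE /= inordK // ltnS bq.
by rewrite /c ea => /eqP; rewrite -(negbK (mcoeff a q == 0)) -mcoeff_msupp aq.
Qed.

End Independence.
End FreeGenerators.

(** * Finite orbits *)

Section EigenLists.
Variables (k : closedFieldType) (K : fieldType) (h : {rmorphism k -> K}).
Variable s : {rmorphism K -> K}.
Hypothesis sh : forall c, s (h c) = h c.
Hypothesis fix_k : forall a, s a = a -> exists c, a = h c.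
Variable Y : set K.
Hypothesis sY : forall y, Y y -> s y = y + 1.
Hypothesis YG : forall u, geneig h s 1 u -> gen_subalgebra h Y u.

Definition eig_seq (E : seq K) : Prop :=
  forall e, e \in E -> e != 0 /\ exists mu, s e = h mu * e.

Lemma subalgebraD (S : set K) a b : subalgebra h S -> S a -> S b -> S (a + b).
Proof.
move=> [Sc SB SM] Sa Sb; rewrite -[b]opprK; apply: (SB) => //.
by rewrite -sub0r -(rmorph0 h); apply: (SB).
Qed.

Lemma subalgebra_sum (S : set K) (I : Type) (r : seq I) (F : I -> K) : subalgebra h S ->
  (forall i, S (F i)) -> S (\sum_(i <- r) F i).
Proof.
move=> aS SF; apply: (big_ind S) => [|a b|//]; last exact: subalgebraD.
by rewrite -(rmorph0 h); have [Sc _ _] := aS; apply: Sc.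
Qed.

Lemma subalgebraX (S : set K) a n : subalgebra h S -> S a -> S (a ^+ n).
Proof.
move=> [Sc SB SM] Sa; elim: n => [|n IH]; first by rewrite expr0 -(rmorph1 h).
by rewrite exprS; apply: (SM).
Qed.

(** The last nonzero [(s - mu)^m u] is an eigenvector, and dividing [u] by it leaves a unipotent
    element. *)
Lemma geneig_factor mu u : geneig h s mu u -> u != 0 ->
  exists e w, [/\ e != 0, s e = h mu * e, gen_subalgebra h Y w & u = e * w].
Proof.
move=> gu u0; have [m [e0 e1]] := geneig_eigenvector u0 gu.
set e := iter m _ u in e0 *.
have se : s e = h mu * e by move: e1 => /= /eqP; rewrite subr_eq0 => /eqP.
exists e, (u / e); split => //; last by rewrite mulrC divfK.
by apply: YG; apply: (geneig_divide sh e0 se).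
Qed.

Lemma gen_subfield_eig_mono (E E' : seq K) z : {subset E <= E'} ->
  gen_subfield h ([set` E] `|` Y) z -> gen_subfield h ([set` E'] `|` Y) z.
Proof.
move=> EE'; apply: gen_subfield_sub; first exact: gen_subfieldP.
by move=> a [/EE' aE|Ya]; apply: sub_gen_subfield; [left|right].
Qed.

Lemma eig_seq_cat E E' : eig_seq E -> eig_seq E' -> eig_seq (E ++ E').
Proof. by move=> eE eE' e; rewrite mem_cat => /orP[/eE|/eE']. Qed.

Lemma finite_orbit_eig_seq l v : shift_ops h s l v = 0 ->
  exists2 E, eig_seq E & gen_subfield h ([set` E] `|` Y) v.
Proof.
move=> /(geneig_decomposition sh)[F gF ->]; elim: (undup l) => [|mu t [E eE IH]].
  exists [::] => //; rewrite big_nil -(rmorph0 h).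
  by have [[Sc _ _] _] := gen_subfieldP h ([set` [::]] `|` Y); apply: Sc.
have [F0|F0] := eqVneq (F mu) 0; first by exists E => //; rewrite big_cons F0 add0r.
have [e [w [e0 se Yw eF]]] := geneig_factor (gF mu) F0.
exists (e :: E).
  by move=> e'; rewrite inE => /orP[/eqP ->|/eE //]; split => //; exists mu.
have [aS SV] := gen_subfieldP h ([set` e :: E] `|` Y); have [Sc SB SM] := aS.
rewrite big_cons eF; apply: (subalgebraD aS); last first.
  by apply: gen_subfield_eig_mono IH => z zE; rewrite inE zE orbT.
apply: (SM); first by apply: sub_gen_subfield; left; rewrite /= mem_head.
apply: (gen_subalgebra_sub aS) Yw => a Ya; apply: sub_gen_subfield; by right.
Qed.

Section Stability.
Variable E : seq K.
Hypothesis eE : eig_seq E.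
Local Notation L := (gen_subfield h ([set` E] `|` Y)).

Lemma eig_field_s z : L z -> L (s z).
Proof.
have [[Sc SB SM] SV] := gen_subfieldP h ([set` E] `|` Y).
apply: (@gen_subfield_sub _ _ _ _ [set z | L (s z)]).
  split; first split.
  - by move=> c /=; rewrite sh; apply: Sc.
  - by move=> a b /= La Lb; rewrite rmorphB; apply: SB.
  - by move=> a b /= La Lb; rewrite rmorphM; apply: SM.
  - by move=> a /= La; rewrite fmorphV; apply: SV.
move=> a [aE|Ya] /=.
  have [_ [mu ->]] := eE aE; apply: (SM); first exact: Sc.
  by apply: sub_gen_subfield; left.
rewrite sY //; apply: (subalgebraD (S := L)); first exact: (gen_subfieldP _ _).1.
  by apply: sub_gen_subfield; right.
by rewrite -(rmorph1 h).
Qed.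

Lemma eig_field_sV z : L z -> exists2 w, L w & s w = z.
Proof.
have [[Sc SB SM] SV] := gen_subfieldP h ([set` E] `|` Y).
apply: (@gen_subfield_sub _ _ _ _ [set z | exists2 w, L w & s w = z]).
  split; first split.
  - by move=> c; exists (h c) => //; apply: Sc.
  - by move=> _ _ [a La <-] [b Lb <-]; exists (a - b); rewrite ?rmorphB //; apply: SB.
  - by move=> _ _ [a La <-] [b Lb <-]; exists (a * b); rewrite ?rmorphM //; apply: SM.
  - by move=> _ [a La <-]; exists a^-1; rewrite ?fmorphV //; apply: SV.
move=> a [aE|Ya] /=.
  have [a0 [mu sa]] := eE aE.
  have mu0 : mu != 0.
    by apply: contraNneq a0 => m0; rewrite -(fmorph_eq0 s) sa m0 rmorph0 mul0r.
  exists (h mu^-1 * a).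
    by apply: (SM); [exact: Sc|apply: sub_gen_subfield; left].
  by rewrite rmorphM sh sa mulrA -rmorphM mulVf // rmorph1 mul1r.
exists (a - 1); last by rewrite rmorphB rmorph1 sY // addrK.
by apply: (SB); [apply: sub_gen_subfield; right|rewrite -(rmorph1 h)].
Qed.

End Stability.

Lemma eig_seq_generators (E : seq K) : eig_seq E -> gen_subfield h ([set` E] `|` Y) = setT ->
  exists p : 'I_(size E) -> k, eig_generators h s Y (fun i => E`_i) p.
Proof.
move=> eE gE; have EP (i : 'I_(size E)) : exists mu, E`_i != 0 /\ s E`_i = h mu * E`_i.
  by have [e0 [mu se]] := eE _ (mem_nth 0 (ltn_ord i)); exists mu.
have /choice[p pP] := EP; exists p; split; [by move=> i; case: (pP i)|by move=> i; case: (pP i)|].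
apply/seteqP; split=> // z _; have : gen_subfield h ([set` E] `|` Y) z by rewrite gE.
apply: gen_subfield_sub; first exact: gen_subfieldP.
move=> a [/(nthP 0)[i iE <-]|Ya]; apply: sub_gen_subfield; last by right.
by left; exists (Ordinal iE).
Qed.

(** Each component of [v] is an eigenvector times an element of the algebra generated by [Y], and by
    [eig_monomial] the eigenvector is a scalar multiple of a Laurent monomial. *)
Lemma finite_orbit_subalgebra m (x : 'I_m -> K) p (T : set K) : eig_generators h s Y x p ->
  subalgebra h T -> (forall i, T (x i) /\ T (x i)^-1) -> Y `<=` T ->
  forall l v, shift_ops h s l v = 0 -> T v.
Proof.
move=> [x0 sx gx] aT Tx YT l v /(geneig_decomposition sh)[F gF ->].
have [Tc TB TM] := aT.
have Tmono b : T (mono x b).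
  apply: (big_ind T) => [|//|i _]; first by rewrite -(rmorph1 h).
  have [Tx1 Tx2] := Tx i; case: (b i) => n; first exact: subalgebraX.
  by rewrite NegzE -exprz_inv; apply: (@subalgebraX T _ n.+1).
apply: subalgebra_sum => // mu; have [->|F0] := eqVneq (F mu) 0.
  by rewrite -(rmorph0 h).
have [e [w [e0 se Yw ->]]] := geneig_factor (gF mu) F0.
have [b [c [_ ->]]] := eig_monomial sh fix_k x0 sx sY gx e0 se.
apply: (TM); first exact: (TM).
exact: gen_subalgebra_sub Yw.
Qed.

Section Stable.
Variable B : set K.
Hypothesis aB : subalgebra h B.
Hypothesis sB : forall z, B z -> B (s z).
Hypothesis fB : forall z, B z -> exists l, shift_ops h s l z = 0.
Hypothesis frac : forall z, exists a b, [/\ B a, B b, b != 0 & z = a / b].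
Hypothesis eB : forall e mu, e != 0 -> B e -> s e = h mu * e -> B e^-1.

Lemma stable_subspace_of : stable_subspace h s B.
Proof.
have [Sc SB SM] := aB; split => //.
- by rewrite -(rmorph0 h).
- by move=> u v; apply: subalgebraD.
- by move=> c u Bu; apply: (SM).
Qed.

(** A denominator of [z] can be replaced by one of its components: if multiplication by [z] scales
    eigenvalues by [nu], the components of the numerator are [z] times those of the denominator, and
    [B] contains them. *)
Lemma stable_denominator z : exists mu g, [/\ B g, g != 0, geneig h s mu g &
  forall nu, (forall mu' u, geneig h s mu' u -> geneig h s (nu * mu') (z * u)) -> nu != 0 ->
    B (z * g)].
Proof.
have [a [g [Ba Bg g0 ez]]] := frac z.
have [l el] := fB Bg; have [F gF eg] := geneig_decomposition sh el.
have BF mu : mu \in undup l -> B (F mu).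
  apply: (ss_component sh stable_subspace_of (r := undup l) (F := F) (mu := id)) => //.
    exact: undup_uniq.
  by rewrite -eg.
have [mu mul F0] : exists2 mu, mu \in undup l & F mu != 0.
  apply: contrapT => noF; move/eqP: g0; apply; rewrite eg big_seq big1 // => mu mul.
  by apply/eqP; apply: contrapT => /negP F0; apply: noF; exists mu.
exists mu, (F mu); split => //; first exact: BF.
move=> nu zG nu0.
apply: (ss_component sh stable_subspace_of (r := undup l) (F := fun mu => z * F mu)
  (mu := fun mu => nu * mu)) => //.
- exact: undup_uniq.
- by move=> mu' _; apply: zG.
- by move=> mu1 mu2 _ _ /(mulfI nu0).
- by rewrite -mulr_sumr -eg ez divfK.
Qed.

(** Applying a power of [s - nu mu] to [e * g] replaces [g] by an eigenvector [g'] in [B], and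
    eigenvectors in [B] have their inverses in [B]. *)
Lemma stable_contains_eig e nu : e != 0 -> s e = h nu * e -> B e.
Proof.
move=> e0 se.
have [mu [g [Bg g0 gg zg]]] := stable_denominator e.
have nu0 : nu != 0.
  by apply: contraNneq e0 => m0; rewrite -(fmorph_eq0 s) se m0 rmorph0 mul0r.
have Beg : B (e * g).
  apply: (zg nu) => // mu' u gu; apply: geneigM => //.
  by exists 1%N; rewrite /= /shift_op se subrr.
have [m [g'0 g'1]] := geneig_eigenvector g0 gg.
set g' := iter m _ g in g'0 *.
have sg' : s g' = h mu * g' by move: g'1 => /= /eqP; rewrite subr_eq0 => /eqP.
have iterB n mu' u : B u -> B (iter n (shift_op h s mu') u).
  by move=> Bu; elim: n => //= n; apply: (ss_op stable_subspace_of).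
have Bg' : B g' by apply: iterB.
have Beg' : B (e * g').
  have := iterB m (nu * mu) _ Beg.
  have -> : iter m (shift_op h s (nu * mu)) (e * g) = h (nu ^+ m) * (e * g').
    rewrite /g'; elim: (m) => [|n IH]; first by rewrite expr0 rmorph1 mul1r.
    rewrite !iterS IH (shift_opZ sh) exprS /shift_op !rmorphM se; ring.
  move=> /(ssZ stable_subspace_of (nu ^+ m)^-1).
  by rewrite mulrA -rmorphM mulVf ?rmorph1 ?mul1r // expf_neq0.
rewrite -(mulfK g'0 e); have [_ _ SM] := aB; apply: SM => //.
exact: eB sg'.
Qed.

(** Dividing the denominator [g] by its eigenvector [e] gives a unipotent [q] with both [q] and
    [y * q] in [B], and not both constant. Applying [s - 1] to a nonconstant one leads to some [u]
    in [B] with [s u = u + c], [c] a nonzero constant; then [y - u / c] is fixed by [s]. *)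
Lemma stable_contains_additive y : s y = y + 1 -> B y.
Proof.
move=> sy; have [Sc SB SM] := aB.
have [mu [g [Bg g0 gg zg]]] := stable_denominator y.
have Byg : B (y * g).
  apply: (zg 1); last exact: oner_neq0.
  move=> mu' u gu; apply: geneigM => //; exists 2%N.
  by rewrite /= /shift_op !rmorph1 !mul1r rmorphB !sy rmorphD sy rmorph1; ring.
have [m [e0 e1]] := geneig_eigenvector g0 gg.
set e := iter m _ g in e0 *.
have se : s e = h mu * e by move: e1 => /= /eqP; rewrite subr_eq0 => /eqP.
have Bei : B e^-1.
  have ei0 : e^-1 != 0 by rewrite invr_eq0.
  apply: (@stable_contains_eig _ mu^-1 ei0).
  by rewrite fmorphV se invfM fmorphV.
have Bq : B (g / e) by apply: SM.
have Byq : B (y * (g / e)) by rewrite mulrA; apply: SM.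
have q0 : g / e != 0 by rewrite mulf_neq0 ?invr_eq0.
have gq : geneig h s 1 (g / e) by apply: (geneig_divide sh e0 se).
have gyq : geneig h s 1 (y * (g / e)).
  rewrite -[1]mulr1; apply: geneigM => //; exists 2%N.
  by rewrite /= /shift_op !rmorph1 !mul1r rmorphB !sy rmorphD sy rmorph1; ring.
have [u [Bu gu nu]] : exists u, [/\ B u, geneig h s 1 u & forall c, u != h c].
  have [[c ec]|nc] := pselect (exists c, g / e = h c); last first.
    by exists (g / e); split => // c; apply/eqP => ec; apply: nc; exists c.
  exists (y * (g / e)); split => // c'; apply/eqP => ec'.
  have := additive_transcendental sh sy (c' / c).
  by rewrite rmorphM fmorphV -ec -ec' mulfK // eqxx.
have [m' em'] := gu; elim: m' u em' Bu {gu} nu => [|m' IH] u em' Bu nu.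
  by have := nu 0; rewrite rmorph0; move: em' => /= ->; rewrite eqxx.
have [[c ec]|nc] := pselect (exists c, shift_op h s 1 u = h c); last first.
  apply: (IH (shift_op h s 1 u)); [by rewrite -iterSr|exact: (ss_op stable_subspace_of)|].
  by move=> c; apply/eqP => ec; apply: nc; exists c.
have su : s u = u + h c by rewrite -ec /shift_op rmorph1 mul1r addrC subrK.
have c0 : c != 0.
  apply/eqP => c0; have [|c' ec'] := @fix_k u; first by rewrite su c0 rmorph0 addr0.
  by have := nu c'; rewrite ec' eqxx.
have hc0 : h c != 0 by rewrite fmorph_eq0.
have [|c' ec'] := @fix_k (y - u / h c).
  by rewrite rmorphB rmorphM fmorphV sh sy su; field.
rewrite -[y](subrK (u / h c)) ec'; apply: (subalgebraD aB); first exact: Sc.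
by apply: SM => //; rewrite -fmorphV; apply: Sc.
Qed.

End Stable.
End EigenLists.

(** * Stability of [T] under [s] *)

Section PartialLaurent.
Variables (k : closedFieldType) (K : fieldType) (h : {rmorphism k -> K}).
Variable s : {rmorphism K -> K}.
Hypothesis sh : forall c, s (h c) = h c.

(** The additive variable has to be one that is not inverted, since [s] sends [y^-1] to
    [(y + 1)^-1]. *)
Lemma partial_laurent_image d (P : pred 'I_d) (x : 'I_d -> K) (p : 'I_d -> k) :
  (forall i, x i != 0) ->
  (forall i, (s (x i) = h (p i) * x i) \/ (s (x i) = x i + 1 /\ ~~ P i)) ->
  s @` partial_laurent h P x = partial_laurent h P x.
Proof.
move=> x0 sx; rewrite /partial_laurent; set X := (X in gen_subalgebra _ X).
have aS := gen_subalgebraP h X; have [Sc SB SM] := aS.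
have Sx i : gen_subalgebra h X (x i) by apply: sub_gen_subalgebra; left; exists i.
have SxV i : P i -> gen_subalgebra h X (x i)^-1.
  by move=> Pi; apply: sub_gen_subalgebra; right; exists i.
have p0 i : s (x i) = h (p i) * x i -> p i != 0.
  by move=> e; apply: contraNneq (x0 i) => m0; rewrite -(fmorph_eq0 s) e m0 rmorph0 mul0r.
apply/seteqP; split.
  move=> _ [z Sz <-]; move: z Sz.
  apply: (@gen_subalgebra_sub _ _ _ _ [set z | gen_subalgebra h X (s z)]).
    split=> [c|a b|a b] /=; first by rewrite sh; apply: Sc.
      by rewrite rmorphB; apply: SB.
    by rewrite rmorphM; apply: SM.
  move=> _ [[i _ <-]|[i Pi <-]] /=.
    case: (sx i) => [->|[-> _]]; first by apply: (SM).
    by apply: (subalgebraD aS) => //; rewrite -(rmorph1 h); apply: Sc.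
  case: (sx i) => [e|[_]]; last by rewrite Pi.
  by rewrite fmorphV e invfM -fmorphV; apply: (SM) => //; apply: SxV.
apply: (@gen_subalgebra_sub _ _ _ _ (s @` gen_subalgebra h X)).
  split=> [c|_ _ [a Sa <-] [b Sb <-]|_ _ [a Sa <-] [b Sb <-]].
  - by exists (h c).
  - by exists (a - b); rewrite ?rmorphB //; apply: SB.
  - by exists (a * b); rewrite ?rmorphM //; apply: SM.
move=> _ [[i _ <-]|[i Pi <-]].
  case: (sx i) => [e|[e _]].
    exists (h (p i)^-1 * x i); first by apply: (SM).
    by rewrite rmorphM sh e mulrA -rmorphM mulVf ?p0 // rmorph1 mul1r.
  exists (x i - 1); last by rewrite rmorphB rmorph1 e addrK.
  by apply: (SB) => //; rewrite -(rmorph1 h).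
case: (sx i) => [e|[_]]; last by rewrite Pi.
exists (h (p i) * (x i)^-1); first by apply: (SM) => //; apply: SxV.
rewrite rmorphM sh fmorphV e; have hp : h (p i) != 0 by rewrite fmorph_eq0 p0.
by field; rewrite hp x0.
Qed.

End PartialLaurent.

(** * Two-sided orbits *)

Section Orbits.
Variables (k : fieldType) (K : fieldType) (h : {rmorphism k -> K}).
Variables (s : {rmorphism K -> K}) (s_bij : bijective s).
Hypothesis sh : forall c, s (h c) = h c.

Lemma aut_pow_neq0 n v : v != 0 -> aut_pow s n v != 0.
Proof.
move=> v0; apply: contra_neq v0 => e; have := aut_powD s_bij (- n) n v.
rewrite addNr e /= => ->.
have -> : aut_pow s (- n) 0 = 0; last by [].
by have := aut_pow_zmod s_bij (- n) 0 0; rewrite !subrr.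
Qed.

(* Taking the number of spanning translates minimal makes the span of the
   first [n] forward translates stable under the inverse of [s] as well. *)
Lemma two_sided_orbit v n : lcomb h (fun i => iter i s v) n (iter n s v) ->
  exists n, forall i : int, lcomb h (fun i => iter i s v) n (aut_pow s i v).
Proof.
pose u i := iter i s v.
move=> vn; have exN : exists n, `[< lcomb h u n (u n) >] by exists n; apply/asboolP.
case: (ex_minnP exN) => N /asboolP uN Nmin {n vn}.
have sL y : lcomb h u N y -> lcomb h u N (s y).
  move=> [c ->]; rewrite rmorph_sum.
  apply: (big_ind (lcomb h u N)) => [|? ?|i _]; [exact: lcomb0|exact: lcombD|].
  rewrite rmorphM sh; apply: lcombZ.
  have [iN|] := ltnP i.+1 N; first exact: (lcomb_gen h u iN).
  move=> Ni; have -> : s (u i) = u N; last by [].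
  by rewrite /u -iterS; congr (iter _ s v); apply/eqP; rewrite eqn_leq Ni ltn_ord.
have s_inj : injective s by apply: bij_inj.
have [c0 | [z zN sz]] : (N = 0)%N \/ exists2 z, lcomb h u N z & s z = v.
- case: N uN Nmin {sL} => [|N] uN Nmin; [by left|right].
  have [c ec] := uN; rewrite big_ord_recl /= in ec.
  have shift : \sum_(i < N) h (c (lift ord0 i)) * u (lift ord0 i) =
      s (\sum_(i < N) h (c i.+1) * u i).
    by rewrite rmorph_sum; apply: eq_bigr => i _; rewrite rmorphM sh lift0.
  (* If [v] does not occur in the relation, undoing [s] shortens it, against minimality. Otherwise
     the relation is solved for [v], as [s] of a combination of translates. *)
  have [c00|c00] := eqVneq (c 0%N) 0.
    have uN' : lcomb h u N (u N).
      exists (fun i => c i.+1); apply: s_inj.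
      by rewrite -shift ec c00 rmorph0 mul0r add0r.
    suff : (N < N)%N by rewrite ltnn.
    by apply: Nmin; apply/asboolP.
  exists (h (c 0%N)^-1 * (u N - \sum_(i < N) h (c i.+1) * u i)).
    apply: lcombZ; apply: lcombD; first exact: lcomb_gen.
    apply: lcombN; apply: (big_ind (lcomb h u N.+1)) => [|? ?|i _].
    - exact: lcomb0.
    - exact: lcombD.
    - by apply: lcombZ; apply: lcomb_gen; apply: ltnW; rewrite ltnS.
  rewrite rmorphM sh rmorphB -shift ec addrK.
  by rewrite mulrA -rmorphM mulVf // rmorph1 mul1r.
- have v0 : v = 0 by have [c] := uN; rewrite c0 big_ord0.
  exists 0%N => i; rewrite v0.
  have -> : aut_pow s i 0 = 0 by have := aut_pow_zmod s_bij i 0 0; rewrite !subrr.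
  exact: lcomb0.
exists N.
have iV y : lcomb h u N y -> lcomb h u N (aut_inv s y).
  move=> [c ->].
  have -> : aut_inv s (\sum_(i < N) h (c i) * u i) =
      \sum_(i < N) h (c i) * (if i : nat is i'.+1 then u i' else z).
    apply: s_inj; rewrite (aut_invK s_bij) rmorph_sum; apply: eq_bigr => i _.
    by rewrite rmorphM sh; congr (_ * _); case: (nat_of_ord i).
  apply: (big_ind (lcomb h u N)) => [|? ?|i _]; [exact: lcomb0|exact: lcombD|].
  apply: lcombZ; case: i => [[|i] /= iN] //.
  by apply: lcomb_gen; apply: ltnW.
have vN : lcomb h u N v by rewrite -sz; apply: sL.
elim/int_rect => [//|n IH|n IH].
- by have -> : n.+1%:Z = n%:Z + 1; rewrite -?PoszD ?addn1 // -addn1 PoszD aut_powS //; apply: sL.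
- have -> : - n.+1%:Z = - n%:Z - 1 by rewrite -opprD -PoszD addn1.
  by rewrite aut_powP //; apply: iV.
Qed.

Lemma aut_pow_eig mu e n : s e = h mu * e -> e != 0 ->
  exists c, aut_pow s n e = h c * e.
Proof.
move=> se e0.
have mu0 : mu != 0.
  by apply: contraNneq e0 => m0; rewrite -(fmorph_eq0 s) se m0 rmorph0 mul0r.
elim/int_rect: n => [|n [c IH]|n [c IH]].
- by exists 1; rewrite rmorph1 mul1r.
- exists (c * mu); have -> : n.+1%:Z = n%:Z + 1 by rewrite -PoszD addn1.
  by rewrite aut_powS // IH [s _]rmorphM sh se mulrA -rmorphM.
- exists (c / mu); have -> : - n.+1%:Z = - n%:Z - 1 by rewrite -opprD -PoszD addn1.
  rewrite aut_powP // IH; apply: (bij_inj s_bij); rewrite aut_invK //.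
  by rewrite [s _]rmorphM sh se mulrA -rmorphM divfK.
Qed.

End Orbits.

(** * The graded algebra *)

Section GradedQuotient.
Variables (k : closedFieldType) (A : algType k) (A_ : int -> set A).
Variables (K : fieldType) (h : {rmorphism k -> K}).
Variables (s : {rmorphism K -> K}) (s_bij : bijective s).
Variable j : {rmorphism A -> skewLaurent s_bij}.
Hypothesis grA : Zgrading A_.
Hypothesis nzA : forall n : int, exists a : A, A_ n a /\ a != 0.
Hypothesis sh : forall c : k, s (h c) = h c.
Hypothesis grQ :
  graded_quotient_ring A_ (fun c => slC s_bij (h c)) (@sl_degree K s s_bij) j.
Local Notation coef := (@monalg.mcoeff int K).
Local Notation B := (zero_part j).

Lemma j_const (c : k) : j c%:A = slC s_bij (h c).
Proof. exact: (gqr_alg grQ). Qed.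

Lemma j_homogeneous n a : A_ n a -> j a = slmono s_bij n (coef n (j a)).
Proof. by move=> /(gqr_graded grQ)[c _ <-]; rewrite slmono_coef eqxx. Qed.

Lemma j_neq0 n a : A_ n a -> a != 0 -> coef n (j a) != 0.
Proof.
move=> An; apply: contra_neq => e; apply: (gqr_inj grQ).
by rewrite (j_homogeneous An) e !raddf0.
Qed.

Lemma zero_part_subalgebra : subalgebra h B.
Proof.
split=> [c|a b [al ja] [be jb]|a b [al ja] [be jb]].
- by exists c%:A; rewrite j_const.
- by exists (al - be); rewrite rmorphB ja jb /slC raddfB.
- by exists (al * be); rewrite rmorphM ja jb /slC slmonoM.
Qed.

(** Numerator and denominator of a homogeneous fraction share a degree [n]; a nonzero element of
    degree [- n] brings both to degree 0. *)
Lemma zero_part_fraction z : exists a b, [/\ B a, B b, b != 0 & z = a / b].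
Proof.
have [a [t [[n _ tn] t0 e]]] := gqr_right_fraction grQ (slC s_bij z).
have [b [bn b0]] := nzA (- n).
have jt := j_homogeneous tn; have jb := j_homogeneous bn.
have ct := j_neq0 tn t0; have cb := j_neq0 bn b0.
set c := coef n (j t) in jt ct; set c' := coef _ (j b) in jb cb.
have c'0 := aut_pow_neq0 s_bij n cb.
exists (z * (c * aut_pow s n c')), (c * aut_pow s n c'); split.
- by exists (a * b); rewrite rmorphM -e jt jb /slC !slmonoM add0r subrr mulrA.
- by exists (t * b); rewrite rmorphM jt jb slmonoM subrr.
- by rewrite mulf_neq0.
- by rewrite mulfK // mulf_neq0.
Qed.

(** The list of degrees in [gr_sum] may repeat; a repeated term is then taken with its
    multiplicity. *)
Lemma sum_by_degree (r : seq int) (x : int -> A) : (forall n, A_ n (x n)) ->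
  exists2 x' : int -> A, forall n, A_ n (x' n) &
    \sum_(n <- r) x n = \sum_(n <- undup r) x' n.
Proof.
move=> xA; exists (fun n => x n *+ count_mem n r); last first.
  by rewrite big_undup_iterop_count; apply: eq_bigr.
move=> n; have sA := gr_subspace grA n.
elim: (count_mem n r) => [|m IH]; first by rewrite mulr0n; exact: sA.1.
by rewrite mulrS; apply: subspaceD.
Qed.

Lemma zero_part_degree0 z : B z -> (j @` A_ 0) (slC s_bij z).
Proof.
move=> [a ja]; have [r [x [xA ea]]] := gr_sum grA a.
have [x' x'A ex'] := sum_by_degree r xA.
have x'0 n : n \in undup r -> n != 0 -> x' n = 0.
  move=> nr n0; apply/eqP; apply: contrapT => /negP x'n.
  have := j_neq0 (x'A n) x'n; apply/negP/negPn/eqP.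
  have := congr1 (coef n) ja.
  rewrite ea ex' raddf_sum sl_coef_sum /slC slmono_coef eq_sym (negPf n0) => e.
  rewrite -[RHS]e (bigD1_seq n) ?undup_uniq //= big1 ?addr0 // => m mn.
  by rewrite (j_homogeneous (x'A m)) slmono_coef (negPf mn).
exists a => //; rewrite ea ex'.
have [r0|r0] := boolP (0 \in undup r).
  rewrite (bigD1_seq 0) ?undup_uniq //= big_seq_cond big1 ?addr0 //.
  by move=> n /andP[]; exact: x'0.
rewrite big_seq big1; first exact: (gr_subspace grA 0).1.
by move=> n nr; apply: x'0 => //; apply: contraNneq r0 => <-.
Qed.

Lemma degree0_zero_part q : (j @` A_ 0) q -> exists2 z, B z & q = slC s_bij z.
Proof.
move=> [a a0 <-]; exists (coef 0 (j a)); last exact: j_homogeneous.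
by exists a; exact: j_homogeneous.
Qed.

Lemma coef_mul_closed (L : set K) f g : subalgebra h L ->
  (forall n z, L z -> L (aut_pow s n z)) ->
  (forall n, L (coef n f)) -> (forall n, L (coef n g)) ->
  forall n, L (coef n ((f : skewLaurent s_bij) * g)).
Proof.
move=> aL sL Lf Lg n; have [Lc LB LM] := aL.
have L0 : L 0 by rewrite -(rmorph0 h).
have -> : (f : skewLaurent s_bij) * g = slmul f g by [].
rewrite /slmul sl_coef_sum; apply: (big_ind L) => [//|a b|m _]; first exact: (subalgebraD aL).
rewrite sl_coef_sum; apply: (big_ind L) => [//|a b|m' _]; first exact: (subalgebraD aL).
rewrite slmono_coef.
by case: eqP => // _; apply: (LM) => //; apply: sL.
Qed.

Hypothesis cenQ : center (skewLaurent s_bij) = range (fun c => slC s_bij (h c)).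

(** A fixed element commutes with every power of [t], hence is central. *)
Lemma fixed_in_k a : s a = a -> exists c, a = h c.
Proof.
move=> sa.
have sna n : aut_pow s n a = a.
  elim/int_rect: n => [//|n IH|n IH].
    have -> : n.+1%:Z = n%:Z + 1 by rewrite -PoszD addn1.
    by rewrite aut_powS // IH.
  have -> : - n.+1%:Z = - n%:Z - 1 by rewrite -opprD -PoszD addn1.
  by rewrite aut_powP // IH; apply: (bij_inj s_bij); rewrite aut_invK.
have : center (skewLaurent s_bij) (slC s_bij a).
  move=> q; rewrite [q]slmonoE mulr_suml mulr_sumr; apply: eq_bigr => n _.
  by rewrite /slC !slmonoM addr0 add0r sna mulrC.
rewrite cenQ => -[c _ e]; exists c; exact/esym/(slmono_inj e).
Qed.

(** * Consequences of simplicity *)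

Section Simple.
Hypothesis simA : simple_ring A.
Hypothesis fin : forall v, B v ->
  exists n, lcomb h (fun i => iter i s v) n (iter n s v).

Lemma simple_zero_part_stable v i : B v -> B (aut_pow s i v).
Proof.
move=> Bv; have [_ /(two_sided_orbit s_bij sh)[N vN]] := fin Bv.
have [tA [tA1 tA0]] := nzA 1.
have jt := j_homogeneous tA1; set tau := coef 1 (j tA) in jt.
have tau0 : tau != 0 := j_neq0 tA1 tA0.
have [va jva] := Bv.
(* This ideal is nonzero: it contains [tA ^+ N], since the [s]-orbit of [v] is
   spanned by the translates [s^l v = t^l v t^(-l)] with [l < N]. *)
pose I := [set al : A | forall i, exists be, j be = slC s_bij (aut_pow s i v) * j al].
have idI : two_sided_ideal I.
  split.
  - by move=> i'; exists 0; rewrite !rmorph0 mulr0.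
  - move=> a b Ia Ib i'; have [a' ea] := Ia i'; have [b' eb] := Ib i'.
    by exists (a' + b'); rewrite !rmorphD ea eb mulrDr.
  - move=> b a Ia; split=> i'; last first.
      by have [a' ea] := Ia i'; exists (a' * b); rewrite !rmorphM ea mulrA.
    have [r [x [xA ->]]] := gr_sum grA b.
    (* Moving [s^i' v] to the right past [x n], of degree [n], turns it into [s^(i' - n) v]. This is
       why the ideal involves translates of either sign. *)
    have /choice[y yP] n := Ia (- n + i').
    exists (\sum_(n <- r) x n * y n); rewrite mulr_suml !rmorph_sum mulr_sumr.
    apply: eq_bigr => n _; rewrite !rmorphM /= yP !mulrA; congr (_ * _).
    rewrite (j_homogeneous (xA n)) /slC !slmonoM addr0 add0r -aut_powD //.
    by rewrite addrA subrr add0r mulrC.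
have It : I (tA ^+ N).
  move=> i'; have [c ->] := vN i'.
  have jtN : j (tA ^+ N) = slmono s_bij N (skew_power s tau N).
    rewrite rmorphXn jt; elim: N {vN c} => [|N IH]; first by rewrite expr0.
    by rewrite exprS IH slmonoM /= -add1n PoszD.
  have /choice[y yP] (l : 'I_N) : exists y, j y = slC s_bij (iter l s v) * j (tA ^+ N).
    have jV a : a \in [:: va] -> j a = slC s_bij v by rewrite inE => /eqP ->.
    have [|w [_ _ jw]] := word_realization jt (kap := fun=> v) jV (n := N) (l := [:: (l : nat, va)]).
      by move=> q; rewrite inE => /eqP -> /=; rewrite ltnW // mem_head.
    by exists (\prod_(a <- w) a); rewrite jw jtN big_seq1 /slC slmonoM add0r.
  exists (\sum_(l < N) c l *: y l); rewrite raddf_sum /slC raddf_sum mulr_suml.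
  apply: eq_bigr => l _; rewrite /= (j_scale j_const) yP mulrA /slC slmonoM.
  by rewrite add0r.
have [I0|IT] := simA idI.
  have : tA ^+ N = 0 by move: It; rewrite I0.
  move/(congr1 (fun a => coef N (j a))); rewrite rmorph0 monalg.mcoeff0 rmorphXn jt.
  have -> : slmono s_bij 1 tau ^+ N = slmono s_bij N (skew_power s tau N).
    by elim: N {vN It} => [|N IH]; rewrite ?expr0 // exprS IH slmonoM /= -add1n PoszD.
  rewrite slmono_coef eqxx => /eqP; rewrite (negPf (skew_power_neq0 s N tau0)) //.
have : I 1 by rewrite IT.
by move=> /(_ i)[be]; rewrite rmorph1 mulr1; exists be.
Qed.

Lemma simple_eig_inverse e mu : e != 0 -> B e -> s e = h mu * e -> B e^-1.
Proof.
move=> e0 [al jal] se.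
(* An eigenvector is normal in [A], so it generates this two-sided ideal. *)
pose I := [set be : A | exists ga, j be = slC s_bij e * j ga].
have idI : two_sided_ideal I.
  split.
  - by exists 0; rewrite !rmorph0 mulr0.
  - by move=> a b [ga ea] [gb eb]; exists (ga + gb); rewrite !rmorphD ea eb mulrDr.
  - move=> b a [ga ea]; split; last by exists (ga * b); rewrite !rmorphM ea mulrA.
    have [r [x [xA ->]]] := gr_sum grA b.
    have /choice[c cP] n := aut_pow_eig s_bij sh n se e0.
    exists (\sum_(n <- r) (c n *: x n) * ga); rewrite mulr_suml !rmorph_sum mulr_sumr.
    apply: eq_bigr => n _; rewrite !rmorphM /= ea (j_scale j_const) !mulrA; congr (_ * _).
    rewrite (j_homogeneous (xA n)) /slC !slmonoM addr0 !add0r cP; congr slmono.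
    by rewrite /= [RHS]mulrC; congr (_ * _); rewrite mulrC.
have Ial : I al by exists 1; rewrite rmorph1 mulr1.
have [I0|IT] := simA idI.
  have al0 : al = 0 by move: Ial; rewrite I0.
  move: jal; rewrite al0 rmorph0 => /(congr1 (coef 0)).
  by rewrite monalg.mcoeff0 /slC slmono_coef => /esym/eqP; rewrite (negPf e0).
have : I 1 by rewrite IT.
move=> [ga]; rewrite rmorph1 => ega; exists ga.
have : slC s_bij e^-1 * 1 = slC s_bij e^-1 * (slC s_bij e * j ga) by rewrite -ega.
rewrite mulr1 mulrA => ->; rewrite /slC slmonoM add0r /= mulVf //.
by rewrite -[LHS]mul1r.
Qed.

End Simple.

(** * Finite generation of [K] *)

Section Generation.
Variable Y : set K.
Hypothesis sY : forall y, Y y -> s y = y + 1.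
Hypothesis YG : forall u, geneig h s 1 u -> gen_subalgebra h Y u.
Hypothesis fin : forall v, B v -> exists l, shift_ops h s l v = 0.
Hypothesis fgA : finitely_generated A.

Lemma field_eig_seq z : exists2 E, eig_seq h s E & gen_subfield h ([set` E] `|` Y) z.
Proof.
have [a [b [/fin[l la] /fin[l' lb] b0 ->]]] := zero_part_fraction z.
have [E eE Ea] := finite_orbit_eig_seq sh YG la.
have [E' eE' Eb] := finite_orbit_eig_seq sh YG lb.
exists (E ++ E'); first exact: eig_seq_cat.
have [[Sc SB SM] SV] := gen_subfieldP h ([set` E ++ E'] `|` Y).
apply: (SM).
  by apply: gen_subfield_eig_mono Ea => c cE; rewrite mem_cat cE.
by apply: (SV); apply: gen_subfield_eig_mono Eb => c cE; rewrite mem_cat cE orbT.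
Qed.

Lemma field_eig_seqs (t : seq K) : exists2 E, eig_seq h s E &
  forall z, z \in t -> gen_subfield h ([set` E] `|` Y) z.
Proof.
elim: t => [|z t [E eE Et]]; first by exists [::].
have [E' eE' Ez] := field_eig_seq z.
exists (E' ++ E); first exact: eig_seq_cat.
move=> y; rewrite inE => /orP[/eqP ->|/Et].
  by apply: gen_subfield_eig_mono Ez => c cE; rewrite mem_cat cE.
by apply: gen_subfield_eig_mono => c cE; rewrite mem_cat cE orbT.
Qed.

(** The coefficients of the generators of [A] lie in a field [L] generated by [Y] and finitely many
    eigenvectors. As [L] is stable under [s] and its inverse, it contains the coefficients of all
    products, in degrees of either sign, hence [A_0] and its fractions. *)
Lemma field_generated : exists2 E, eig_seq h s E & gen_subfield h ([set` E] `|` Y) = setT.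
Proof.
have [gs gsP] := fgA.
have [E eE Et] := field_eig_seqs
  (flatten [seq [seq coef n (j g) | n <- finmap.enum_fset (@monalg.msupp int K (j g))] | g <- gs]).
exists E => //; set L := gen_subfield _ _ in Et *.
have [aL LV] : subfield h L := gen_subfieldP _ _; have [Lc LB LM] := aL.
have L0 : L 0 by rewrite -(rmorph0 h).
have sL n z : L z -> L (aut_pow s n z).
  move=> Lz; elim/int_rect: n => [//|n IH|n IH].
    have -> : n.+1%:Z = n%:Z + 1 by rewrite -PoszD addn1.
    by rewrite aut_powS //; apply: (eig_field_s sh sY eE).
  have -> : - n.+1%:Z = - n%:Z - 1 by rewrite -opprD -PoszD addn1.
  rewrite aut_powP //; have [w Lw <-] := eig_field_sV sh sY eE IH.
  by rewrite autK.
have AL a : forall n, L (coef n (j a)).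
  have : gen_subalgebra (in_alg A) [set` gs] a by rewrite gsP.
  apply: (@gen_subalgebra_sub _ _ _ _ [set a | forall n, L (coef n (j a))]).
    split.
    - by move=> c n; rewrite j_const /slC slmono_coef; case: eqP.
    - by move=> b c Lb Lc' n; rewrite rmorphB monalg.mcoeffB; apply: (LB).
    - by move=> b c Lb Lc' n; rewrite rmorphM; apply: coef_mul_closed.
  move=> g gg n; have [nd|nd] := boolP (n \in finmap.enum_fset (@monalg.msupp int K (j g))); last first.
    by rewrite monalg.mcoeff_outdom.
  apply: Et; apply/flattenP; exists [seq coef n (j g) | n <- finmap.enum_fset (@monalg.msupp int K (j g))].
    exact: map_f.
  exact: (map_f (fun n => coef n (j g))).
have BL z : B z -> L z by move=> [a ja]; have := AL a 0; rewrite ja /slC slmono_coef.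
apply/seteqP; split=> // z _; have [a [b [Ba Bb b0 ->]]] := zero_part_fraction z.
by apply: (LM); [apply: BL|apply: (LV); apply: BL].
Qed.

End Generation.
End GradedQuotient.

(** * Number of generators, and the two cases *)

Lemma algebraic_over_setT (K : fieldType) (F : set K) (y : K) : F = setT -> algebraic_over F y.
Proof.
move=> ->; exists ('X - y%:P); split=> //; first by rewrite polyXsubC_eq0.
by rewrite root_XsubC.
Qed.

Lemma trdeg_unique (k K : fieldType) (h : {rmorphism k -> K}) d m (x : 'I_m -> K) :
  trdeg_eq h d -> alg_indep h x -> gen_subfield h (range x) = setT -> m = d.
Proof.
move=> [z [zi Kalg]] xi gx; apply/eqP; rewrite eqn_leq (trdeg_le xi Kalg).
by rewrite (trdeg_le zi (fun y => algebraic_over_setT y gx)).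
Qed.

Theorem theorem1p2 (R : realType) (k : closedFieldType) (A : algType k)
    (A_ : int -> set A) (d : nat)
    (K : fieldType) (h : {rmorphism k -> K})
    (s : {rmorphism K -> K}) (s_bij : bijective s)
    (j : {rmorphism A -> skewLaurent s_bij}) :
  Zgrading A_ ->
  finitely_generated A ->
  (forall n : int, exists a : A, A_ n a /\ a != 0) ->
  Ore_domain A ->
  (forall c : k, s (h c) = h c) ->
  graded_quotient_ring A_ (fun c => slC s_bij (h c)) (@sl_degree K s s_bij) j ->
  trdeg_eq h d ->
  GKdim R A = (d.+1%:R)%:E ->
  center (skewLaurent s_bij) = range (fun c => slC s_bij (h c)) ->
  exists (x : 'I_d -> K) (T : set K),
    [/\ alg_indep h x /\ gen_subfield h (range x) = setT,
        j @` A_ 0 `<=` slC s_bij @` T,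
        s @` T = T,
        case_A h s x T \/ case_B h s x T
      & simple_ring A -> j @` A_ 0 = slC s_bij @` T].
Proof.
move=> grA fgA nzA _ sh grQ trd GK cenQ.
have fixk := fixed_in_k cenQ.
have frac := zero_part_fraction nzA grQ.
have aB := zero_part_subalgebra grQ.
have fin0 v : zero_part j v -> exists n, lcomb h (fun i => iter i s v) n (iter n s v).
  have [tA [tA1 tA0]] := nzA 1.
  apply: (zero_part_orbit_finite (R := R) (j_const grQ) (j_homogeneous grQ tA1) (j_neq0 grQ tA1 tA0) trd _ frac).
  by rewrite GK.
have fin v : zero_part j v -> exists l, shift_ops h s l v = 0.
  by move=> /fin0[n]; apply: orbit_shift_ops.
have sub0 (T : set K) : zero_part j `<=` T -> j @` A_ 0 `<=` slC s_bij @` T.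
  by move=> BT q /(degree0_zero_part grQ)[z /BT Tz ->]; exists z.
have simple_eq (T : set K) : zero_part j `<=` T -> (simple_ring A -> T `<=` zero_part j) ->
    simple_ring A -> j @` A_ 0 = slC s_bij @` T.
  move=> BT TB sA; apply/seteqP; split; first exact: sub0.
  by move=> _ [z /(TB sA) Bz <-]; apply: (zero_part_degree0 grA grQ).
have sB (sA : simple_ring A) z : zero_part j z -> zero_part j (s z).
  exact: (simple_zero_part_stable grA nzA sh grQ sA fin0 1).
have eigB (sA : simple_ring A) e mu : e != 0 -> s e = h mu * e -> zero_part j e.
  apply: (stable_contains_eig sh aB (sB sA) fin frac).
  by move=> e' mu' e'0 Be' se'; apply: (simple_eig_inverse grA sh grQ sA e'0 Be' se').
have addB (sA : simple_ring A) y : s y = y + 1 -> zero_part j y.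
  apply: (stable_contains_additive sh fixk aB (sB sA) fin frac).
  by move=> e' mu' e'0 Be' se'; apply: (simple_eig_inverse grA sh grQ sA e'0 Be' se').
have eigV e mu : e != 0 -> s e = h mu * e -> s e^-1 = h mu^-1 * e^-1.
  by move=> e0 se; rewrite !fmorphV se invfM.
(* Solvability of [s y = y + 1] decides between (A) and (B). *)
have [[y sy]|noy] := pselect (exists y, s y = y + 1).
- have sY y' : [set y] y' -> s y' = y' + 1 by move=> ->.
  have YG := geneig1_additive sh fixk sy.
  have [E eE gE] := field_generated nzA sh grQ sY YG fin fgA.
  have [p0 x0p0] := eig_seq_generators eE gE.
  have [m [x [p [xp free]]]] := free_generators fixk x0p0.
  have [x0 sx gx] := xp.
  pose x' := adjoin_first x y.
  have x'i : alg_indep h x' := eig_additive_alg_indep sh x0 sx free sy.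
  have x'0 : x' ord0 = y by rewrite /x' /adjoin_first unlift_none.
  have x'l l : x' (lift ord0 l) = x l by rewrite /x' /adjoin_first liftK.
  have gx' : gen_subfield h (range x') = setT.
    apply/seteqP; split=> // z _; have : gen_subfield h (range x `|` [set y]) z by rewrite gx.
    apply: gen_subfield_sub; first exact: gen_subfieldP.
    by move=> a [[l _ <-]|->]; apply: sub_gen_subfield; [exists (lift ord0 l)|exists ord0].
  (* [y] is one of the [d] variables, so [d = m + 1]. *)
  have dm := trdeg_unique trd x'i gx'; subst d.
  pose P := [pred i : 'I_m.+1 | (0 < i)%N].
  pose T := partial_laurent h P x'.
  have Tx i : T (x' i) by apply: sub_gen_subalgebra; left; exists i.
  have BT : zero_part j `<=` T.
    move=> v /fin[l el].
    apply: (finite_orbit_subalgebra sh fixk sY YG xp (gen_subalgebraP _ _) _ _ el).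
      move=> i; rewrite -x'l; split; first exact: Tx.
      by apply: sub_gen_subalgebra; right; exists (lift ord0 i).
    by move=> _ ->; have := Tx ord0; rewrite x'0.
  exists x', T; split => //.
  + exact: sub0.
  + pose p' i := if unlift ord0 i is Some l then p l else 1.
    apply: (partial_laurent_image sh (p := p')) => i.
      exact: alg_indep_neq0 x'i i.
    rewrite /p'; case: (unliftP ord0 i) => [l|] ->; first by left; rewrite x'l.
    by right; rewrite x'0.
  + left; split => //.
    * split=> // i i0; have -> : i = ord0 by apply: val_inj.
      by rewrite x'0.
    (* The value 1 at index 0 is a filler: [P] excludes that index. *)
    * exists (fun i => if unlift ord0 i is Some l then p l else 1); split; last first.
        move=> i; case: (unliftP ord0 i) => [l|] -> //=.
        by rewrite x'l.
      split=> [i|n]; first by case: unliftP => [l|] _ _; [exact: (eig_neq0 x0 sx)|exact: oner_neq0].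
      rewrite big_mkcond big_ord_recl /= mul1r => e i.
      case: (unliftP ord0 i) => [l|] -> //= _.
      apply: (free (fun l => n (lift ord0 l))); rewrite -[RHS]e; apply: eq_bigr => l' _.
      by rewrite liftK.
    * exact: (additive_char0 sh fixk sy).
  + apply: simple_eq => // sA; apply: gen_subalgebra_sub => // a [[i _ <-]|[i Pi <-]].
      case: (unliftP ord0 i) => [l|] ->; last by rewrite x'0; apply: addB.
      by rewrite x'l; apply: (eigB sA _ (p l)).
    move: Pi; case: (unliftP ord0 i) => [l|] -> // _.
    by rewrite x'l; apply: (eigB sA _ (p l)^-1); rewrite ?invr_eq0 //; apply: eigV.
- have noy' y : s y != y + 1 by apply/eqP => e; apply: noy; exists y.
  have sY y' : set0 y' -> s y' = y' + 1 by [].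
  have YG u : geneig h s 1 u -> gen_subalgebra h set0 u.
    move=> /(geneig1_const sh fixk noy')[c ->].
    by have [Sc _ _] := gen_subalgebraP h set0; apply: Sc.
  have [E eE gE] := field_generated nzA sh grQ sY YG fin fgA.
  have [p0 x0p0] := eig_seq_generators eE gE.
  have [m [x [p [xp free]]]] := free_generators fixk x0p0.
  have [x0 sx gx] := xp; rewrite setU0 in gx.
  have xi : alg_indep h x := eig_alg_indep sh x0 sx free.
  have dm := trdeg_unique trd xi gx; subst d.
  pose T := partial_laurent h predT x.
  have Tx i : T (x i) by apply: sub_gen_subalgebra; left; exists i.
  have TxV i : T (x i)^-1 by apply: sub_gen_subalgebra; right; exists i.
  have BT : zero_part j `<=` T.
    move=> v /fin[l el].
    have TxVx i : T (x i) /\ T (x i)^-1 by split; [exact: Tx|exact: TxV].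
    by apply: (finite_orbit_subalgebra sh fixk sY YG xp (gen_subalgebraP _ _) TxVx _ el).
  exists x, T; split => //.
  + exact: sub0.
  + by apply: (partial_laurent_image sh (p := p)) => // i; left.
  + right; split => //; exists p; split => //; split=> [i _|n e i _].
      exact: (eig_neq0 x0 sx).
    exact: free e i.
  + apply: simple_eq => // sA; apply: gen_subalgebra_sub => // a [[i _ <-]|[i Pi <-]].
      exact: (eigB sA _ (p i)).
    by apply: (eigB sA _ (p i)^-1); rewrite ?invr_eq0 //; apply: eigV.
Qed.
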